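(* Let $n\ge 3$ be an integer, let $\omega>0$, and let $\alpha,\beta:[0,\omega]\to\mathbb{R}$ be continuous functions with $\beta(t)\le 0$ for all $t\in[0,\omega]$. Then the differential equation $$\dot z = z^{n}+\alpha(t)z^{n-1}+\beta(t)z^{n-2},\qquad z\in\mathbb{C},$$ has exactly $n$ (complex-valued) periodic solutions, counted with multiplicity.
   Context: Here $t\in[0,\omega]$ is real and $z=z(t)$ is complex-valued. For $c\in\mathbb{C}$ let $z(t,c)$ denote the solution with $z(0,c)=c$. Let $Q\subset\mathbb{C}$ be the (open) set of all $c$ such that $z(t,c)$ is defined for all $t\in[0,\omega]$, and define the displacement function $q:Q\to\mathbb{C}$, $q(c)=z(\omega,c)-c$, which is holomorphic on $Q$. A periodic solution is a solution defined on $[0,\omega]$ with $z(0)=z(\omega)$, i.e. $z(t,c)$ with $c\in Q$ and $q(c)=0$ (the coefficients need not be periodic). The multiplicity of a periodic solution $\varphi$ is the multiplicity of $\varphi(0)$ as a zero of $q$. *)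

(* Defs.v *)
From Stdlib Require Import Reals List ClassicalEpsilon.
From Coquelicot Require Import Coquelicot.

Open Scope R_scope.

Definition interval (omega : R) (t : R) : Prop := 0 <= t <= omega.

(* The derivative is taken within [0, omega], hence one-sided at the endpoints;
   values of z outside [0, omega] are irrelevant. *)
Definition is_solution (F : R -> C -> C) (omega : R) (z : R -> C) : Prop :=
  forall t, interval omega t ->
    filterdiff (K := R_AbsRing) (U := R_NormedModule) (V := C_R_NormedModule)
      z (within (interval omega) (locally t)) (fun s => scal s (F t (z t))).

Definition Q (F : R -> C -> C) (omega : R) (c : C) : Prop :=
  exists z, is_solution F omega z /\ z 0 = c.

(* The solution z(., c), determined on [0, omega] when c is in Q F omega and F is
   locally Lipschitz; an arbitrary function when c is not in Q F omega. *)
Definition sol (F : R -> C -> C) (omega : R) (c : C) : R -> C :=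
  epsilon (inhabits (fun _ => RtoC 0))
    (fun z => is_solution F omega z /\ z 0 = c).

(* The displacement function; only meaningful on Q F omega. *)
Definition q (F : R -> C -> C) (omega : R) (c : C) : C :=
  (sol F omega c omega - c)%C.

Definition periodic_solution (F : R -> C -> C) (omega : R) (z : R -> C) : Prop :=
  is_solution F omega z /\ z 0 = z omega.

Definition holomorphic_at (g : C -> C) (c : C) : Prop :=
  locally c (fun w => ex_derive (K := C_AbsRing) (V := C_NormedModule) g w).

(* f is a function on D, c is interior to D, and f(w) = (w - c)^m g(w) near c
   with g holomorphic at c and g(c) <> 0. *)
Definition zero_multiplicity
    (D : C -> Prop) (f : C -> C) (c : C) (m : nat) : Prop :=
  exists g : C -> C,
    holomorphic_at g c /\ g c <> RtoC 0 /\
    locally c (fun w => D w /\ f w = ((w - c) ^ m * g w)%C).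

Definition multiplicity
    (F : R -> C -> C) (omega : R) (phi : R -> C) (m : nat) : Prop :=
  zero_multiplicity (Q F omega) (q F omega) (phi 0) m.

Definition same_on (omega : R) (phi psi : R -> C) : Prop :=
  forall t, interval omega t -> phi t = psi t.

(* L lists the periodic solutions, each paired with its multiplicity, without
   omission or repetition. *)
Definition exactly_periodic_solutions
    (F : R -> C -> C) (omega : R) (n : nat) : Prop :=
  exists L : list ((R -> C) * nat),
    List.Forall (fun p => periodic_solution F omega (fst p) /\
                          multiplicity F omega (fst p) (snd p)) L /\
    ForallOrdPairs (fun p p' => ~ same_on omega (fst p) (fst p')) L /\
    (forall psi, periodic_solution F omega psi ->
       List.Exists (fun p => same_on omega psi (fst p)) L) /\
    list_sum (map snd L) = n.

(* Main.v *)
Require Import Defs.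
From Stdlib Require Import Reals Lra Lia Psatz List.
From Stdlib Require Import Classical ClassicalEpsilon FunctionalExtensionality PropExtensionality.
From Coquelicot Require Import Coquelicot.
Open Scope R_scope.

(** Along a zero-free periodic solution, [z ^ (2 - n) / (2 - n)] is a primitive of
    [z + alpha + beta / z].  Since [beta <= 0], the imaginary part of the latter vanishes
    only when [z] is real, and on either real half-line it is strictly increasing in [z];
    by Rolle, every nonzero periodic solution is real, and there is at most one of each
    sign.  The same monotonicity, applied to the linearised equation, shows that it is
    simple.

    The multiplicity of [0] is read off by writing [z = c y] and integrating the equation
    of [y] over the period: it is [n - 2] when [beta] is not identically zero; for
    [beta = 0] it is [n - 1] when [alpha] has nonzero integral and [n] otherwise.
    The sign of the leading coefficient of [q] at [0] makes a small solution a strict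
    lower solution; a large constant is an upper solution, and as solutions do not blow up
    backward in time, the backward Poincare map has a fixed point in between.  This yields
    both nonzero solutions in the first case, one in the second, none in the third. *)

(** * Functions of a real variable with complex values *)

(** Multiplicity asks for a holomorphic quotient of [q] by a power of [c - phi 0]. No theory of
    holomorphic functions is used for this division: for a nearby solution [w + h y], the divided
    difference [y] solves an equation that is polynomial in [y] and [h] and still makes sense at
    [h = 0], so its final value is complex differentiable in [h]. Near the zero solution, the
    remaining powers of [h] are pulled out of the integrand before integrating. Differentiability is
    carried as a uniform quadratic remainder, which passes through products, integrals and Gronwall
    estimates with explicit constants. Coefficients and solutions are frozen outside [[0, omega]] by
    [clamp]. Continuity can then be stated on the whole line and the equation only inside the open
    interval; the one-sided derivatives at the ends come back from the integral equation. Truncated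
    equations are globally Lipschitz, so global Picard iteration is the only existence theorem
    needed. *)

Definition clamp (omega t : R) : R := Rmax 0 (Rmin t omega).

Lemma clamp_interval omega t : 0 <= omega -> interval omega (clamp omega t).
Proof.
  intros H; unfold interval, clamp, Rmax, Rmin.
  destruct (Rle_dec t omega); destruct (Rle_dec 0 _); lra.
Qed.

Lemma clamp_id omega t : interval omega t -> clamp omega t = t.
Proof.
  unfold interval, clamp, Rmax, Rmin; intros H.
  destruct (Rle_dec t omega); destruct (Rle_dec 0 _); lra.
Qed.

Lemma clamp_idem omega t :
  0 <= omega -> clamp omega (clamp omega t) = clamp omega t.
Proof. intros H; apply clamp_id, clamp_interval, H. Qed.

Lemma clamp_dist omega s t :
  Rabs (clamp omega s - clamp omega t) <= Rabs (s - t).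
Proof.
  unfold clamp, Rmax, Rmin, Rabs.
  destruct (Rle_dec s omega); destruct (Rle_dec t omega);
    repeat destruct (Rle_dec 0 _); repeat destruct (Rcase_abs _); lra.
Qed.

Lemma continuous_eps (f : R -> R) t :
  continuous f t <->
  (forall eps : posreal, exists d : posreal,
     forall s, Rabs (s - t) < d -> Rabs (f s - f t) < eps).
Proof.
  split.
  - intros H eps.
    destruct (proj1 (filterlim_locally f (f t)) H eps) as [d Hd].
    exists d; intros s Hs; apply (Hd s Hs).
  - intros H; apply filterlim_locally; intros eps.
    destruct (H eps) as [d Hd]; exists d; intros s Hs; apply (Hd s Hs).
Qed.

Lemma continuous_of_lipschitz1 (f : R -> R) t :
  (forall s, Rabs (f s - f t) <= Rabs (s - t)) -> continuous f t.
Proof.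
  intros H; apply continuous_eps; intros eps; exists eps; intros s Hs.
  eapply Rle_lt_trans; [apply H | exact Hs].
Qed.

Lemma continuous_clamp omega t : continuous (clamp omega) t.
Proof. apply continuous_of_lipschitz1; intros s; apply clamp_dist. Qed.

Lemma locally_interior omega t :
  0 < t < omega -> locally t (fun s => 0 < s < omega).
Proof.
  intros [H0 H1].
  apply filter_and; [apply (open_gt 0) | apply (open_lt omega)]; assumption.
Qed.

Lemma clamp_locally omega t :
  0 < t < omega -> locally t (fun s => clamp omega s = s).
Proof.
  intros H; generalize (locally_interior omega t H).
  apply filter_imp; intros s Hs; apply clamp_id; unfold interval; lra.
Qed.

Lemma continuous_comp_clamp omega (f : R -> R) t :
  (forall s, continuous f s) -> continuous (fun s => f (clamp omega s)) t.
Proof.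
  intros H; apply (continuous_comp (clamp omega) f);
    [apply continuous_clamp | apply H].
Qed.

(** [clamp] is 1-Lipschitz with values in the interval, so continuity within the interval becomes
    continuity on the line. *)
Lemma continuous_on_clamp omega (f : R -> R) t :
  0 <= omega -> continuous_on (interval omega) f ->
  continuous (fun s => f (clamp omega s)) t.
Proof.
  intros H0 H; apply filterlim_locally; intros eps.
  specialize (H _ (clamp_interval omega t H0)).
  destruct (proj1 (filterlim_locally f _) H eps) as [d Hd].
  exists d; intros s Hs; apply Hd.
  - eapply Rle_lt_trans; [apply clamp_dist | exact Hs].
  - apply clamp_interval, H0.
Qed.

Lemma bounded_clamp omega (f : R -> R) :
  0 <= omega -> (forall s, continuous f s) ->
  exists B, 0 <= B /\ forall t, Rabs (f (clamp omega t)) <= B.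
Proof.
  intros H0 H.
  destruct (continuity_ab_maj (fun t => Rabs (f t)) 0 omega H0) as [M [HM _]].
  - intros c _; apply continuity_pt_filterlim.
    apply (continuous_comp f Rabs); [apply H | apply continuous_Rabs].
  - exists (Rabs (f M)); split; [apply Rabs_pos|].
    intros t; apply HM, clamp_interval, H0.
Qed.

(** * Monotonicity and mean values from derivatives inside the interval *)

Lemma decreasing_of_derive_nonpos (f df : R -> R) (a b : R) :
  a <= b -> (forall t, continuous f t) ->
  (forall t, a < t < b -> is_derive f t (df t)) ->
  (forall t, a < t < b -> df t <= 0) -> f b <= f a.
Proof.
  intros Hab Hc Hd Hn.
  destruct (Req_dec a b) as [->|Hne]; [lra|].
  (* [MVT_gen] places its point only in the closed interval, and nothing is known of [df] at the
     ends; the patched derivative is nonpositive everywhere. *)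
  destruct (MVT_gen f a b (fun t => if Rle_dec (df t) 0 then df t else 0))
    as [c [Hc1 Hc2]].
  - rewrite Rmin_left, Rmax_right by lra; intros x Hx.
    destruct (Rle_dec (df x) 0) as [_|n]; [apply Hd, Hx|].
    destruct n; apply Hn, Hx.
  - intros x _; apply continuity_pt_filterlim, Hc.
  - destruct (Rle_dec (df c) 0); nra.
Qed.

(** The point is strictly inside, where the differential equation holds. This is the form of Rolle's
    theorem applied to periodic solutions. *)
Lemma mean_value_interior (f df : R -> R) (a b : R) :
  a < b -> (forall t, continuous f t) ->
  (forall t, a < t < b -> is_derive f t (df t)) ->
  exists t, a < t < b /\ f b - f a = df t * (b - a).
Proof.
  intros Hab Hc Hd.
  assert (pr1 : forall c, a < c < b -> derivable_pt f c).
  { intros c Hcc; exists (df c); apply is_derive_Reals, Hd, Hcc. }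
  assert (pr2 : forall c, a < c < b -> derivable_pt id c).
  { intros c _; apply derivable_pt_id. }
  destruct (MVT f id a b pr1 pr2 Hab) as [c [Hcc E]].
  - intros c _; apply continuity_pt_filterlim, Hc.
  - intros c _; apply derivable_continuous_pt, derivable_pt_id.
  - exists c; split; [exact Hcc|].
    rewrite (derive_pt_eq_0 id c 1 (pr2 c Hcc) (derivable_pt_lim_id c)) in E.
    rewrite (derive_pt_eq_0 f c (df c) (pr1 c Hcc)) in E.
    + unfold id in E; lra.
    + apply is_derive_Reals, Hd, Hcc.
Qed.

(** * Componentwise calculus for complex-valued functions *)

Definition Ccont (f : R -> C) : Prop :=
  forall t, continuous (fun s => Re (f s)) t /\ continuous (fun s => Im (f s)) t.

(** Componentwise, so that real calculus applies directly; [CD_eps] identifies it with the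
    derivative in [Cmod]. *)
Definition CD (f : R -> C) (t : R) (l : C) : Prop :=
  is_derive (fun s => Re (f s)) t (Re l) /\
  is_derive (fun s => Im (f s)) t (Im l).

Lemma Ccont_ext f g : (forall t, f t = g t) -> Ccont f -> Ccont g.
Proof.
  intros E H t; destruct (H t) as [H1 H2]; split.
  - apply (continuous_ext (fun s => Re (f s))); [|exact H1].
    intros s; rewrite E; reflexivity.
  - apply (continuous_ext (fun s => Im (f s))); [|exact H2].
    intros s; rewrite E; reflexivity.
Qed.

Lemma Ccont_const c : Ccont (fun _ => c).
Proof. intros t; split; apply continuous_const. Qed.

Lemma Ccont_RtoC (f : R -> R) :
  (forall t, continuous f t) -> Ccont (fun t => RtoC (f t)).
Proof. intros H t; split; [apply H | apply continuous_const]. Qed.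

Lemma Ccont_plus f g : Ccont f -> Ccont g -> Ccont (fun t => f t + g t)%C.
Proof.
  intros Hf Hg t; destruct (Hf t), (Hg t); split.
  - apply (continuous_plus (V := R_NormedModule)
             (fun s => Re (f s)) (fun s => Re (g s))); assumption.
  - apply (continuous_plus (V := R_NormedModule)
             (fun s => Im (f s)) (fun s => Im (g s))); assumption.
Qed.

Lemma Ccont_mult f g : Ccont f -> Ccont g -> Ccont (fun t => f t * g t)%C.
Proof.
  intros Hf Hg t; destruct (Hf t), (Hg t); split.
  - apply (continuous_minus (V := R_NormedModule)
      (fun s => Re (f s) * Re (g s)) (fun s => Im (f s) * Im (g s)));
      apply (continuous_mult (K := R_AbsRing)); assumption.
  - apply (continuous_plus (V := R_NormedModule)
      (fun s => Re (f s) * Im (g s)) (fun s => Im (f s) * Re (g s)));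
      apply (continuous_mult (K := R_AbsRing)); assumption.
Qed.

Lemma Ccont_opp f : Ccont f -> Ccont (fun t => - f t)%C.
Proof.
  intros H; apply (Ccont_ext (fun t => (- (1)) * f t)%C); [intros; ring|].
  apply Ccont_mult; [apply Ccont_const | exact H].
Qed.

Lemma Ccont_minus f g : Ccont f -> Ccont g -> Ccont (fun t => f t - g t)%C.
Proof. intros; apply Ccont_plus; [|apply Ccont_opp]; assumption. Qed.

Lemma Ccont_pow f n : Ccont f -> Ccont (fun t => f t ^ n)%C.
Proof.
  intros H; induction n as [|n IH]; [exact (Ccont_const 1) | apply Ccont_mult; assumption].
Qed.

Lemma Ccont_clamp omega f : Ccont f -> Ccont (fun t => f (clamp omega t)).
Proof.
  intros H t; split.
  - apply (continuous_comp_clamp omega (fun s => Re (f s))); apply H.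
  - apply (continuous_comp_clamp omega (fun s => Im (f s))); apply H.
Qed.

Lemma Ccont_conj f : Ccont f -> Ccont (fun t => Cconj (f t)).
Proof.
  intros H t; split; [apply H|].
  apply (continuous_opp (V := R_NormedModule) (fun s => Im (f s))), H.
Qed.

Lemma Cmod_le_abs (z : C) : Cmod z <= Rabs (Re z) + Rabs (Im z).
Proof.
  assert (H := Cmod_ge_0 z).
  assert (H1 := Rabs_pos (Re z)); assert (H2 := Rabs_pos (Im z)).
  apply Rsqr_incr_0_var; [|lra].
  rewrite !Rsqr_pow2, Cmod2_alt, <- (pow2_abs (Re z)), <- (pow2_abs (Im z)); nra.
Qed.

Lemma im_le_Cmod (z : C) : Rabs (Im z) <= Cmod z.
Proof. eapply Rle_trans; [apply Rmax_r | apply Rmax_Cmod]. Qed.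

Lemma Ccont_bounded_clamp omega f :
  0 <= omega -> Ccont f ->
  exists B, 0 <= B /\ forall t, Cmod (f (clamp omega t)) <= B.
Proof.
  intros H0 H.
  destruct (bounded_clamp omega (fun s => Re (f s)) H0) as [B1 [P1 H1]];
    [apply H|].
  destruct (bounded_clamp omega (fun s => Im (f s)) H0) as [B2 [P2 H2]];
    [apply H|].
  exists (B1 + B2); split; [lra|]; intros t.
  eapply Rle_trans; [apply Cmod_le_abs|].
  specialize (H1 t); specialize (H2 t); lra.
Qed.

Lemma CD_ext_loc f g t l :
  locally t (fun s => f s = g s) -> CD f t l -> CD g t l.
Proof.
  intros E [H1 H2]; split.
  - apply (is_derive_ext_loc (fun s => Re (f s))); [|exact H1].
    revert E; apply filter_imp; intros s ->; reflexivity.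
  - apply (is_derive_ext_loc (fun s => Im (f s))); [|exact H2].
    revert E; apply filter_imp; intros s ->; reflexivity.
Qed.

Lemma CD_eq f t l l' : l = l' -> CD f t l -> CD f t l'.
Proof. intros ->; exact (fun H => H). Qed.

Lemma CD_clamp omega f t l :
  0 < t < omega -> CD f t l -> CD (fun s => f (clamp omega s)) t l.
Proof.
  intros Ht; apply CD_ext_loc.
  generalize (clamp_locally omega t Ht); apply filter_imp; intros s ->; reflexivity.
Qed.

Lemma CD_const c t : CD (fun _ => c) t 0%C.
Proof. split; apply (is_derive_const (V := R_NormedModule)). Qed.

Lemma CD_plus f g t l m :
  CD f t l -> CD g t m -> CD (fun s => f s + g s)%C t (l + m)%C.
Proof.
  intros [H1 H2] [H3 H4]; split.
  - exact (is_derive_plus (V := R_NormedModule) _ _ _ _ _ H1 H3).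
  - exact (is_derive_plus (V := R_NormedModule) _ _ _ _ _ H2 H4).
Qed.

Lemma is_derive_mult_R (f g : R -> R) t l m :
  is_derive f t l -> is_derive g t m ->
  is_derive (fun s => f s * g s) t (l * g t + f t * m).
Proof.
  intros H1 H2; apply (is_derive_mult f g t l m H1 H2); intros; apply Rmult_comm.
Qed.

Lemma CD_mult f g t l m :
  CD f t l -> CD g t m -> CD (fun s => f s * g s)%C t (l * g t + f t * m)%C.
Proof.
  intros [H1 H2] [H3 H4]; split.
  - evar_last.
    + apply (is_derive_minus (V := R_NormedModule)
        (fun s => Re (f s) * Re (g s)) (fun s => Im (f s) * Im (g s)));
        apply is_derive_mult_R; eassumption.
    + unfold minus, plus, opp, Re, Im; simpl; ring.
  - evar_last.
    + apply (is_derive_plus (V := R_NormedModule)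
        (fun s => Re (f s) * Im (g s)) (fun s => Im (f s) * Re (g s)));
        apply is_derive_mult_R; eassumption.
    + unfold plus, Re, Im; simpl; ring.
Qed.

Lemma CD_opp f t l : CD f t l -> CD (fun s => - f s)%C t (- l)%C.
Proof.
  intros [H1 H2]; split.
  - exact (is_derive_opp (V := R_NormedModule) _ _ _ H1).
  - exact (is_derive_opp (V := R_NormedModule) _ _ _ H2).
Qed.

Lemma CD_minus f g t l m :
  CD f t l -> CD g t m -> CD (fun s => f s - g s)%C t (l - m)%C.
Proof. intros; apply CD_plus; [|apply CD_opp]; assumption. Qed.

Lemma CD_scal (c : C) f t l : CD f t l -> CD (fun s => c * f s)%C t (c * l)%C.
Proof.
  intros H; apply (CD_eq _ _ (0 * f t + c * l)%C); [ring|].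
  apply CD_mult; [apply CD_const | exact H].
Qed.

Lemma CD_pow f t l n :
  CD f t l -> CD (fun s => f s ^ n)%C t (RtoC (INR n) * f t ^ (n - 1) * l)%C.
Proof.
  intros H; induction n as [|n IH].
  - apply (CD_eq _ _ (RtoC 0)); [|exact (CD_const 1 t)].
    change (INR 0) with 0; rewrite !Cmult_0_l; reflexivity.
  - apply (CD_eq _ _ (l * f t ^ n + f t * (RtoC (INR n) * f t ^ (n - 1) * l))%C);
      [|exact (CD_mult f (fun s => f s ^ n)%C t _ _ H IH)].
    rewrite S_INR, RtoC_plus.
    destruct n as [|n].
    + change (INR 0) with 0; simpl (_ - _)%nat; simpl Cpow; ring.
    + replace (S (S n) - 1)%nat with (S n) by lia.
      replace (S n - 1)%nat with n by lia.
      rewrite !Cpow_S; ring.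
Qed.

Lemma CD_conj f t l : CD f t l -> CD (fun s => Cconj (f s)) t (Cconj l).
Proof.
  intros [H1 H2]; split; [exact H1|].
  exact (is_derive_opp (V := R_NormedModule) _ _ _ H2).
Qed.

Lemma CD_RtoC (f : R -> R) t l :
  is_derive f t l -> CD (fun s => RtoC (f s)) t (RtoC l).
Proof.
  intros H; split; [exact H | exact (is_derive_const (V := R_NormedModule) 0 t)].
Qed.

Lemma CD_inv (f : R -> C) t (l : C) :
  f t <> RtoC 0 -> CD f t l -> CD (fun s => / f s)%C t (- (l / f t ^ 2))%C.
Proof.
  intros H0 [H1 H2].
  assert (Hn : Re (f t) ^ 2 + Im (f t) ^ 2 <> 0).
  { rewrite <- Cmod2_alt; apply pow_nonzero; intros E; apply H0, Cmod_eq_0, E. }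
  assert (HD : is_derive (fun s => Re (f s) ^ 2 + Im (f s) ^ 2) t
                 (2 * Re (f t) * Re l + 2 * Im (f t) * Im l)).
  { evar_last; [apply (is_derive_plus (V := R_NormedModule));
                apply is_derive_pow; eassumption|].
    unfold plus; simpl; ring. }
  split.
  - apply (is_derive_ext (fun s => Re (f s) / (Re (f s) ^ 2 + Im (f s) ^ 2)));
      [reflexivity|].
    evar_last; [apply is_derive_div; eassumption|].
    clear -Hn; cbv beta; destruct (f t) as [a b], l as [c d]; unfold Cdiv, Cinv, Cpow, Cmult,
      Copp, RtoC, Re, Im in *; simpl in *.
    field; split; [|nra]; intros E; apply Hn; nra.
  - apply (is_derive_ext (fun s => - Im (f s) / (Re (f s) ^ 2 + Im (f s) ^ 2)));
      [reflexivity|].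
    evar_last; [apply is_derive_div; [apply (is_derive_opp (V := R_NormedModule));
      exact H2|eassumption|eassumption]|].
    clear -Hn; cbv beta; destruct (f t) as [a b], l as [c d]; unfold Cdiv, Cinv, Cpow, Cmult,
      Copp, RtoC, Re, Im, opp in *; simpl in *.
    field; split; [|nra]; intros E; apply Hn; nra.
Qed.

(** * Gronwall inequality and integrals *)

Lemma Cmod2 (z : C) : Cmod z ^ 2 = Re z ^ 2 + Im z ^ 2.
Proof. exact (Cmod2_alt z). Qed.

Lemma is_derive_Cmod2 (E : R -> C) t l :
  CD E t l ->
  is_derive (fun s => Cmod (E s) ^ 2) t (2 * (Re (E t) * Re l + Im (E t) * Im l)).
Proof.
  intros [H1 H2].
  apply (is_derive_ext (fun s => Re (E s) * Re (E s) + Im (E s) * Im (E s))).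
  { intros s; rewrite Cmod2; simpl; ring. }
  evar_last.
  - apply (is_derive_plus (V := R_NormedModule)
      (fun s => Re (E s) * Re (E s)) (fun s => Im (E s) * Im (E s)));
      apply is_derive_mult_R; eassumption.
  - unfold plus, Re, Im; simpl; ring.
Qed.

Lemma continuous_Cmod2 (E : R -> C) t :
  Ccont E -> continuous (fun s => Cmod (E s) ^ 2) t.
Proof.
  intros H; destruct (H t) as [H1 H2].
  apply (continuous_ext (fun s => Re (E s) * Re (E s) + Im (E s) * Im (E s))).
  { intros s; rewrite Cmod2; simpl; ring. }
  apply (continuous_plus (V := R_NormedModule)
    (fun s => Re (E s) * Re (E s)) (fun s => Im (E s) * Im (E s)));
    apply (continuous_mult (K := R_AbsRing)); assumption.
Qed.

Lemma inner_le_Cmod (z w : C) : Re z * Re w + Im z * Im w <= Cmod z * Cmod w.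
Proof.
  assert (H1 := Cmod_ge_0 z); assert (H2 := Cmod_ge_0 w).
  assert (E1 := Cmod2 z); assert (E2 := Cmod2 w).
  apply Rsqr_incr_0_var; [|nra].
  rewrite !Rsqr_pow2, Rpow_mult_distr, E1, E2.
  assert (0 <= (Re z * Im w - Im z * Re w) ^ 2) by apply pow2_ge_0.
  nra.
Qed.

Lemma inner_abs_le_Cmod (z w : C) :
  Rabs (Re z * Re w + Im z * Im w) <= Cmod z * Cmod w.
Proof.
  apply Rabs_le; split; [|apply inner_le_Cmod].
  assert (H := inner_le_Cmod (- z) w); rewrite Cmod_opp in H.
  unfold Re, Im in *; simpl in H; lra.
Qed.

Lemma is_derive_exp_lin k t :
  is_derive (fun s => exp (k * s)) t (k * exp (k * t)).
Proof. auto_derive; [trivial | ring]. Qed.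

Lemma continuous_exp_lin k t : continuous (fun s => exp (k * s)) t.
Proof.
  apply (ex_derive_continuous (V := R_NormedModule)).
  eexists; apply is_derive_exp_lin.
Qed.

(** [|E|^2] is differentiable even where [E] vanishes, unlike [|E|]. Its derivative is at most [2 L
    |E|^2 + 2 K |E| <= (2 L + 1) |E|^2 + K^2], so [|E|^2 exp (- (2 L + 1) t) - K^2 t] is
    nonincreasing. *)
Lemma gronwall omega (E E' : R -> C) L K :
  0 <= L -> Ccont E ->
  (forall t, 0 < t < omega -> CD E t (E' t)) ->
  (forall t, 0 < t < omega -> Cmod (E' t) <= L * Cmod (E t) + K) ->
  forall t, interval omega t ->
  Cmod (E t) ^ 2 <= exp ((2 * L + 1) * t) * (Cmod (E 0) ^ 2 + K ^ 2 * t).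
Proof.
  intros HL HE HD HB t [Ht0 Ht1].
  set (M := 2 * L + 1).
  assert (H : Cmod (E t) ^ 2 * exp (- M * t) - K ^ 2 * t
              <= Cmod (E 0) ^ 2 * exp (- M * 0) - K ^ 2 * 0).
  { apply (decreasing_of_derive_nonpos
      (fun s => Cmod (E s) ^ 2 * exp (- M * s) - K ^ 2 * s)
      (fun s => (2 * (Re (E s) * Re (E' s) + Im (E s) * Im (E' s))) * exp (- M * s)
                 + Cmod (E s) ^ 2 * (- M * exp (- M * s)) - K ^ 2)); [exact Ht0| | |].
    - intros s; apply (continuous_minus (V := R_NormedModule)
        (fun s => Cmod (E s) ^ 2 * exp (- M * s)) (fun s => K ^ 2 * s)).
      + apply (continuous_mult (K := R_AbsRing) (fun s => Cmod (E s) ^ 2)).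
        * apply continuous_Cmod2, HE.
        * apply continuous_exp_lin.
      + apply (continuous_mult (K := R_AbsRing)); [apply continuous_const | apply continuous_id].
    - intros s Hs.
      apply (is_derive_minus (V := R_NormedModule)
        (fun s => Cmod (E s) ^ 2 * exp (- M * s)) (fun s => K ^ 2 * s)).
      + apply (is_derive_mult_R (fun s => Cmod (E s) ^ 2) (fun s => exp (- M * s)));
          [apply is_derive_Cmod2, HD; lra | apply is_derive_exp_lin].
      + auto_derive; [trivial | ring].
    - intros s Hs; assert (Hs' : 0 < s < omega) by lra.
      assert (H1 := inner_le_Cmod (E s) (E' s)); assert (H2 := HB s Hs').
      assert (H3 := Cmod_ge_0 (E s)); assert (H4 := Cmod_ge_0 (E' s)).
      assert (P := exp_pos (- M * s)).
      assert (P1 : exp (- M * s) <= 1).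
      { rewrite <- exp_0; 
        destruct (Rle_lt_or_eq_dec (- M * s) 0) as [h|h]; [unfold M; nra| |].
        - left; apply exp_increasing, h.
        - rewrite h; right; reflexivity. }
      assert (H5 : 2 * (Re (E s) * Re (E' s) + Im (E s) * Im (E' s))
                   <= M * Cmod (E s) ^ 2 + K ^ 2).
      { unfold M; assert (0 <= (Cmod (E s) - K) ^ 2) by apply pow2_ge_0. nra. }
      assert (0 <= K ^ 2) by apply pow2_ge_0.
      nra. }
  rewrite !Rmult_0_r, exp_0, Rmult_1_r, Rminus_0_r in H.
  assert (P := exp_pos (M * t)).
  assert (X : exp (M * t) * exp (- M * t) = 1).
  { rewrite <- exp_plus; replace (M * t + - M * t) with 0 by ring; apply exp_0. }
  replace (Cmod (E t) ^ 2) with (exp (M * t) * (Cmod (E t) ^ 2 * exp (- M * t))).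
  - apply Rmult_le_compat_l; [lra|]. lra.
  - rewrite (Rmult_comm (Cmod (E t) ^ 2)), <- Rmult_assoc, X; ring.
Qed.

(** [|E|^2 exp (- 2 L t)] is nonincreasing and [|E|^2 exp (2 L t)] nondecreasing, so a zero spreads
    forward and backward. All uniqueness arguments rest on this. *)
Lemma zero_propagates omega (E E' : R -> C) L :
  Ccont E ->
  (forall t, 0 < t < omega -> CD E t (E' t)) ->
  (forall t, 0 < t < omega -> Cmod (E' t) <= L * Cmod (E t)) ->
  forall s t, interval omega s -> interval omega t -> E s = 0%C -> E t = 0%C.
Proof.
  intros HE HD HB.
  assert (Hc : forall k s, continuous (fun s => Cmod (E s) ^ 2 * exp (k * s)) s).
  { intros k s; apply (continuous_mult (K := R_AbsRing) (fun s => Cmod (E s) ^ 2)).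
    - apply continuous_Cmod2, HE.
    - apply continuous_exp_lin. }
  assert (Hd : forall k s, 0 < s < omega ->
    is_derive (fun s => Cmod (E s) ^ 2 * exp (k * s)) s
      ((2 * (Re (E s) * Re (E' s) + Im (E s) * Im (E' s))) * exp (k * s)
       + Cmod (E s) ^ 2 * (k * exp (k * s)))).
  { intros k s Hs; apply (is_derive_mult_R (fun s => Cmod (E s) ^ 2) (fun s => exp (k * s)));
      [apply is_derive_Cmod2, HD, Hs | apply is_derive_exp_lin]. }
  assert (Hi : forall s, 0 < s < omega ->
    Rabs (2 * (Re (E s) * Re (E' s) + Im (E s) * Im (E' s))) <= 2 * L * Cmod (E s) ^ 2).
  { intros s Hs; rewrite Rabs_mult, (Rabs_pos_eq 2) by lra.
    assert (H1 := inner_abs_le_Cmod (E s) (E' s)); assert (H2 := HB s Hs).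
    assert (H3 := Cmod_ge_0 (E s)); nra. }
  assert (Hz : forall t k, Cmod (E t) ^ 2 * exp (k * t) <= 0 -> E t = 0%C).
  { intros t k H; apply Cmod_eq_0; assert (P := exp_pos (k * t)).
    destruct (Rle_lt_or_eq_dec _ _ (Cmod_ge_0 (E t))) as [H3|H3]; [|symmetry; exact H3].
    assert (0 < Cmod (E t) ^ 2 * exp (k * t)); [|lra].
    apply Rmult_lt_0_compat; [apply pow_lt, H3 | exact P]. }
  intros s t [Hs0 Hs1] [Ht0 Ht1] H0.
  destruct (Rle_dec s t) as [Hst|Hst].
  - apply (Hz t (- (2 * L))).
    replace 0 with (Cmod (E s) ^ 2 * exp (- (2 * L) * s)) by (rewrite H0, Cmod_0; ring).
    refine (decreasing_of_derive_nonpos _ _ s t Hst (Hc _) (fun u Hu =>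
      Hd (- (2 * L)) u (conj (Rle_lt_trans _ _ _ Hs0 (proj1 Hu))
                             (Rlt_le_trans _ _ _ (proj2 Hu) Ht1))) _).
    intros u Hu; assert (Hu' : 0 < u < omega) by lra.
    assert (H1 := Rle_trans _ _ _ (Rle_abs _) (Hi u Hu')).
    assert (P := exp_pos (- (2 * L) * u)); nra.
  - apply (Hz t (2 * L)).
    replace 0 with (Cmod (E s) ^ 2 * exp ((2 * L) * s)) by (rewrite H0, Cmod_0; ring).
    apply Ropp_le_cancel.
    refine (decreasing_of_derive_nonpos
      (fun s => - (Cmod (E s) ^ 2 * exp (2 * L * s))) _ t s _ _
      (fun u Hu => is_derive_opp (V := R_NormedModule) _ _ _
        (Hd (2 * L) u (conj (Rle_lt_trans _ _ _ Ht0 (proj1 Hu))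
                            (Rlt_le_trans _ _ _ (proj2 Hu) Hs1)))) _); [lra| |].
    + intros u; apply (continuous_opp (V := R_NormedModule)), Hc.
    + intros u Hu; assert (Hu' : 0 < u < omega) by lra.
      assert (H1 := Rle_trans _ _ _ (Rle_abs _) (Rle_trans _ _ _ (Req_le _ _ (Rabs_Ropp _))
        (Hi u Hu'))).
      assert (P := exp_pos ((2 * L) * u)); unfold opp; simpl; nra.
Qed.

(** * Integrals of complex-valued functions *)

Definition CInt (f : R -> C) (a b : R) : C :=
  (RInt (fun s => Re (f s)) a b, RInt (fun s => Im (f s)) a b).

Lemma is_derive_RInt_cont (f : R -> R) a t :
  (forall s, continuous f s) -> is_derive (fun s => RInt f a s) t (f t).
Proof.
  intros H; apply (is_derive_RInt f _ a t); [|apply H].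
  apply filter_forall; intros s; apply (RInt_correct (V := R_CompleteNormedModule)).
  apply (ex_RInt_continuous (V := R_CompleteNormedModule)); intros; apply H.
Qed.

Lemma CD_CInt f a t : Ccont f -> CD (fun s => CInt f a s) t (f t).
Proof.
  intros H; split; apply is_derive_RInt_cont; intros s; apply H.
Qed.

Lemma Ccont_of_CD f l : (forall t, CD f t (l t)) -> Ccont f.
Proof.
  intros H t; destruct (H t) as [H1 H2].
  split; apply (ex_derive_continuous (V := R_NormedModule)); eexists; eassumption.
Qed.

Lemma Ccont_CInt f a : Ccont f -> Ccont (fun s => CInt f a s).
Proof. intros H; apply (Ccont_of_CD _ f); intros t; apply CD_CInt, H. Qed.

Lemma CInt_point f a : CInt f a a = 0%C.
Proof. unfold CInt; rewrite !RInt_point; reflexivity. Qed.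

Lemma constant_of_CD_zero omega F :
  Ccont F -> (forall t, 0 < t < omega -> CD F t 0%C) ->
  forall t, interval omega t -> F t = F 0.
Proof.
  intros HF HD t Ht.
  assert (H : (F t - F 0)%C = 0%C).
  { refine (zero_propagates omega (fun s => F s - F 0)%C (fun _ => 0%C) 0 _ _ _ 0 t _ Ht _).
    - apply Ccont_minus; [exact HF | apply Ccont_const].
    - intros s Hs; apply (CD_eq _ _ (0 - 0)%C); [ring|].
      apply CD_minus; [apply HD, Hs | apply CD_const].
    - intros s Hs; rewrite Cmod_0; lra.
    - unfold interval in *; lra.
    - ring. }
  replace (F t) with (F t - F 0 + F 0)%C by ring; rewrite H; ring.
Qed.

(** The derivative is known only inside; continuity of [F] extends the identity to both ends. *)
Lemma CInt_FTC omega F f :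
  Ccont F -> Ccont f -> (forall t, 0 < t < omega -> CD F t (f t)) ->
  forall t, interval omega t -> CInt f 0 t = (F t - F 0)%C.
Proof.
  intros HF Hf HD t Ht.
  assert (H := constant_of_CD_zero omega (fun s => F s - CInt f 0 s)%C).
  cbv beta in H; rewrite CInt_point in H.
  replace (F 0) with (F t - CInt f 0 t)%C; [ring|].
  rewrite H; [ring| | |exact Ht].
  - apply Ccont_minus; [exact HF | apply Ccont_CInt, Hf].
  - intros s Hs; apply (CD_eq _ _ (f s - f s)%C); [ring|].
    apply CD_minus; [apply HD, Hs | apply CD_CInt, Hf].
Qed.

Lemma primitive_abs_le (G g : R -> R) omega B k :
  0 < k -> 0 <= B -> G 0 = 0 -> (forall t, continuous G t) ->
  (forall t, 0 < t < omega -> is_derive G t (g t)) ->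
  (forall t, 0 < t < omega -> Rabs (g t) <= B * exp (k * t)) ->
  forall t, interval omega t -> Rabs (G t) <= B / k * exp (k * t).
Proof.
  intros Hk HB H0 HG HD Hg t [Ht0 Ht1].
  assert (Hc : forall s, continuous (fun s => B / k * exp (k * s)) s).
  { intros s; apply (continuous_mult (K := R_AbsRing));
    [apply continuous_const | apply continuous_exp_lin]. }
  assert (Hd : forall s, is_derive (fun s => B / k * exp (k * s)) s (B * exp (k * s))).
  { intros s; auto_derive; [trivial | field; lra]. }
  assert (P : 0 <= B / k) by (apply Rmult_le_pos; [exact HB | left; apply Rinv_0_lt_compat, Hk]).
  assert (A1 : G t - B / k * exp (k * t) <= G 0 - B / k * exp (k * 0)).
  { refine (decreasing_of_derive_nonpos (fun s => G s - B / k * exp (k * s))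
    (fun s => g s - B * exp (k * s)) 0 t Ht0 _ _ _).
    - intros s; apply (continuous_minus (V := R_NormedModule) G); [apply HG | apply Hc].
    - intros s Hs; apply (is_derive_minus (V := R_NormedModule) G); [apply HD; lra | apply Hd].
    - intros s Hs; specialize (Hg s ltac:(lra)); apply Rabs_le_between in Hg; lra. }
  assert (A2 : - G t - B / k * exp (k * t) <= - G 0 - B / k * exp (k * 0)).
  { refine (decreasing_of_derive_nonpos (fun s => - G s - B / k * exp (k * s))
    (fun s => - g s - B * exp (k * s)) 0 t Ht0 _ _ _).
    - intros s; apply (continuous_minus (V := R_NormedModule) (fun s => - G s)); [apply
      (continuous_opp (V := R_NormedModule)), HG | apply Hc].
    - intros s Hs; apply (is_derive_minus (V := R_NormedModule) (fun s => - G s)); [apply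
      (is_derive_opp (V := R_NormedModule)), HD; lra | apply Hd].
    - intros s Hs; specialize (Hg s ltac:(lra)); apply Rabs_le_between in Hg; lra. }
  rewrite Rmult_0_r, exp_0, H0 in A1, A2.
  apply Rabs_le; lra.
Qed.

(** In the norm weighted by [exp (- k t)], integration gains a factor [/ k], whatever the length of
    the interval. The [2] comes from treating real and imaginary parts separately. *)
Lemma Cmod_CInt_le_exp omega f B k :
  0 < k -> 0 <= B -> Ccont f ->
  (forall t, interval omega t -> Cmod (f t) <= B * exp (k * t)) ->
  forall t, interval omega t -> Cmod (CInt f 0 t) <= 2 * B / k * exp (k * t).
Proof.
  intros Hk HB Hf HM t Ht.
  assert (H := Ccont_CInt f 0 Hf).
  eapply Rle_trans; [apply Cmod_le_abs|].
  replace (2 * B / k * exp (k * t)) with (B / k * exp (k * t) + B / k * exp (k * t)) by (field;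
    lra).
  apply Rplus_le_compat.
  - apply (primitive_abs_le (fun s => Re (CInt f 0 s)) (fun s => Re (f s)) omega); try assumption.
    + simpl; rewrite RInt_point; reflexivity.
    + intros s; exact (proj1 (H s)).
    + intros s _; exact (proj1 (CD_CInt f 0 s Hf)).
    + intros s Hs; eapply Rle_trans; [apply re_le_Cmod | apply HM; unfold interval; lra].
  - apply (primitive_abs_le (fun s => Im (CInt f 0 s)) (fun s => Im (f s)) omega); try assumption.
    + simpl; rewrite RInt_point; reflexivity.
    + intros s; exact (proj2 (H s)).
    + intros s _; exact (proj2 (CD_CInt f 0 s Hf)).
    + intros s Hs; eapply Rle_trans; [apply im_le_Cmod | apply HM; unfold interval; lra].
Qed.

Lemma Cmod_CInt_le f b M :
  0 <= b -> Ccont f -> (forall t, 0 <= t <= b -> Cmod (f t) <= M) ->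
  Cmod (CInt f 0 b) <= 2 * b * M.
Proof.
  intros Hb Hf HM.
  eapply Rle_trans; [apply Cmod_le_abs|]; unfold CInt, Re at 1, Im at 1; simpl.
  replace (2 * b * M) with ((b - 0) * M + (b - 0) * M) by ring.
  apply Rplus_le_compat; apply abs_RInt_le_const; try assumption.
  - apply (ex_RInt_continuous (V := R_CompleteNormedModule)); intros; apply Hf.
  - intros t Ht; eapply Rle_trans; [apply re_le_Cmod | apply HM, Ht].
  - apply (ex_RInt_continuous (V := R_CompleteNormedModule)); intros; apply Hf.
  - intros t Ht; eapply Rle_trans; [apply im_le_Cmod | apply HM, Ht].
Qed.

Lemma CInt_linear omega (f g h : R -> C) (c : C) t :
  interval omega t -> Ccont f -> Ccont g -> Ccont h ->
  CInt (fun s => f s - g s - c * h s)%C 0 t =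
  (CInt f 0 t - CInt g 0 t - c * CInt h 0 t)%C.
Proof.
  intros Ht Hf Hg Hh.
  assert (Hch : Ccont (fun s => c * h s)%C) by (apply Ccont_mult; [apply Ccont_const | exact Hh]).
  rewrite (CInt_FTC omega (fun s => CInt f 0 s - CInt g 0 s - c * CInt h 0 s)%C).
  - rewrite !CInt_point; ring.
  - apply Ccont_minus; [apply Ccont_minus; apply Ccont_CInt; assumption|].
    apply Ccont_mult; [apply Ccont_const | apply Ccont_CInt, Hh].
  - apply Ccont_minus; [apply Ccont_minus|]; assumption.
  - intros s _; apply CD_minus; [apply CD_minus; apply CD_CInt; assumption|].
    apply CD_scal, CD_CInt, Hh.
  - exact Ht.
Qed.

(** * Global solutions of Lipschitz equations *)

Lemma half_pow_small (B e : R) : 0 < e -> exists k : nat, B * (/ 2) ^ k < e.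
Proof.
  intros He.
  destruct (pow_lt_1_zero (/ 2)) with (y := e / (Rabs B + 1)) as [N HN].
  - rewrite Rabs_pos_eq; lra.
  - apply Rdiv_lt_0_compat; [exact He | assert (H := Rabs_pos B); lra].
  - exists N; specialize (HN N (Nat.le_refl N)).
    rewrite Rabs_pos_eq in HN by (apply pow_le; lra).
    assert (H := Rabs_pos B); assert (H1 := Rle_abs B).
    assert (P : 0 < (/ 2) ^ N) by (apply pow_lt; lra).
    apply (Rmult_lt_compat_l (Rabs B + 1)) in HN; [|lra].
    replace ((Rabs B + 1) * (e / (Rabs B + 1))) with e in HN by (field; lra).
    nra.
Qed.

Lemma nonpos_of_half_pow (a B : R) : (forall k : nat, a <= B * (/ 2) ^ k) -> a <= 0.
Proof.
  intros H; apply Rnot_lt_le; intros Ha.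
  destruct (half_pow_small B a Ha) as [k Hk]; specialize (H k); lra.
Qed.

(** The intervals of radius [2 B (/ 2) ^ k] around [u k] are nested, so the supremum of their left
    ends lies in all of them. *)
Lemma geometric_limit (u : nat -> R) (B : R) :
  (forall k, Rabs (u (S k) - u k) <= B * (/ 2) ^ k) ->
  exists l, forall k, Rabs (u k - l) <= 2 * B * (/ 2) ^ k.
Proof.
  intros H.
  assert (HB : 0 <= B).
  { specialize (H 0%nat); simpl in H; assert (P := Rabs_pos (u 1%nat - u 0%nat)); lra. }
  set (lo := fun k => u k - 2 * B * (/ 2) ^ k).
  set (hi := fun k => u k + 2 * B * (/ 2) ^ k).
  assert (Hlo : forall k j, lo k <= lo (j + k)%nat).
  { intros k j; induction j as [|j IH]; [simpl; lra|].
    eapply Rle_trans; [exact IH|].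
    specialize (H (j + k)%nat); apply Rabs_le_between in H.
    change (S j + k)%nat with (S (j + k)); unfold lo; simpl ((/ 2) ^ S _); lra. }
  assert (Hhi : forall k j, hi (j + k)%nat <= hi k).
  { intros k j; induction j as [|j IH]; [simpl; lra|].
    eapply Rle_trans; [|exact IH].
    specialize (H (j + k)%nat); apply Rabs_le_between in H.
    change (S j + k)%nat with (S (j + k)); unfold hi; simpl ((/ 2) ^ S _); lra. }
  assert (Hlh : forall k j, lo k <= hi j).
  { intros k j; eapply Rle_trans; [apply (Hlo k j)|].
    eapply Rle_trans; [|apply (Hhi j k)]; rewrite (Nat.add_comm k j).
    assert (P : 0 < (/ 2) ^ (j + k)) by (apply pow_lt; lra).
    unfold lo, hi; nra. }
  destruct (completeness (fun y => exists k, y = lo k)) as [l [Hl1 Hl2]].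
  - exists (hi 0%nat); intros y [k ->]; apply Hlh.
  - exists (lo 0%nat), 0%nat; reflexivity.
  - exists l; intros k.
    assert (A1 : lo k <= l) by (apply Hl1; exists k; reflexivity).
    assert (A2 : l <= hi k) by (apply Hl2; intros y [j ->]; apply Hlh).
    unfold lo, hi in *; apply Rabs_le; lra.
Qed.

Lemma continuous_uniform_limit (u : nat -> R -> R) (x : R -> R) (B t : R) :
  (forall k s, Rabs (u k s - x s) <= B * (/ 2) ^ k) ->
  (forall k, continuous (u k) t) -> continuous x t.
Proof.
  intros H Hc; apply continuous_eps; intros eps.
  destruct (half_pow_small B (eps / 3)) as [k Hk]; [apply Rdiv_lt_0_compat; [apply eps | lra]|].
  assert (He : 0 < eps / 3) by (apply Rdiv_lt_0_compat; [apply eps | lra]).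
  destruct (proj1 (continuous_eps (u k) t) (Hc k) (mkposreal _ He)) as [d Hd].
  exists d; intros s Hs; specialize (Hd s Hs); simpl in Hd.
  assert (H1 := H k s); assert (H2 := H k t).
  apply Rabs_le_between in H1; apply Rabs_le_between in H2.
  apply Rabs_lt_between in Hd; apply Rabs_def1; lra.
Qed.

Lemma Ccont_uniform_limit (u : nat -> R -> C) (x : R -> C) (B : R) :
  (forall k s, Cmod (u k s - x s) <= B * (/ 2) ^ k) ->
  (forall k, Ccont (u k)) -> Ccont x.
Proof.
  intros H Hc t; split.
  - apply (continuous_uniform_limit (fun k s => Re (u k s)) _ B).
    + intros k s; eapply Rle_trans; [|apply (H k s)].
      exact (re_le_Cmod (u k s - x s)).
    + intros k; apply Hc.
  - apply (continuous_uniform_limit (fun k s => Im (u k s)) _ B).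
    + intros k s; eapply Rle_trans; [|apply (H k s)].
      exact (im_le_Cmod (u k s - x s)).
    + intros k; apply Hc.
Qed.

(** The limit is chosen pointwise; [4 B] is the tail bound [2 B] for each of the two coordinates. *)
Lemma geometric_limit_fun (u : nat -> R -> C) (B : R) :
  (forall k t, Cmod (u (S k) t - u k t) <= B * (/ 2) ^ k) ->
  exists x : R -> C, forall k t, Cmod (u k t - x t) <= 4 * B * (/ 2) ^ k.
Proof.
  intros H.
  assert (Hl : forall t, exists l : C, forall k, Cmod (u k t - l) <= 4 * B * (/ 2) ^ k).
  { intros t.
    destruct (geometric_limit (fun k => Re (u k t)) B) as [l1 H1].
    { intros k; eapply Rle_trans; [|apply (H k t)].
      exact (re_le_Cmod (u (S k) t - u k t)). }
    destruct (geometric_limit (fun k => Im (u k t)) B) as [l2 H2].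
    { intros k; eapply Rle_trans; [|apply (H k t)].
      exact (im_le_Cmod (u (S k) t - u k t)). }
    exists (l1, l2); intros k; eapply Rle_trans; [apply Cmod_le_abs|].
    specialize (H1 k); specialize (H2 k).
    unfold Re, Im in *; simpl; unfold Rminus in *; lra. }
  exists (fun t => proj1_sig (constructive_indefinite_description _ (Hl t))).
  intros k t; exact (proj2_sig (constructive_indefinite_description _ (Hl t)) k).
Qed.

(* Picard iteration, contracting for the sup norm weighted by [exp (- k t)],
   [k = 4 L + 1]; the iterates are frozen outside [0, omega]. *)
Theorem picard_lipschitz omega (F : R -> C -> C) L (c : C) :
  0 < omega -> 0 <= L ->
  (forall x, Ccont x -> Ccont (fun t => F t (x t))) ->
  (forall t x y, Cmod (F t x - F t y) <= L * Cmod (x - y)) ->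
  exists x, Ccont x /\ (forall t, x (clamp omega t) = x t) /\ x 0 = c /\
    forall t, 0 < t < omega -> CD x t (F t (x t)).
Proof.
  intros Hw HL HF HLip.
  assert (Hw0 : 0 <= omega) by lra.
  set (T := fun (x : R -> C) t => (c + CInt (fun s => F s (x s)) 0 (clamp omega t))%C).
  set (X := nat_rect (fun _ => R -> C) (fun _ => c) (fun _ x => T x)).
  assert (HT : forall x, Ccont x -> Ccont (T x)).
  { intros x Hx; apply Ccont_plus; [apply Ccont_const|].
    apply (Ccont_clamp omega (CInt (fun s => F s (x s)) 0)), Ccont_CInt, HF, Hx. }
  assert (HX : forall k, Ccont (X k)).
  { induction k as [|k IH]; [apply Ccont_const | apply HT, IH]. }
  assert (HTd : forall x y t, Ccont x -> Ccont y -> interval omega t ->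
    (T x t - T y t)%C = CInt (fun s => F s (x s) - F s (y s))%C 0 t).
  { intros x y t Hx Hy Ht; unfold T; rewrite (clamp_id omega t Ht).
    replace (CInt (fun s => F s (x s) - F s (y s))%C 0 t)
      with (CInt (fun s => F s (x s) - F s (y s) - 0 * 0)%C 0 t).
    - rewrite (CInt_linear omega (fun s => F s (x s)) (fun s => F s (y s)) (fun _ => 0%C));
        [ring|exact Ht|apply HF, Hx|apply HF, Hy|apply Ccont_const].
    - unfold CInt; f_equal; apply RInt_ext; intros; f_equal; ring. }
  (* One iteration multiplies the weighted norm by at most [2 L / kk], which is below [/ 2] for this
     choice. *)
  set (kk := 4 * L + 1).
  assert (Hkk : 0 < kk) by (unfold kk; lra).
  destruct (Ccont_bounded_clamp omega (fun t => X 1%nat t - X 0%nat t)%C Hw0) as [A [HA0 HA]].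
  { apply Ccont_minus; apply HX. }
  assert (Hexp1 : forall t, 0 <= t -> 1 <= exp (kk * t)).
  { intros t Ht; assert (h := exp_ineq1_le (kk * t)); nra. }
  assert (Hk : forall k t, interval omega t ->
    Cmod (X (S k) t - X k t) <= A * (/ 2) ^ k * exp (kk * t)).
  { induction k as [|k IH]; intros t Ht.
    - specialize (HA t); rewrite (clamp_id omega t Ht) in HA.
      specialize (Hexp1 t (proj1 Ht)); simpl ((/ 2) ^ 0); rewrite Rmult_1_r; nra.
    - change (X (S (S k))) with (T (X (S k))); change (X (S k)) with (T (X k)) at 2.
      rewrite HTd by (try apply HX; exact Ht).
      assert (P : 0 < (/ 2) ^ k) by (apply pow_lt; lra).
      eapply Rle_trans; [apply (Cmod_CInt_le_exp omega _ (L * (A * (/ 2) ^ k)) kk Hkk)|].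
      + apply Rmult_le_pos; [exact HL|nra].
      + apply Ccont_minus; apply HF, HX.
      + intros s Hs; eapply Rle_trans; [apply HLip|].
        rewrite Rmult_assoc; apply Rmult_le_compat_l; [exact HL | apply IH, Hs].
      + exact Ht.
      + apply Rmult_le_compat_r; [left; apply exp_pos|].
        apply (Rmult_le_reg_r kk); [exact Hkk|].
        replace (2 * (L * (A * (/ 2) ^ k)) / kk * kk) with (2 * L * (A * (/ 2) ^ k)) by (field;
          lra).
        simpl ((/ 2) ^ S k).
        assert (0 <= A * (/ 2) ^ k) by nra.
        unfold kk; nra. }
  assert (Hcl : forall k t, X k (clamp omega t) = X k t).
  { intros [|k] t; [reflexivity|].
    change (T (X k) (clamp omega t) = T (X k) t); unfold T; rewrite clamp_idem by exact Hw0;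
      reflexivity. }
  set (B := A * exp (kk * omega)).
  destruct (geometric_limit_fun X B) as [x Hx].
  { intros k t; rewrite <- (Hcl (S k)), <- (Hcl k).
    assert (Hi := clamp_interval omega t Hw0).
    eapply Rle_trans; [apply Hk, Hi|]; unfold B.
    assert (P : 0 < (/ 2) ^ k) by (apply pow_lt; lra).
    assert (Hm : exp (kk * clamp omega t) <= exp (kk * omega)).
    { destruct Hi as [_ [Hi|Hi]]; [left; apply exp_increasing; nra | rewrite Hi; lra]. }
    replace (A * exp (kk * omega) * (/ 2) ^ k) with (A * (/ 2) ^ k * exp (kk * omega)) by ring.
    apply Rmult_le_compat_l; [nra | exact Hm]. }
  assert (Hxc : Ccont x) by (apply (Ccont_uniform_limit X x (4 * B) Hx HX)).
  assert (Hfix : forall t, x t = T x (clamp omega t)).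
  { intros t.
    assert (Hi := clamp_interval omega t Hw0).
    assert (Z : (x t - T x (clamp omega t))%C = 0%C).
    { apply Cmod_eq_0, Rle_antisym; [|apply Cmod_ge_0].
      (* [4 B] accounts for the distance from [X (S k)] to the limit, [2 omega L (4 B)] for the
         distance between the images under [T] of [X k] and of the limit. *)
      apply (nonpos_of_half_pow _ (4 * B + 2 * omega * (L * (4 * B)))); intros k.
      replace (x t - T x (clamp omega t))%C
        with (- (X (S k) t - x t) + (T (X k) (clamp omega t) - T x (clamp omega t)))%C
        by (rewrite <- (Hcl (S k) t); change (X (S k)) with (T (X k)); ring).
      eapply Rle_trans; [apply Cmod_triangle|]; rewrite Cmod_opp, Rmult_plus_distr_r.
      assert (Q : 0 <= 4 * B * (/ 2) ^ k) by (eapply Rle_trans; [apply Cmod_ge_0 | apply (Hx k 0)]).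
      apply Rplus_le_compat.
      - eapply Rle_trans; [apply Hx|]; simpl ((/ 2) ^ S k); lra.
      - rewrite HTd by (try apply HX; assumption).
        eapply Rle_trans; [apply (Cmod_CInt_le _ _ (L * (4 * B * (/ 2) ^ k)))|].
        + apply Hi.
        + apply Ccont_minus; apply HF; [apply HX | exact Hxc].
        + intros s _; eapply Rle_trans; [apply HLip|].
          apply Rmult_le_compat_l; [exact HL | apply Hx].
        + assert (0 <= L * (4 * B * (/ 2) ^ k)) by (apply Rmult_le_pos; assumption).
          destruct Hi; nra. }
    replace (x t) with (x t - T x (clamp omega t) + T x (clamp omega t))%C by ring.
    rewrite Z; ring. }
  exists x; split; [exact Hxc|]; split; [|split].
  - intros t; rewrite !Hfix, clamp_idem by exact Hw0; reflexivity.
  - rewrite Hfix; unfold T; rewrite !(clamp_id omega 0), CInt_point; [ring|..];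
      unfold interval; lra.
  - intros t Ht.
    apply (CD_ext_loc (fun s => c + CInt (fun u => F u (x u)) 0 s)%C).
    + generalize (clamp_locally omega t Ht); apply filter_imp; intros s Hs.
      rewrite (Hfix s); unfold T; rewrite clamp_idem, Hs by exact Hw0; reflexivity.
    + apply (CD_eq _ _ (0 + F t (x t))%C); [ring|].
      apply CD_plus; [apply CD_const|].
      apply (CD_CInt (fun u => F u (x u)) 0 t), HF, Hxc.
Qed.

(** * Uniformly smooth functions *)

(** One constant bounds values, partial derivatives and remainder, which keeps the property stable
    under sums and products. Continuity is asked along continuous paths with [h] fixed: this is what
    Picard iteration and integration in [t] use. *)
Definition smooth_with (r d : R) (f fy fh : R -> C -> C -> C) (K : R) : Prop :=
  0 <= K /\
  (forall t y h, Cmod y <= r -> Cmod h <= d ->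
     Cmod (f t y h) <= K /\ Cmod (fy t y h) <= K /\ Cmod (fh t y h) <= K) /\
  (forall t y h y' h', Cmod y <= r -> Cmod h <= d -> Cmod y' <= r -> Cmod h' <= d ->
     Cmod (f t y' h' - f t y h - (fy t y h * (y' - y) + fh t y h * (h' - h)))
       <= K * (Cmod (y' - y) + Cmod (h' - h)) ^ 2) /\
  (forall x h, Ccont x -> (forall t, Cmod (x t) <= r) -> Cmod h <= d ->
     Ccont (fun t => f t (x t) h) /\ Ccont (fun t => fy t (x t) h) /\
     Ccont (fun t => fh t (x t) h)).

(* [f t y h] is complex differentiable in [(y, h)], with a quadratic remainder
   uniform in [t] and in [|y| <= r], [|h| <= d]. *)
Definition smooth (r d : R) (f : R -> C -> C -> C) : Prop :=
  exists fy fh K, smooth_with r d f fy fh K.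

Lemma smooth_coef r d (a : R -> C) B :
  Ccont a -> (forall t, Cmod (a t) <= B) -> smooth r d (fun t _ _ => a t).
Proof.
  intros Ha HB.
  assert (HB0 : 0 <= B) by (eapply Rle_trans; [apply Cmod_ge_0 | apply (HB 0)]).
  exists (fun _ _ _ => 0%C), (fun _ _ _ => 0%C), B; split; [exact HB0|]; split; [|split].
  - intros; rewrite Cmod_0; auto.
  - intros; match goal with |- Cmod ?c <= _ => replace c with (RtoC 0) by ring end.
    rewrite Cmod_0; apply Rmult_le_pos; [exact HB0 | apply pow2_ge_0].
  - intros; split; [exact Ha | split; apply Ccont_const].
Qed.

Lemma smooth_const r d (c : C) : smooth r d (fun _ _ _ => c).
Proof.
  apply (smooth_coef r d (fun _ => c) (Cmod c)); [apply Ccont_const | intros; lra].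
Qed.

Lemma smooth_y r d : 0 <= r -> smooth r d (fun _ y _ => y).
Proof.
  intros Hr; exists (fun _ _ _ => 1%C), (fun _ _ _ => 0%C), (Rmax r 1).
  assert (M1 := Rmax_l r 1); assert (M2 := Rmax_r r 1).
  split; [lra|]; split; [|split].
  - intros; rewrite Cmod_0, Cmod_1; lra.
  - intros; match goal with |- Cmod ?c <= _ => replace c with (RtoC 0) by ring end.
    rewrite Cmod_0; apply Rmult_le_pos; [lra | apply pow2_ge_0].
  - intros; split; [assumption | split; apply Ccont_const].
Qed.

Lemma smooth_h r d : 0 <= d -> smooth r d (fun _ _ h => h).
Proof.
  intros Hr; exists (fun _ _ _ => 0%C), (fun _ _ _ => 1%C), (Rmax d 1).
  assert (M1 := Rmax_l d 1); assert (M2 := Rmax_r d 1).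
  split; [lra|]; split; [|split].
  - intros; rewrite Cmod_0, Cmod_1; lra.
  - intros; match goal with |- Cmod ?c <= _ => replace c with (RtoC 0) by ring end.
    rewrite Cmod_0; apply Rmult_le_pos; [lra | apply pow2_ge_0].
  - intros; split; [|split]; apply Ccont_const.
Qed.

Lemma smooth_plus r d f g :
  smooth r d f -> smooth r d g -> smooth r d (fun t y h => f t y h + g t y h)%C.
Proof.
  intros (fy & fh & K & HK & H1 & H2 & H3) (gy & gh & J & HJ & G1 & G2 & G3).
  exists (fun t y h => fy t y h + gy t y h)%C, (fun t y h => fh t y h + gh t y h)%C, (K + J).
  split; [lra|]; split; [|split].
  - intros t y h Hy Hh; destruct (H1 t y h Hy Hh) as (A1 & A2 & A3).
    destruct (G1 t y h Hy Hh) as (B1 & B2 & B3).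
    repeat split; (eapply Rle_trans; [apply Cmod_triangle | lra]).
  - intros t y h y' h' Hy Hh Hy' Hh'.
    specialize (H2 t y h y' h' Hy Hh Hy' Hh'); specialize (G2 t y h y' h' Hy Hh Hy' Hh').
    match type of H2 with Cmod ?a <= _ => match type of G2 with Cmod ?b <= _ =>
      match goal with |- Cmod ?c <= _ => replace c with (a + b)%C by ring end end end.
    eapply Rle_trans; [apply Cmod_triangle | lra].
  - intros x h Hx Hxr Hh; destruct (H3 x h Hx Hxr Hh) as (A1 & A2 & A3).
    destruct (G3 x h Hx Hxr Hh) as (B1 & B2 & B3).
    split; [|split]; apply Ccont_plus; assumption.
Qed.

Lemma Cmod_lin_le (a b u v : C) K :
  Cmod a <= K -> Cmod b <= K -> Cmod (a * u + b * v) <= K * (Cmod u + Cmod v).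
Proof.
  intros Ha Hb; eapply Rle_trans; [apply Cmod_triangle|]; rewrite !Cmod_mult.
  assert (P1 := Cmod_ge_0 u); assert (P2 := Cmod_ge_0 v); nra.
Qed.

Lemma Cmod_diff_le (u v : C) : Cmod (u - v) <= Cmod u + Cmod v.
Proof. rewrite <- (Cmod_opp v); apply Cmod_triangle. Qed.

(** On discs of diameters [2 r] and [2 d], the quadratic remainder is itself linear with factor
    [2 (r + d)]; the [1] comes from the differential. *)
Lemma smooth_with_lipschitz r d f fy fh K :
  0 <= r -> 0 <= d -> smooth_with r d f fy fh K ->
  forall t y h y' h', Cmod y <= r -> Cmod h <= d -> Cmod y' <= r -> Cmod h' <= d ->
  Cmod (f t y' h' - f t y h)
    <= K * (1 + 2 * (r + d)) * (Cmod (y' - y) + Cmod (h' - h)).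
Proof.
  intros Hr Hd (HK & H1 & H2 & H3) t y h y' h' Hy Hh Hy' Hh'.
  specialize (H2 t y h y' h' Hy Hh Hy' Hh').
  destruct (H1 t y h Hy Hh) as (A1 & A2 & A3).
  assert (B := Cmod_lin_le _ _ (y' - y) (h' - h) K A2 A3).
  set (l := (fy t y h * (y' - y) + fh t y h * (h' - h))%C) in *.
  replace (f t y' h' - f t y h)%C with (f t y' h' - f t y h - l + l)%C by ring.
  eapply Rle_trans; [apply Cmod_triangle|].
  assert (N1 := Cmod_diff_le y' y); assert (N2 := Cmod_diff_le h' h).
  assert (P1 := Cmod_ge_0 (y' - y)); assert (P2 := Cmod_ge_0 (h' - h)).
  set (N := Cmod (y' - y) + Cmod (h' - h)) in *.
  assert (N ^ 2 <= 2 * (r + d) * N) by (unfold N in *; nra).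
  assert (K * N ^ 2 <= K * (2 * (r + d) * N)) by (apply Rmult_le_compat_l; assumption).
  lra.
Qed.

Lemma smooth_mult r d f g :
  0 <= r -> 0 <= d ->
  smooth r d f -> smooth r d g -> smooth r d (fun t y h => f t y h * g t y h)%C.
Proof.
  intros Hr Hd (fy & fh & K & HF) (gy & gh & J & HG).
  assert (LG := smooth_with_lipschitz r d g gy gh J Hr Hd HG).
  destruct HF as (HK & H1 & H2 & H3); destruct HG as (HJ & G1 & G2 & G3).
  set (D := 2 * (r + d)) in *; assert (HD : 0 <= D) by (unfold D; lra).
  assert (HKJ : 0 <= K * J) by (apply Rmult_le_pos; assumption).
  exists (fun t y h => fy t y h * g t y h + f t y h * gy t y h)%C,
    (fun t y h => fh t y h * g t y h + f t y h * gh t y h)%C, (K * J * (3 + D)).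
  split; [apply Rmult_le_pos; lra|]; split; [|split].
  - intros t y h Hy Hh; destruct (H1 t y h Hy Hh) as (A1 & A2 & A3).
    destruct (G1 t y h Hy Hh) as (B1 & B2 & B3).
    assert (X : forall a b, Cmod a <= K -> Cmod b <= J -> Cmod (a * b) <= K * J).
    { intros a b Ha Hb; rewrite Cmod_mult; apply Rmult_le_compat; auto using Cmod_ge_0. }
    assert (0 <= K * J * D) by (apply Rmult_le_pos; assumption).
    repeat split.
    + eapply Rle_trans; [apply X; assumption | lra].
    + eapply Rle_trans; [apply Cmod_triangle|].
      assert (Y1 := X _ _ A2 B1); assert (Y2 := X _ _ A1 B2); lra.
    + eapply Rle_trans; [apply Cmod_triangle|].
      assert (Y1 := X _ _ A3 B1); assert (Y2 := X _ _ A1 B3); lra.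
  - intros t y h y' h' Hy Hh Hy' Hh'.
    specialize (H2 t y h y' h' Hy Hh Hy' Hh'); specialize (G2 t y h y' h' Hy Hh Hy' Hh').
    specialize (LG t y h y' h' Hy Hh Hy' Hh').
    destruct (H1 t y h Hy Hh) as (A1 & A2 & A3).
    destruct (G1 t y' h' Hy' Hh') as (B1 & _ & _).
    assert (B := Cmod_lin_le _ _ (y' - y) (h' - h) K A2 A3).
    set (df := (fy t y h * (y' - y) + fh t y h * (h' - h))%C) in *.
    set (dg := (gy t y h * (y' - y) + gh t y h * (h' - h))%C) in *.
    assert (HN : 0 <= Cmod (y' - y) + Cmod (h' - h))
      by (apply Rplus_le_le_0_compat; apply Cmod_ge_0).
    set (N := Cmod (y' - y) + Cmod (h' - h)) in *.
    (* Product rule with remainder: the remainder of [f] times [g'], the differential of [f] times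
       the increment of [g], and [f] times the remainder of [g]. They contribute [1], [1 + D] and
       [1] to the factor [3 + D]. *)
    match goal with |- Cmod ?c <= _ => replace c with
      ((f t y' h' - f t y h - df) * g t y' h' + df * (g t y' h' - g t y h)
       + f t y h * (g t y' h' - g t y h - dg))%C by (unfold df, dg; ring) end.
    eapply Rle_trans; [apply Cmod_triangle|].
    eapply Rle_trans; [apply Rplus_le_compat_r, Cmod_triangle|].
    rewrite !Cmod_mult.
    replace (K * J * (3 + D) * N ^ 2)
      with (K * N ^ 2 * J + K * N * (J * (1 + D) * N) + K * (J * N ^ 2)) by ring.
    repeat apply Rplus_le_compat; apply Rmult_le_compat; auto using Cmod_ge_0.
  - intros x h Hx Hxr Hh; destruct (H3 x h Hx Hxr Hh) as (A1 & A2 & A3).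
    destruct (G3 x h Hx Hxr Hh) as (B1 & B2 & B3).
    split; [exact (Ccont_mult _ _ A1 B1)|].
    split; apply Ccont_plus; apply Ccont_mult; assumption.
Qed.

Lemma smooth_pow r d f n :
  0 <= r -> 0 <= d -> smooth r d f -> smooth r d (fun t y h => f t y h ^ n)%C.
Proof.
  intros Hr Hd Hf; induction n as [|n IH].
  - exact (smooth_const r d 1).
  - exact (smooth_mult r d f (fun t y h => f t y h ^ n)%C Hr Hd Hf IH).
Qed.

(** Projection onto the square circumscribed about the disc of radius [r]. Working by coordinates
    reduces everything to [clamp], at the cost of factors [2]; the shift by [r] is there because
    [clamp] starts at [0]. *)
Definition clampC (r : R) (z : C) : C :=
  (clamp (2 * r) (Re z + r) - r, clamp (2 * r) (Im z + r) - r).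

Lemma clampC_id r z : Cmod z <= r -> clampC r z = z.
Proof.
  intros H; assert (H1 := re_le_Cmod z); assert (H2 := im_le_Cmod z).
  assert (H3 := Rle_trans _ _ _ H1 H); assert (H4 := Rle_trans _ _ _ H2 H).
  apply Rabs_le_between in H3; apply Rabs_le_between in H4.
  unfold clampC; rewrite !clamp_id by (unfold interval; lra).
  rewrite (surjective_pairing z) at 3; unfold Re, Im; f_equal; ring.
Qed.

Lemma clampC_bound r z : 0 <= r -> Cmod (clampC r z) <= 2 * r.
Proof.
  intros H; eapply Rle_trans; [apply Cmod_le_abs|]; unfold clampC; simpl.
  destruct (clamp_interval (2 * r) (Re z + r)) as [A1 A2]; [lra|].
  destruct (clamp_interval (2 * r) (Im z + r)) as [B1 B2]; [lra|].
  replace (2 * r) with (r + r) at 3 by ring.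
  apply Rplus_le_compat; apply Rabs_le; lra.
Qed.

Lemma clampC_lipschitz r z w : Cmod (clampC r z - clampC r w) <= 2 * Cmod (z - w).
Proof.
  eapply Rle_trans; [apply Cmod_le_abs|]; unfold clampC; simpl.
  assert (A := clamp_dist (2 * r) (Re z + r) (Re w + r)).
  assert (B := clamp_dist (2 * r) (Im z + r) (Im w + r)).
  assert (A' := re_le_Cmod (z - w)); assert (B' := im_le_Cmod (z - w)).
  replace (Re z + r - (Re w + r)) with (Re (z - w)) in A by (unfold Re; simpl; ring).
  replace (Im z + r - (Im w + r)) with (Im (z - w)) in B by (unfold Im; simpl; ring).
  match type of A with Rabs ?a <= _ =>
    match goal with |- Rabs ?x + _ <= _ => replace x with a by ring end end.
  match type of B with Rabs ?a <= _ =>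
    match goal with |- _ + Rabs ?x <= _ => replace x with a by ring end end.
  lra.
Qed.

Lemma Ccont_clampC r x : Ccont x -> Ccont (fun t => clampC r (x t)).
Proof.
  intros H t; destruct (H t) as [H1 H2]; unfold clampC; simpl; split.
  - apply (continuous_minus (V := R_NormedModule)
      (fun s => clamp (2 * r) (Re (x s) + r)) (fun _ => r)); [|apply continuous_const].
    apply (continuous_comp (fun s => Re (x s) + r) (clamp (2 * r)));
      [|apply continuous_clamp].
    apply (continuous_plus (V := R_NormedModule)); [exact H1 | apply continuous_const].
  - apply (continuous_minus (V := R_NormedModule)
      (fun s => clamp (2 * r) (Im (x s) + r)) (fun _ => r)); [|apply continuous_const].
    apply (continuous_comp (fun s => Im (x s) + r) (clamp (2 * r)));
      [|apply continuous_clamp].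
    apply (continuous_plus (V := R_NormedModule)); [exact H2 | apply continuous_const].
Qed.

(** * Dependence on a complex parameter *)

(** [1 + x] dominates the square root of [x], so the Gronwall bound on [|E|^2] yields one on [|E|]
    without roots. *)
Definition growth (omega L : R) : R := 1 + exp ((2 * L + 1) * omega) * omega.

Lemma growth_pos omega L : 0 <= omega -> 1 <= growth omega L.
Proof.
  intros H; unfold growth; assert (P := exp_pos ((2 * L + 1) * omega)); nra.
Qed.

Lemma gronwall_zero omega (E E' : R -> C) L K :
  0 < omega -> 0 <= L -> 0 <= K -> Ccont E ->
  (forall t, E (clamp omega t) = E t) -> E 0 = 0%C ->
  (forall t, 0 < t < omega -> CD E t (E' t)) ->
  (forall t, 0 < t < omega -> Cmod (E' t) <= L * Cmod (E t) + K) ->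
  forall t, Cmod (E t) <= growth omega L * K.
Proof.
  intros Hw HL HK HE Hcl H0 HD HB t.
  rewrite <- Hcl.
  assert (Hi := clamp_interval omega t (Rlt_le _ _ Hw)).
  assert (H := gronwall omega E E' L K HL HE HD HB _ Hi).
  rewrite H0, Cmod_0 in H; destruct Hi as [Hi1 Hi2].
  assert (G := growth_pos omega L (Rlt_le _ _ Hw)).
  apply Rsqr_incr_0_var; [|apply Rmult_le_pos; lra].
  rewrite !Rsqr_pow2, Rpow_mult_distr.
  eapply Rle_trans; [exact H|].
  assert (P : 0 <= K ^ 2) by apply pow2_ge_0.
  assert (Q : exp ((2 * L + 1) * clamp omega t) <= exp ((2 * L + 1) * omega)).
  { destruct Hi2 as [Hi2|Hi2]; [left; apply exp_increasing; nra | rewrite Hi2; lra]. }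
  assert (Q0 := exp_pos ((2 * L + 1) * clamp omega t)).
  replace (exp ((2 * L + 1) * clamp omega t) * (0 ^ 2 + K ^ 2 * clamp omega t))
    with (exp ((2 * L + 1) * clamp omega t) * clamp omega t * K ^ 2) by ring.
  apply Rmult_le_compat_r; [exact P|].
  apply Rle_trans with (growth omega L); [|nra].
  unfold growth; assert (exp ((2 * L + 1) * clamp omega t) * clamp omega t
    <= exp ((2 * L + 1) * omega) * omega) by (apply Rmult_le_compat; lra).
  lra.
Qed.

(* The solution of [y' = f t y h] exists for small [h] because [f] may be truncated
   outside a ball containing the solution at [h = 0]; its derivative in [h] solves
   the linearised equation, and Gronwall bounds the remainder quadratically. *)
Theorem smooth_parameter omega (f : R -> C -> C -> C) (y0 : R -> C) B :
  0 < omega -> (forall r, 0 <= r -> smooth r 1 f) ->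
  Ccont y0 -> (forall t, y0 (clamp omega t) = y0 t) -> (forall t, Cmod (y0 t) <= B) ->
  (forall t, 0 < t < omega -> CD y0 t (f t (y0 t) 0%C)) ->
  exists d (Y : R -> C -> C), 0 < d <= 1 /\
    (forall h, Cmod h <= d -> Ccont (fun t => Y t h) /\
       (forall t, Y (clamp omega t) h = Y t h) /\ Y 0 h = y0 0 /\
       forall t, 0 < t < omega -> CD (fun s => Y s h) t (f t (Y t h) h)) /\
    (forall t, Y t 0%C = y0 t) /\
    (forall r, smooth r d (fun t _ h => Y t h)).
Proof.
  intros Hw Hf Hy0 Hy0c HB Hy0d.
  assert (HB0 : 0 <= B) by (eapply Rle_trans; [apply Cmod_ge_0 | apply (HB 0)]).
  (* This leaves room [1] around [y0]. Since [clampC r] takes values of modulus up to [2 r],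
     smoothness is required on that larger disc. *)
  set (r := B + 1); assert (Hr : 0 <= r) by (unfold r; lra).
  assert (Hr2 : 0 <= 2 * r) by lra.
  destruct (Hf (2 * r) Hr2) as (fy & fh & K & HF).
  assert (HL := smooth_with_lipschitz _ _ f fy fh K Hr2 Rle_0_1 HF).
  set (L := K * (1 + 2 * (2 * r + 1))) in HL.
  destruct HF as (HK & F1 & F2 & F3).
  assert (HL0 : 0 <= L) by (apply Rmult_le_pos; lra).
  (* The condition on [h] stands under the existential so that a total function [X] can be chosen;
     [y0] is the default value for large [h]. *)
  assert (HX : forall h, exists x, Cmod h <= 1 ->
    Ccont x /\ (forall t, x (clamp omega t) = x t) /\ x 0 = y0 0 /\
    forall t, 0 < t < omega -> CD x t (f t (clampC r (x t)) h)).
  { intros h; destruct (Rle_dec (Cmod h) 1) as [Hh|Hh].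
    - destruct (picard_lipschitz omega (fun t y => f t (clampC r y) h) (2 * L) (y0 0))
        as [x Hx]; [exact Hw|lra| | |exists x; intros _; exact Hx].
      + intros x Hx; apply (F3 (fun t => clampC r (x t)) h);
          [apply Ccont_clampC, Hx | intros; apply clampC_bound, Hr | exact Hh].
      + intros t x y.
        eapply Rle_trans; [apply HL; try apply clampC_bound; assumption|].
        replace (h - h)%C with (RtoC 0) by ring; rewrite Cmod_0, Rplus_0_r.
        assert (C := clampC_lipschitz r x y).
        replace (2 * L * Cmod (x - y)) with (L * (2 * Cmod (x - y))) by ring.
        apply Rmult_le_compat_l; assumption.
    - exists y0; intros; contradiction. }
  set (X := fun h => proj1_sig (constructive_indefinite_description _ (HX h))).
  assert (HX' : forall h, Cmod h <= 1 ->
    Ccont (X h) /\ (forall t, X h (clamp omega t) = X h t) /\ X h 0 = y0 0 /\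
    forall t, 0 < t < omega -> CD (X h) t (f t (clampC r (X h t)) h)).
  { intros h; exact (proj2_sig (constructive_indefinite_description _ (HX h))). }
  clearbody X; clear HX.
  set (G := growth omega (2 * L)).
  assert (HG : 1 <= G) by (apply growth_pos; lra).
  assert (Hdiff : forall h x, Cmod h <= 1 -> Ccont x ->
    (forall t, x (clamp omega t) = x t) -> x 0 = y0 0 ->
    forall h', Cmod h' <= 1 ->
    (forall t, 0 < t < omega -> CD x t (f t (clampC r (x t)) h')) ->
    forall t, Cmod (X h t - x t) <= G * (L * Cmod (h - h'))).
  { intros h x Hh Hx Hxc Hx0 h' Hh' Hxd.
    destruct (HX' h Hh) as (A1 & A2 & A3 & A4).
    apply (gronwall_zero omega (fun t => X h t - x t)%C
      (fun t => f t (clampC r (X h t)) h - f t (clampC r (x t)) h')%C (2 * L)); try lra.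
    - apply Rmult_le_pos; [exact HL0 | apply Cmod_ge_0].
    - apply Ccont_minus; assumption.
    - intros t; rewrite A2, Hxc; reflexivity.
    - rewrite A3, Hx0; ring.
    - intros t Ht; apply CD_minus; [apply A4, Ht | apply Hxd, Ht].
    - intros t Ht.
      eapply Rle_trans; [apply HL; try apply clampC_bound; assumption|].
      assert (C := clampC_lipschitz r (X h t) (x t)).
      replace (2 * L * Cmod (X h t - x t) + L * Cmod (h - h'))
        with (L * (2 * Cmod (X h t - x t) + Cmod (h - h'))) by ring.
      apply Rmult_le_compat_l; lra. }
  assert (Hh0 : Cmod 0 <= 1) by (rewrite Cmod_0; lra).
  assert (Hy0cl : forall t, clampC r (y0 t) = y0 t).
  { intros t; apply clampC_id; specialize (HB t); unfold r; lra. }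
  assert (Hy0d' : forall t, 0 < t < omega -> CD y0 t (f t (clampC r (y0 t)) 0%C)).
  { intros t Ht; rewrite Hy0cl; apply Hy0d, Ht. }
  (* The solution at [h] deviates from [y0] by at most [G L |h|], hence by at most [1] here: it
     stays in the ball where [clampC] is the identity and solves the original equation. *)
  set (d := / (1 + G * L)).
  assert (HGL : 0 <= G * L) by (apply Rmult_le_pos; lra).
  assert (Hd : 0 < d <= 1).
  { unfold d; split; [apply Rinv_0_lt_compat; lra|].
    rewrite <- Rinv_1; apply Rinv_le_contravar; lra. }
  assert (HXb : forall h t, Cmod h <= d -> Cmod (X h t) <= r).
  { intros h t Hh.
    assert (H := Hdiff h y0 ltac:(lra) Hy0 Hy0c eq_refl 0%C Hh0 Hy0d' t).
    replace (h - 0)%C with h in H by ring.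
    replace (X h t) with (X h t - y0 t + y0 t)%C by ring.
    eapply Rle_trans; [apply Cmod_triangle|]; specialize (HB t).
    assert (G * (L * Cmod h) <= 1).
    { apply Rle_trans with ((1 + G * L) * d).
      - rewrite <- Rmult_assoc; apply Rmult_le_compat; auto using Cmod_ge_0; lra.
      - unfold d; rewrite Rinv_r by lra; lra. }
    unfold r; lra. }
  assert (HXd : forall h, Cmod h <= d ->
    Ccont (X h) /\ (forall t, X h (clamp omega t) = X h t) /\ X h 0 = y0 0 /\
    forall t, 0 < t < omega -> CD (X h) t (f t (X h t) h)).
  { intros h Hh; destruct (HX' h ltac:(lra)) as (A1 & A2 & A3 & A4).
    split; [exact A1|]; split; [exact A2|]; split; [exact A3|].
    intros t Ht; specialize (A4 t Ht); rewrite clampC_id in A4; [exact A4|].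
    apply HXb, Hh. }
  exists d, (fun t h => X h t); split; [exact Hd|]; split; [exact HXd|]; split.
  { intros t; assert (H := Hdiff 0%C y0 Hh0 Hy0 Hy0c eq_refl 0%C Hh0 Hy0d' t).
    replace (0 - 0)%C with (RtoC 0) in H by ring; rewrite Cmod_0, !Rmult_0_r in H.
    replace (X 0%C t) with (X 0%C t - y0 t + y0 t)%C by ring.
    rewrite (Cmod_eq_0 (X 0%C t - y0 t)); [ring|].
    apply Rle_antisym; [exact H | apply Cmod_ge_0]. }
  intros r'.
  (* The variational equation. Its initial value is [0] because [X h 0] does not depend on [h]. *)
  assert (HDx : forall h, exists x, Cmod h <= d ->
    Ccont x /\ (forall t, x (clamp omega t) = x t) /\ x 0 = 0%C /\
    forall t, 0 < t < omega -> CD x t (fy t (X h t) h * x t + fh t (X h t) h)%C).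
  { intros h; destruct (Rle_dec (Cmod h) d) as [Hh|Hh].
    - destruct (F3 (X h) h) as (_ & C2 & C3);
        [apply HXd, Hh | intros t; specialize (HXb h t Hh); lra | lra |].
      destruct (picard_lipschitz omega (fun t y => fy t (X h t) h * y + fh t (X h t) h)%C K 0%C)
        as [x Hx]; [exact Hw|exact HK| | |exists x; intros _; exact Hx].
      + intros x Hx; apply Ccont_plus; [apply Ccont_mult|]; assumption.
      + intros t x y.
        replace (fy t (X h t) h * x + fh t (X h t) h - (fy t (X h t) h * y + fh t (X h t) h))%C
          with (fy t (X h t) h * (x - y))%C by ring.
        rewrite Cmod_mult; apply Rmult_le_compat_r; [apply Cmod_ge_0|].
        specialize (HXb h t Hh); apply F1; lra.
    - exists y0; intros; contradiction. }
  set (DX := fun h => proj1_sig (constructive_indefinite_description _ (HDx h))).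
  assert (HDX : forall h, Cmod h <= d ->
    Ccont (DX h) /\ (forall t, DX h (clamp omega t) = DX h t) /\ DX h 0 = 0%C /\
    forall t, 0 < t < omega -> CD (DX h) t (fy t (X h t) h * DX h t + fh t (X h t) h)%C).
  { intros h; exact (proj2_sig (constructive_indefinite_description _ (HDx h))). }
  clearbody DX; clear HDx.
  set (J := growth omega K).
  assert (HJ : 1 <= J) by (apply growth_pos; lra).
  assert (HFb : forall h t, Cmod h <= d ->
    Cmod (fy t (X h t) h) <= K /\ Cmod (fh t (X h t) h) <= K).
  { intros h t Hh; specialize (HXb h t Hh); apply F1; lra. }
  set (S := G * L + 1).
  assert (HS : 0 <= J * (K * S ^ 2))
    by (apply Rmult_le_pos; [lra | apply Rmult_le_pos; [exact HK | apply pow2_ge_0]]).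
  assert (HJK : 0 <= J * K) by (apply Rmult_le_pos; lra).
  (* The three summands bound the solution, its derivative in [h], and the quadratic remainder; [S]
     is a Lipschitz constant of [(X h, h)] in [h]. *)
  exists (fun _ _ _ => 0%C), (fun t _ h => DX h t), (r + J * K + J * (K * S ^ 2)).
  split; [lra|]; split; [|split].
  - intros t y h _ Hh; specialize (HXb h t Hh); rewrite Cmod_0.
    split; [lra|]; split; [lra|].
    destruct (HDX h Hh) as (A1 & A2 & A3 & A4).
    assert (H : Cmod (DX h t) <= J * K); [|lra].
    apply (gronwall_zero omega (DX h) (fun t => fy t (X h t) h * DX h t + fh t (X h t) h)%C K);
      try assumption.
    intros s Hs; destruct (HFb h s Hh) as [B1 B2].
    eapply Rle_trans; [apply Cmod_triangle|]; rewrite Cmod_mult.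
    assert (P := Cmod_ge_0 (DX h s)); nra.
  - intros t y h y' h' _ Hh _ Hh'.
    destruct (HDX h Hh) as (A1 & A2 & A3 & A4).
    destruct (HXd h Hh) as (B1 & B2 & B3 & B4).
    destruct (HXd h' Hh') as (C1 & C2 & C3 & C4).
    assert (Hlip : forall s, Cmod (X h' s - X h s) + Cmod (h' - h) <= S * Cmod (h' - h)).
    { intros s; destruct (HX' h ltac:(lra)) as (_ & _ & _ & Hd4).
      assert (H := Hdiff h' (X h) ltac:(lra) B1 B2 B3 h ltac:(lra) Hd4 s).
      unfold S; lra. }
    assert (Hq : 0 <= K * (S * Cmod (h' - h)) ^ 2)
      by (apply Rmult_le_pos; [exact HK | apply pow2_ge_0]).
    assert (H : Cmod (X h' t - X h t - DX h t * (h' - h))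
                <= J * (K * (S * Cmod (h' - h)) ^ 2)).
    { apply (gronwall_zero omega (fun t => X h' t - X h t - DX h t * (h' - h))%C
        (fun t => f t (X h' t) h' - f t (X h t) h
                  - (fy t (X h t) h * DX h t + fh t (X h t) h) * (h' - h))%C K);
        try assumption.
      - apply Ccont_minus; [apply Ccont_minus; assumption|].
        apply Ccont_mult; [exact A1 | apply Ccont_const].
      - intros s; rewrite A2, B2, C2; reflexivity.
      - rewrite A3, B3, C3; ring.
      - intros s Hs; apply CD_minus; [apply CD_minus; [apply C4, Hs | apply B4, Hs]|].
        match goal with |- CD _ _ (?a * ?b)%C =>
          apply (CD_eq _ _ (a * b + DX h s * 0)%C); [ring|] end.
        apply CD_mult; [apply A4, Hs | apply CD_const].
      - intros s Hs; destruct (HFb h s Hh) as [D1 D2].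
        assert (X1 := HXb h s Hh); assert (X2 := HXb h' s Hh').
        assert (H2 := F2 s (X h s) h (X h' s) h' ltac:(lra) ltac:(lra) ltac:(lra) ltac:(lra)).
        (* The remainder satisfies the linearised equation with forcing term the remainder of [f],
           which is quadratic in [h' - h]. *)
        match type of H2 with Cmod ?a <= _ =>
          match goal with |- Cmod ?b <= _ =>
            replace b with (fy s (X h s) h * (X h' s - X h s - DX h s * (h' - h)) + a)%C by ring
          end end.
        eapply Rle_trans; [apply Cmod_triangle|]; rewrite Cmod_mult.
        apply Rplus_le_compat.
        + apply Rmult_le_compat_r; [apply Cmod_ge_0 | exact D1].
        + eapply Rle_trans; [exact H2|]; apply Rmult_le_compat_l; [exact HK|].
          apply pow_incr; split; [apply Rplus_le_le_0_compat; apply Cmod_ge_0 | apply Hlip]. }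
    replace (X h' t - X h t - (0 * (y' - y) + DX h t * (h' - h)))%C
      with (X h' t - X h t - DX h t * (h' - h))%C by ring.
    eapply Rle_trans; [exact H|].
    replace (J * (K * (S * Cmod (h' - h)) ^ 2))
      with (J * (K * S ^ 2) * Cmod (h' - h) ^ 2) by ring.
    apply Rle_trans with (J * (K * S ^ 2) * (Cmod (y' - y) + Cmod (h' - h)) ^ 2).
    + apply Rmult_le_compat_l; [exact HS|]; apply pow_incr.
      assert (P1 := Cmod_ge_0 (y' - y)); assert (P2 := Cmod_ge_0 (h' - h)); lra.
    + apply Rmult_le_compat_r; [apply pow2_ge_0 | lra].
  - intros x h _ _ Hh; destruct (HXd h Hh) as (A1 & _); destruct (HDX h Hh) as (B1 & _).
    split; [exact A1|]; split; [apply Ccont_const | exact B1].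
Qed.

(** * Solutions and the displacement function *)

Lemma norm_C_R (z : C) : norm (K := R_AbsRing) (V := C_R_NormedModule) z = Cmod z.
Proof.
  unfold norm; simpl; unfold prod_norm, Cmod, norm; simpl; unfold abs; simpl.
  f_equal; rewrite !Rmult_1_r, <- !Rabs_mult, !Rabs_pos_eq; auto; apply Rle_0_sqr.
Qed.

Lemma CD_eps (f : R -> C) t l :
  CD f t l <->
  (forall eps : posreal, exists d : posreal, forall s, Rabs (s - t) < d ->
     Cmod (f s - f t - RtoC (s - t) * l) <= eps * Rabs (s - t)).
Proof.
  split.
  - intros [[_ H1] [_ H2]] eps.
    specialize (H1 t (fun P H => H)); specialize (H2 t (fun P H => H)).
    assert (He : 0 < eps / 2) by (apply Rdiv_lt_0_compat; [apply eps | lra]).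
    destruct (filter_and _ _ (H1 (mkposreal _ He)) (H2 (mkposreal _ He))) as [d Hd].
    exists d; intros s Hs; destruct (Hd s Hs) as [A B].
    unfold norm, minus, plus, opp, scal in A, B; simpl in A, B.
    unfold abs, mult in A, B; simpl in A, B.
    eapply Rle_trans; [apply Cmod_le_abs|].
    replace (eps * Rabs (s - t)) with (eps / 2 * Rabs (s - t) + eps / 2 * Rabs (s - t)) by field.
    apply Rplus_le_compat.
    + eapply Rle_trans; [|exact A]; right; f_equal; unfold Re; simpl; ring.
    + eapply Rle_trans; [|exact B]; right; f_equal; unfold Im; simpl; ring.
  - intros H; split; (split; [apply is_linear_scal_l|]); intros x Hx eps;
      rewrite <- (is_filter_lim_locally_unique (V := R_NormedModule) t x Hx); clear x Hx;
      destruct (H eps) as [d Hd]; exists d; intros s Hs; specialize (Hd s Hs);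
      unfold norm, minus, plus, opp, scal; simpl; unfold abs, mult; simpl.
    + eapply Rle_trans; [|exact Hd].
      eapply Rle_trans; [|apply re_le_Cmod]; right; f_equal; unfold Re; simpl; ring.
    + eapply Rle_trans; [|exact Hd].
      eapply Rle_trans; [|apply im_le_Cmod]; right; f_equal; unfold Im; simpl; ring.
Qed.

Lemma filterdiff_within_eps omega (f : R -> C) t (l : C) :
  interval omega t ->
  filterdiff (K := R_AbsRing) (U := R_NormedModule) (V := C_R_NormedModule)
    f (within (interval omega) (locally t)) (fun s => scal s l) <->
  (forall eps : posreal, exists d : posreal, forall s, Rabs (s - t) < d ->
     interval omega s ->
     Cmod (f s - f t - RtoC (s - t) * l) <= eps * Rabs (s - t)).
Proof.
  intros Ht; split.
  - intros [_ H] eps.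
    assert (Hl : is_filter_lim (T := R_UniformSpace) (within (interval omega) (locally t)) t).
    { intros P HP; unfold within; revert HP; apply filter_imp; auto. }
    destruct (H t Hl eps) as [d Hd].
    exists d; intros s Hs Hi; specialize (Hd s Hs Hi).
    rewrite norm_C_R, scal_R_Cmult in Hd; exact Hd.
  - intros H; split; [exact (is_linear_scal_l (K := R_AbsRing) (V := C_R_NormedModule) l)|].
    intros x Hx eps.
    (* [filterdiff] speaks of every limit point of the filter. If [x <> t], the points other than
       [t] would form a neighbourhood of [x], but [t] lies in every set of the filter. *)
    assert (x = t).
    { apply NNPP; intros Hne.
      assert (P : locally x (fun s : R => s <> t)) by (apply (open_neq t); exact Hne).
      apply Hx in P; destruct P as [d Hd].
      apply (Hd t); [apply ball_center | exact Ht | reflexivity]. }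
    subst x; destruct (H eps) as [d Hd]; exists d; intros s Hs Hi.
    rewrite norm_C_R, scal_R_Cmult; exact (Hd s Hs Hi).
Qed.

(* Solutions frozen outside [0, omega]; the equation on the open interval suffices. *)
Definition strong_solution (omega : R) (F : R -> C -> C) (z : R -> C) : Prop :=
  Ccont z /\ (forall t, z (clamp omega t) = z t) /\
  forall t, 0 < t < omega -> CD z t (F t (z t)).

(** The increments of [z] are those of the integral of [F t (z t)], whose integrand is continuous on
    the line; this gives the one-sided derivatives at [0] and [omega]. *)
Lemma is_solution_of_strong omega F z :
  Ccont (fun t => F t (z t)) -> strong_solution omega F z -> is_solution F omega z.
Proof.
  intros HF (Hc & _ & Hd) t Ht; apply filterdiff_within_eps; [exact Ht|]; intros eps.
  assert (H := CInt_FTC omega z (fun t => F t (z t)) Hc HF Hd).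
  destruct (proj1 (CD_eps _ _ _) (CD_CInt (fun t => F t (z t)) 0 t HF) eps) as [d Hd'].
  exists d; intros s Hs Hi; specialize (Hd' s Hs); cbv beta in Hd'.
  rewrite (H s Hi), (H t Ht) in Hd'.
  replace (z s - z t)%C with (z s - z 0 - (z t - z 0))%C by ring; exact Hd'.
Qed.

Lemma continuous_of_Cmod (f : R -> C) t :
  (forall eps : posreal, exists d : posreal, forall s, Rabs (s - t) < d ->
     Cmod (f s - f t) < eps) ->
  continuous (fun s => Re (f s)) t /\ continuous (fun s => Im (f s)) t.
Proof.
  intros H; split; apply continuous_eps; intros eps; destruct (H eps) as [d Hd];
    exists d; intros s Hs; (eapply Rle_lt_trans; [|exact (Hd s Hs)]).
  - exact (re_le_Cmod (f s - f t)).
  - exact (im_le_Cmod (f s - f t)).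
Qed.

Lemma strong_of_is_solution omega F z :
  0 < omega -> is_solution F omega z ->
  strong_solution omega F (fun t => z (clamp omega t)).
Proof.
  intros Hw H; assert (Hw0 : 0 <= omega) by lra; split; [|split].
  - intros t; apply (continuous_of_Cmod (fun t => z (clamp omega t))); intros eps.
    assert (Hi := clamp_interval omega t Hw0).
    set (u := clamp omega t) in *.
    destruct (proj1 (filterdiff_within_eps omega z u _ Hi) (H u Hi) (mkposreal 1 Rlt_0_1))
      as [d Hd]; simpl in Hd.
    (* Differentiability at [u] with [eps = 1] bounds the increments near [u] by [M] times the
       distance. *)
    set (M := 1 + Cmod (F u (z u))).
    assert (HM : 0 < M) by (unfold M; assert (P := Cmod_ge_0 (F u (z u))); lra).
    assert (Hp : 0 < Rmin d (eps / M)).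
    { apply Rmin_pos; [apply d | apply Rdiv_lt_0_compat; [apply eps | exact HM]]. }
    exists (mkposreal _ Hp); intros s Hs; simpl in Hs.
    assert (Hs' : Rabs (clamp omega s - u) < Rmin d (eps / M)).
    { eapply Rle_lt_trans; [apply clamp_dist | exact Hs]. }
    assert (Hs1 := Rlt_le_trans _ _ _ Hs' (Rmin_l _ _)).
    assert (Hs2 := Rlt_le_trans _ _ _ Hs' (Rmin_r _ _)).
    specialize (Hd _ Hs1 (clamp_interval omega s Hw0)).
    replace (z (clamp omega s) - z u)%C
      with (z (clamp omega s) - z u - RtoC (clamp omega s - u) * F u (z u)
            + RtoC (clamp omega s - u) * F u (z u))%C by ring.
    eapply Rle_lt_trans; [apply Cmod_triangle|]; rewrite Cmod_mult, Cmod_R.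
    apply (Rmult_lt_compat_r M) in Hs2; [|exact HM].
    replace (eps / M * M) with (pos eps) in Hs2 by (field; lra).
    unfold M in *; lra.
  - intros t; rewrite clamp_idem by exact Hw0; reflexivity.
  - intros t Ht.
    assert (Hi : interval omega t) by (unfold interval; lra).
    rewrite (clamp_id omega t Hi); apply CD_clamp; [exact Ht|].
    apply CD_eps; intros eps.
    destruct (proj1 (filterdiff_within_eps omega z t _ Hi) (H t Hi) eps) as [d Hd].
    destruct (locally_interior omega t Ht) as [d' Hd'].
    assert (Hp : 0 < Rmin d d') by (apply Rmin_pos; apply cond_pos).
    exists (mkposreal _ Hp); intros s Hs; simpl in Hs.
    apply Hd; [eapply Rlt_le_trans; [exact Hs | apply Rmin_l]|].
    assert (0 < s < omega); [|unfold interval; lra].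
    apply Hd'; eapply Rlt_le_trans; [exact Hs | apply Rmin_r].
Qed.

(** * Uniqueness, displacement and its local factorisation *)

Definition smooth_field (F : R -> C -> C) : Prop :=
  forall r, 0 <= r -> smooth r 1 (fun t y _ => F t y).

Lemma smooth_field_cont F x B :
  smooth_field F -> Ccont x -> (forall t, Cmod (x t) <= B) -> Ccont (fun t => F t (x t)).
Proof.
  intros H Hx HB.
  assert (HB0 : 0 <= B) by (eapply Rle_trans; [apply Cmod_ge_0 | apply (HB 0)]).
  destruct (H B HB0) as (fy & fh & K & _ & _ & _ & H3).
  apply (H3 x 0%C Hx HB); rewrite Cmod_0; lra.
Qed.

Lemma strong_bounded omega F z :
  0 <= omega -> strong_solution omega F z -> exists B, 0 <= B /\ forall t, Cmod (z t) <= B.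
Proof.
  intros Hw (Hc & Hcl & _).
  destruct (Ccont_bounded_clamp omega z Hw Hc) as [B [HB0 HB]].
  exists B; split; [exact HB0|]; intros t; rewrite <- Hcl; apply HB.
Qed.

Lemma strong_is_solution omega F z :
  0 < omega -> smooth_field F -> strong_solution omega F z -> is_solution F omega z.
Proof.
  intros Hw HF Hz.
  destruct (strong_bounded omega F z (Rlt_le _ _ Hw) Hz) as [B [_ HB]].
  apply is_solution_of_strong; [|exact Hz].
  apply (smooth_field_cont F z B HF); [apply Hz | exact HB].
Qed.

(** Both solutions stay in a common ball, on which the field is Lipschitz, so [zero_propagates]
    applies to their difference. *)
Lemma strong_unique omega F z w :
  0 < omega -> smooth_field F -> strong_solution omega F z -> strong_solution omega F w ->
  forall s t, interval omega s -> interval omega t -> z s = w s -> z t = w t.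
Proof.
  intros Hw HF Hz Hz' s t Hs Ht E.
  destruct (strong_bounded omega F z (Rlt_le _ _ Hw) Hz) as [B1 [P1 HB1]].
  destruct (strong_bounded omega F w (Rlt_le _ _ Hw) Hz') as [B2 [P2 HB2]].
  set (B := B1 + B2); assert (HB : 0 <= B) by (unfold B; lra).
  destruct (HF B HB) as (fy & fh & K & HK).
  assert (HL := smooth_with_lipschitz _ _ _ _ _ K HB Rle_0_1 HK).
  destruct Hz as (A1 & A2 & A3), Hz' as (C1 & C2 & C3).
  assert (Z : (z t - w t)%C = 0%C).
  { apply (zero_propagates omega (fun t => z t - w t)%C
      (fun t => F t (z t) - F t (w t))%C (K * (1 + 2 * (B + 1)))) with (s := s);
      try assumption.
    - apply Ccont_minus; assumption.
    - intros u Hu; apply CD_minus; [apply A3 | apply C3]; exact Hu.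
    - intros u Hu; specialize (HB1 u); specialize (HB2 u).
      assert (H := HL u (w u) 0%C (z u) 0%C); rewrite Cmod_0 in H.
      replace (0 - 0)%C with (RtoC 0) in H by ring; rewrite Cmod_0, Rplus_0_r in H.
      apply H; unfold B; lra.
    - rewrite E; ring. }
  replace (z t) with (z t - w t + w t)%C by ring; rewrite Z; ring.
Qed.

(** [sol] picks a solution by [epsilon]; uniqueness identifies this pick with [z] at [omega]. *)
Lemma displacement omega F z c :
  0 < omega -> smooth_field F -> strong_solution omega F z -> z 0 = c ->
  Q F omega c /\ q F omega c = (z omega - z 0)%C.
Proof.
  intros Hw HF Hz H0.
  assert (HQ : Q F omega c).
  { exists z; split; [apply strong_is_solution; assumption | exact H0]. }
  split; [exact HQ|]; unfold q, sol.
  destruct (epsilon_spec (inhabits (fun _ : R => RtoC 0))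
    (fun z => is_solution F omega z /\ z 0 = c) HQ) as [A1 A2].
  set (w := epsilon _ _) in *.
  assert (I0 : interval omega 0) by (unfold interval; lra).
  assert (I1 : interval omega omega) by (unfold interval; lra).
  assert (E := strong_unique omega F _ z Hw HF (strong_of_is_solution omega F w Hw A1) Hz
                 0 omega I0 I1); cbv beta in E.
  rewrite !clamp_id in E by assumption.
  rewrite E, H0; [reflexivity|]; rewrite A2, H0; reflexivity.
Qed.

(** What [smooth] leaves for functions of [h] alone: complex differentiability with a remainder
    uniform on the disc, enough for holomorphy at its centre. *)
Definition quad_diff (d : R) (G : C -> C) : Prop :=
  exists (G' : C -> C) (K : R), 0 <= K /\
    forall h h', Cmod h <= d -> Cmod h' <= d ->
      Cmod (G h' - G h - G' h * (h' - h)) <= K * Cmod (h' - h) ^ 2.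

Lemma quad_diff_minus_const d G c : quad_diff d G -> quad_diff d (fun h => G h - c)%C.
Proof.
  intros (G' & K & HK & H); exists G', K; split; [exact HK|].
  intros h h' Hh Hh'; specialize (H h h' Hh Hh').
  replace (G h' - c - (G h - c) - G' h * (h' - h))%C
    with (G h' - G h - G' h * (h' - h))%C by ring; exact H.
Qed.

Lemma quad_diff_eval d (f : R -> C -> C -> C) t :
  smooth 0 d f -> quad_diff d (fun h => f t 0%C h).
Proof.
  intros (fy & fh & K & HK & _ & H & _).
  exists (fun h => fh t 0%C h), K; split; [exact HK|].
  intros h h' Hh Hh'.
  assert (C0 : Cmod 0 <= 0) by (rewrite Cmod_0; lra).
  specialize (H t 0%C h 0%C h' C0 Hh C0 Hh').
  replace (fy t 0%C h * (0 - 0) + fh t 0%C h * (h' - h))%C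
    with (fh t 0%C h * (h' - h))%C in H by ring.
  replace (0 - 0)%C with (RtoC 0) in H by ring.
  rewrite Cmod_0, Rplus_0_l in H; exact H.
Qed.

(** Differentiation under the integral sign: the remainder is uniform in [t], so it can be
    integrated. *)
Lemma quad_diff_CInt omega d (f : R -> C -> C -> C) :
  0 <= omega -> smooth 0 d f -> quad_diff d (fun h => CInt (fun t => f t 0%C h) 0 omega).
Proof.
  intros Hw Hf; assert (Hq := fun t => quad_diff_eval d f t Hf).
  destruct Hf as (fy & fh & K & HK & _ & H & Hc).
  assert (C0 : Cmod 0 <= 0) by (rewrite Cmod_0; lra).
  assert (Hc' : forall h, Cmod h <= d ->
    Ccont (fun t => f t 0%C h) /\ Ccont (fun t => fh t 0%C h)).
  { intros h Hh; destruct (Hc (fun _ => 0%C) h) as (A & _ & B);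
      [apply Ccont_const | intros; exact C0 | exact Hh | split; assumption]. }
  exists (fun h => CInt (fun t => fh t 0%C h) 0 omega), (2 * omega * K).
  split; [apply Rmult_le_pos; [lra | exact HK]|].
  intros h h' Hh Hh'.
  destruct (Hc' h Hh) as [A1 A2]; destruct (Hc' h' Hh') as [B1 _].
  assert (E := CInt_linear omega (fun t => f t 0%C h') (fun t => f t 0%C h)
    (fun t => fh t 0%C h) (h' - h)%C omega (conj Hw (Rle_refl _)) B1 A1 A2).
  rewrite (Cmult_comm (CInt _ _ _)), <- E, Rmult_assoc.
  apply Cmod_CInt_le; [exact Hw| |].
  - apply Ccont_minus; [apply Ccont_minus; assumption|].
    apply Ccont_mult; [apply Ccont_const | exact A2].
  - intros t _; specialize (H t 0%C h 0%C h' C0 Hh C0 Hh').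
    replace (fy t 0%C h * (0 - 0) + fh t 0%C h * (h' - h))%C
      with ((h' - h) * fh t 0%C h)%C in H by ring.
    replace (0 - 0)%C with (RtoC 0) in H by ring.
    rewrite Cmod_0, Rplus_0_l in H; exact H.
Qed.

Lemma locally_Cmod (c : C) d : 0 < d -> locally c (fun w : C => Cmod (w - c) < d).
Proof.
  intros Hd; assert (He : 0 < d / 2) by lra.
  exists (mkposreal _ He); intros w [H1 H2].
  unfold ball in H1, H2; simpl in H1, H2.
  unfold AbsRing_ball, abs, minus, plus, opp in H1, H2; simpl in H1, H2.
  eapply Rle_lt_trans; [apply Cmod_le_abs|]; unfold Re, Im; simpl; lra.
Qed.

Lemma holomorphic_of_quad_diff d G c :
  0 < d -> quad_diff d G -> holomorphic_at (fun w => G (w - c)%C) c.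
Proof.
  intros Hd (G' & K & HK & H); unfold holomorphic_at.
  generalize (locally_Cmod c d Hd); apply filter_imp; intros w Hw.
  exists (G' (w - c)%C); split; [apply is_linear_scal_l|].
  intros x Hx eps; rewrite <- (is_filter_lim_locally_unique
    (V := AbsRing_NormedModule C_AbsRing) w x Hx); clear x Hx.
  (* The first bound keeps [v] in the disc; the second turns the quadratic remainder into one linear
     with factor [eps]. *)
  assert (Hp : 0 < Rmin (d - Cmod (w - c)) (eps / (K + 1))).
  { apply Rmin_pos; [lra | apply Rdiv_lt_0_compat; [apply eps | lra]]. }
  exists (mkposreal _ Hp); intros v Hv.
  assert (Hv' : Cmod (v - w) < Rmin (d - Cmod (w - c)) (eps / (K + 1))) by exact Hv.
  assert (V1 := Rlt_le_trans _ _ _ Hv' (Rmin_l _ _)).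
  assert (V2 := Rlt_le_trans _ _ _ Hv' (Rmin_r _ _)).
  assert (Hvc : Cmod (v - c) <= d).
  { replace (v - c)%C with ((v - w) + (w - c))%C by ring.
    eapply Rle_trans; [apply Cmod_triangle | lra]. }
  specialize (H (w - c)%C (v - c)%C (Rlt_le _ _ Hw) Hvc).
  replace (v - c - (w - c))%C with (v - w)%C in H by ring.
  change (Cmod (G (v - c)%C - G (w - c)%C - (v - w) * G' (w - c)%C) <= eps * Cmod (v - w)).
  match goal with |- Cmod (_ - ?a * ?b) <= _ => rewrite (Cmult_comm a b) end.
  eapply Rle_trans; [exact H|].
  assert (P := Cmod_ge_0 (v - w)%C).
  apply (Rmult_lt_compat_r (K + 1)) in V2; [|lra].
  replace (eps / (K + 1) * (K + 1)) with (pos eps) in V2 by (field; lra).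
  nra.
Qed.

Lemma multiplicity_of_factor omega F z0 (Z : C -> R -> C) d G m :
  0 < omega -> smooth_field F -> 0 < d -> quad_diff d G -> G 0%C <> 0%C ->
  (forall h, Cmod h <= d -> strong_solution omega F (Z h) /\
     Z h 0 = (z0 0 + h)%C /\ (Z h omega - Z h 0)%C = (h ^ m * G h)%C) ->
  multiplicity F omega z0 m.
Proof.
  intros Hw HF Hd HG HG0 HZ.
  exists (fun w => G (w - z0 0)%C); split; [apply (holomorphic_of_quad_diff d); assumption|].
  split; [replace (z0 0 - z0 0)%C with (RtoC 0) by ring; exact HG0|].
  generalize (locally_Cmod (z0 0) d Hd); apply filter_imp; intros w Hw'.
  destruct (HZ (w - z0 0)%C (Rlt_le _ _ Hw')) as (A1 & A2 & A3).
  assert (E : forall u v : C, (u + (v - u))%C = v) by (intros; ring); rewrite E in A2.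
  destruct (displacement omega F _ w Hw HF A1 A2) as [B1 B2].
  split; [exact B1 | rewrite B2; exact A3].
Qed.

(** * Variation of a solution *)

Definition coefficient (omega : R) (a : R -> R) : Prop :=
  (forall t, continuous a t) /\ forall t, a (clamp omega t) = a t.

(* The right-hand side for [n = m + 3]. *)
Definition field (m : nat) (a b : R -> R) (t : R) (z : C) : C :=
  (z ^ S (S (S m)) + RtoC (a t) * z ^ S (S m) + RtoC (b t) * z ^ S m)%C.

Lemma smooth_coefficient omega a r d :
  0 <= omega -> coefficient omega a -> smooth r d (fun t _ _ => RtoC (a t)).
Proof.
  intros Hw [Hc Hcl]; destruct (bounded_clamp omega a Hw Hc) as [B [_ HB]].
  apply (smooth_coef r d (fun t => RtoC (a t)) B); [apply Ccont_RtoC, Hc|].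
  intros t; rewrite Cmod_R, <- Hcl; apply HB.
Qed.

Lemma smooth_poly omega a b r d (p1 p2 p3 : R -> C -> C -> C) :
  0 <= omega -> 0 <= r -> 0 <= d -> coefficient omega a -> coefficient omega b ->
  smooth r d p1 -> smooth r d p2 -> smooth r d p3 ->
  smooth r d (fun t y h => p1 t y h + RtoC (a t) * p2 t y h + RtoC (b t) * p3 t y h)%C.
Proof.
  intros Hw Hr Hd Ha Hb H1 H2 H3.
  apply (smooth_plus r d (fun t y h => p1 t y h + RtoC (a t) * p2 t y h)%C
                         (fun t y h => RtoC (b t) * p3 t y h)%C).
  - apply (smooth_plus r d p1 (fun t y h => RtoC (a t) * p2 t y h)%C); [exact H1|].
    apply (smooth_mult r d (fun t y h => RtoC (a t)) p2 Hr Hd); [|exact H2].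
    apply (smooth_coefficient omega); assumption.
  - apply (smooth_mult r d (fun t y h => RtoC (b t)) p3 Hr Hd); [|exact H3].
    apply (smooth_coefficient omega); assumption.
Qed.

Lemma smooth_field_field omega m a b :
  0 <= omega -> coefficient omega a -> coefficient omega b -> smooth_field (field m a b).
Proof.
  intros Hw Ha Hb r Hr.
  assert (P : forall k, smooth r 1 (fun _ y _ => y ^ k)%C).
  { intros k; apply (smooth_pow r 1 (fun _ y _ => y)); [exact Hr | lra | apply smooth_y, Hr]. }
  apply (smooth_poly omega a b r 1 (fun _ y _ => y ^ S (S (S m)))%C
    (fun _ y _ => y ^ S (S m))%C (fun _ y _ => y ^ S m)%C); auto; lra.
Qed.

(* The divided difference [((w + h y) ^ k - w ^ k) / h]. *)
Fixpoint dpow (w h y : C) (k : nat) : C :=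
  match k with
  | O => 0%C
  | S k => (y * (w + h * y) ^ k + w * dpow w h y k)%C
  end.

Lemma dpow_spec w h y k : ((w + h * y) ^ k = w ^ k + h * dpow w h y k)%C.
Proof.
  induction k as [|k IH]; [simpl; ring|].
  simpl dpow; rewrite (Cpow_S _ k), (Cpow_S w k).
  replace ((w + h * y) * (w + h * y) ^ k)%C
    with (w * (w + h * y) ^ k + h * (y * (w + h * y) ^ k))%C by ring.
  rewrite IH at 1; ring.
Qed.

(** At [h = 0] the divided difference is the derivative. For [k = 0] the truncated exponent is
    harmless, its coefficient being [0]. *)
Lemma dpow_h0 w y k : (dpow w 0 y k = RtoC (INR k) * w ^ (k - 1) * y)%C.
Proof.
  induction k as [|k IH]; [change (INR 0) with 0; simpl; ring|].
  simpl dpow; rewrite IH, S_INR, RtoC_plus.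
  replace (w + 0 * y)%C with w by ring.
  destruct k as [|k]; [change (INR 0) with 0; simpl; ring|].
  replace (S (S k) - 1)%nat with (S k) by lia.
  replace (S k - 1)%nat with k by lia.
  rewrite !Cpow_S; ring.
Qed.

Lemma dpow_w0 h y k : (dpow 0 h y (S k) = h ^ k * y ^ S k)%C.
Proof.
  simpl dpow; replace (0 + h * y)%C with (h * y)%C by ring.
  rewrite Cpow_mult_l, Cpow_S; ring.
Qed.

Lemma smooth_dpow r d (w : R -> C) B (Y : R -> C -> C -> C) k :
  0 <= r -> 0 <= d -> Ccont w -> (forall t, Cmod (w t) <= B) -> smooth r d Y ->
  smooth r d (fun t y h => dpow (w t) h (Y t y h) k).
Proof.
  intros Hr Hd Hw HB HY.
  assert (Hw' : smooth r d (fun t _ _ => w t)) by (apply (smooth_coef r d w B); assumption).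
  induction k as [|k IH]; [exact (smooth_const r d 0)|].
  simpl dpow.
  apply (smooth_plus r d (fun t y h => Y t y h * (w t + h * Y t y h) ^ k)%C
    (fun t y h => w t * dpow (w t) h (Y t y h) k)%C).
  - apply (smooth_mult r d Y (fun t y h => (w t + h * Y t y h) ^ k)%C Hr Hd HY).
    apply (smooth_pow r d (fun t y h => w t + h * Y t y h)%C k Hr Hd).
    apply (smooth_plus r d (fun t _ _ => w t) (fun t y h => h * Y t y h)%C Hw').
    exact (smooth_mult r d (fun _ _ h => h) Y Hr Hd (smooth_h r d Hd) HY).
  - exact (smooth_mult r d (fun t _ _ => w t) (fun t y h => dpow (w t) h (Y t y h) k)
             Hr Hd Hw' IH).
Qed.

(* [z + h y] solves the equation iff [y] solves [y' = dfield], when [z] is a solution. *)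
Definition dfield (m : nat) (a b : R -> R) (w : R -> C) (t : R) (y h : C) : C :=
  (dpow (w t) h y (S (S (S m))) + RtoC (a t) * dpow (w t) h y (S (S m))
   + RtoC (b t) * dpow (w t) h y (S m))%C.

Lemma dfield_spec m a b w t y h :
  (field m a b t (w t + h * y) = field m a b t (w t) + h * dfield m a b w t y h)%C.
Proof. unfold field, dfield; rewrite !dpow_spec; ring. Qed.

Definition linearized (m : nat) (a b : R -> R) (w : R -> C) (t : R) : C :=
  (RtoC (INR (S (S (S m)))) * w t ^ S (S m) + RtoC (a t) * (RtoC (INR (S (S m))) * w t ^ S m)
   + RtoC (b t) * (RtoC (INR (S m)) * w t ^ m))%C.

Lemma dfield_h0 m a b w t y : dfield m a b w t y 0 = (linearized m a b w t * y)%C.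
Proof.
  unfold dfield, linearized; rewrite !dpow_h0.
  replace (S (S (S m)) - 1)%nat with (S (S m)) by lia.
  replace (S (S m) - 1)%nat with (S m) by lia.
  replace (S m - 1)%nat with m by lia; ring.
Qed.

Lemma Ccont_linearized omega m a b w :
  coefficient omega a -> coefficient omega b -> Ccont w -> Ccont (linearized m a b w).
Proof.
  intros [Ha _] [Hb _] Hw; unfold linearized.
  assert (P : forall (c : R) k, Ccont (fun t => RtoC c * w t ^ k)%C).
  { intros c k; exact (Ccont_mult (fun _ => RtoC c) (fun t => w t ^ k)%C
                         (Ccont_const _) (Ccont_pow w k Hw)). }
  exact (Ccont_plus _ _ (Ccont_plus _ _ (P _ _)
    (Ccont_mult _ _ (Ccont_RtoC a Ha) (P _ _))) (Ccont_mult _ _ (Ccont_RtoC b Hb) (P _ _))).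
Qed.

(** The moving initial value [w 0 + h] becomes the fixed value [1] for [y], with [h] a parameter of
    the equation. At [h = 0] this equation is linear, so its solution exists on all of [[0, omega]];
    [smooth_parameter] then covers small [h]. *)
Theorem solution_family omega m a b w :
  0 < omega -> coefficient omega a -> coefficient omega b ->
  strong_solution omega (field m a b) w ->
  exists d (Y : R -> C -> C), 0 < d <= 1 /\
    (forall h, Cmod h <= d ->
       Ccont (fun t => Y t h) /\ Y 0 h = 1%C /\
       (forall t, 0 < t < omega -> CD (fun s => Y s h) t (dfield m a b w t (Y t h) h)) /\
       strong_solution omega (field m a b) (fun t => w t + h * Y t h)%C) /\
    (forall r, smooth r d (fun t _ h => Y t h)).
Proof.
  intros Hw Ha Hb Hz; assert (Hw0 := Rlt_le _ _ Hw).
  destruct (strong_bounded omega _ w Hw0 Hz) as [B [HB0 HB]].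
  assert (Hz' := Hz); destruct Hz' as (Hz1 & Hz2 & Hz3).
  assert (HL := Ccont_linearized omega m a b w Ha Hb Hz1).
  destruct (Ccont_bounded_clamp omega _ Hw0 HL) as [L [HL0 HLb]].
  assert (HLb' : forall t, Cmod (linearized m a b w t) <= L).
  { intros t; specialize (HLb t); revert HLb.
    unfold linearized; rewrite (proj2 Ha), (proj2 Hb), Hz2; exact (fun H => H). }
  destruct (picard_lipschitz omega (fun t y => linearized m a b w t * y)%C L 1%C)
    as [y0 (Hy1 & Hy2 & Hy3 & Hy4)]; [exact Hw | exact HL0 | | |].
  { intros x Hx; apply Ccont_mult; assumption. }
  { intros t x y; replace (linearized m a b w t * x - linearized m a b w t * y)%C
      with (linearized m a b w t * (x - y))%C by ring.
    rewrite Cmod_mult; apply Rmult_le_compat_r; [apply Cmod_ge_0 | apply HLb']. }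
  destruct (Ccont_bounded_clamp omega y0 Hw0 Hy1) as [B1 [_ HB1]].
  destruct (smooth_parameter omega (dfield m a b w) y0 B1) as (d & Y & Hd & H1 & _ & H3);
    try assumption.
  - intros r Hr; unfold dfield.
    apply (smooth_poly omega a b r 1 (fun t y h => dpow (w t) h y (S (S (S m))))
      (fun t y h => dpow (w t) h y (S (S m))) (fun t y h => dpow (w t) h y (S m)));
      try assumption; try lra;
      apply (smooth_dpow r 1 w B (fun _ y _ => y)); try assumption; try lra; apply smooth_y, Hr.
  - intros t; rewrite <- Hy2; apply HB1.
  - intros t Ht; rewrite dfield_h0; apply Hy4, Ht.
  - exists d, Y; split; [exact Hd|]; split; [|exact H3].
    intros h Hh; destruct (H1 h Hh) as (A1 & A2 & A3 & A4).
    split; [exact A1|]; split; [rewrite A3; exact Hy3|]; split; [exact A4|].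
    split; [|split].
    + apply Ccont_plus; [exact Hz1 | apply Ccont_mult; [apply Ccont_const | exact A1]].
    + intros t; rewrite Hz2, A2; reflexivity.
    + intros t Ht; rewrite dfield_spec; apply CD_plus; [apply Hz3, Ht|].
      apply CD_scal, A4, Ht.
Qed.

(** * Conjugation, the zero solution, and invariance of the real axis *)

Lemma field_conj m a b t z : Cconj (field m a b t z) = field m a b t (Cconj z).
Proof.
  unfold field; rewrite !Cplus_conj, !Cmult_conj, !Cpow_conj.
  assert (E : forall x : R, Cconj (RtoC x) = RtoC x).
  { intros x; unfold Cconj, RtoC; simpl; f_equal; ring. }
  rewrite !E; reflexivity.
Qed.

Lemma field_zero m a b t : field m a b t 0%C = 0%C.
Proof. unfold field; rewrite !Cpow_S; ring. Qed.

Lemma strong_zero omega m a b : strong_solution omega (field m a b) (fun _ => 0%C).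
Proof.
  split; [apply Ccont_const|]; split; [reflexivity|].
  intros t _; rewrite field_zero; apply CD_const.
Qed.

Lemma strong_conj omega m a b z :
  strong_solution omega (field m a b) z ->
  strong_solution omega (field m a b) (fun t => Cconj (z t)).
Proof.
  intros (H1 & H2 & H3); split; [apply Ccont_conj, H1|]; split.
  - intros t; rewrite H2; reflexivity.
  - intros t Ht; rewrite <- field_conj; apply CD_conj, H3, Ht.
Qed.

Lemma strong_zero_propagates omega m a b z s t :
  0 < omega -> coefficient omega a -> coefficient omega b ->
  strong_solution omega (field m a b) z ->
  z s = 0%C -> z t = 0%C.
Proof.
  intros Hw Ha Hb Hz H0; assert (Hcl := proj1 (proj2 Hz)).
  rewrite <- Hcl; rewrite <- Hcl in H0.
  refine (strong_unique omega (field m a b) z (fun _ => 0%C) Hw _ Hz _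
           (clamp omega s) (clamp omega t) _ _ H0);
    try (apply clamp_interval; lra).
  - apply (smooth_field_field omega); try assumption; lra.
  - apply strong_zero.
Qed.

(** The coefficients are real, so the conjugate of a solution is a solution; the two coincide
    everywhere once they meet. *)
Lemma strong_real_propagates omega m a b z s t :
  0 < omega -> coefficient omega a -> coefficient omega b ->
  strong_solution omega (field m a b) z ->
  Im (z s) = 0 -> Im (z t) = 0.
Proof.
  intros Hw Ha Hb Hz H0; assert (Hcl := proj1 (proj2 Hz)).
  rewrite <- Hcl; rewrite <- Hcl in H0.
  assert (E : z (clamp omega t) = Cconj (z (clamp omega t))).
  { refine (strong_unique omega (field m a b) z (fun t => Cconj (z t)) Hw _ Hz _
           (clamp omega s) (clamp omega t) _ _ _);
    try (apply clamp_interval; lra).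
    - apply (smooth_field_field omega); try assumption; lra.
    - apply strong_conj, Hz.
    - unfold Cconj; rewrite (surjective_pairing (z (clamp omega s))) at 1.
      unfold Im in H0; rewrite H0; f_equal; ring. }
  apply (f_equal Im) in E; rewrite im_conj in E; lra.
Qed.

(** * Multiplicity of the zero solution *)

(** The displacement at [w 0 + h] is [h ^ k * G h]. The leading coefficient [g0] is recorded because
    both its nonvanishing and its sign are used: the former for multiplicity, the latter for
    existence. *)
Definition local_factor (omega : R) (F : R -> C -> C) (w : R -> C) (k : nat) (g0 : C) : Prop :=
  exists d (G : C -> C) (Z : C -> R -> C), 0 < d /\ quad_diff d G /\ G 0%C = g0 /\
    forall h, Cmod h <= d -> strong_solution omega F (Z h) /\
      Z h 0 = (w 0 + h)%C /\ (Z h omega - Z h 0)%C = (h ^ k * G h)%C.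

Lemma multiplicity_of_local_factor omega F w k (g0 : C) :
  0 < omega -> smooth_field F -> g0 <> RtoC 0 -> local_factor omega F w k g0 ->
  multiplicity F omega w k.
Proof.
  intros Hw HF Hg (d & G & Z & Hd & HG & H0 & HZ).
  apply (multiplicity_of_factor omega F w Z d G k); try assumption.
  rewrite H0; exact Hg.
Qed.

(** The factor [c] is never divided out, since it will be a power of [h], possibly [0]. *)
Lemma increment_CInt omega (F g : R -> C) c :
  0 <= omega -> Ccont F -> Ccont g ->
  (forall t, 0 < t < omega -> CD F t (c * g t)%C) ->
  (F omega - F 0)%C = (c * CInt g 0 omega)%C.
Proof.
  intros Hw HF Hg HD.
  assert (H := constant_of_CD_zero omega (fun t => F t - c * CInt g 0 t)%C).
  cbv beta in H; rewrite CInt_point in H.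
  assert (E : (F omega - c * CInt g 0 omega)%C = (F 0 - c * 0)%C).
  { apply H; [| |unfold interval; lra].
    - apply Ccont_minus; [exact HF|].
      apply Ccont_mult; [apply Ccont_const | apply Ccont_CInt, Hg].
    - intros t Ht; apply (CD_eq _ _ (c * g t - c * g t)%C); [ring|].
      apply CD_minus; [apply HD, Ht | apply CD_scal, CD_CInt, Hg]. }
  replace (F omega) with (F omega - c * CInt g 0 omega + c * CInt g 0 omega)%C by ring.
  rewrite E; ring.
Qed.

Lemma linear_real_explicit omega (k : R -> R) (u : R -> C) :
  (forall t, continuous k t) -> Ccont u -> u 0 = 1%C ->
  (forall t, 0 < t < omega -> CD u t (RtoC (k t) * u t)%C) ->
  forall t, interval omega t -> u t = RtoC (exp (RInt k 0 t)).
Proof.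
  intros Hk Hu H0 HD t Ht.
  assert (He : forall s, is_derive (fun s => exp (- RInt k 0 s)) s (- k s * exp (- RInt k 0 s))).
  { intros s; assert (H := is_derive_RInt_cont k 0 s Hk).
    evar_last; [apply (is_derive_comp exp (fun s => - RInt k 0 s));
      [apply is_derive_exp | apply (is_derive_opp (V := R_NormedModule)), H]|].
    unfold scal, opp; simpl; unfold mult; simpl; ring. }
  assert (H := constant_of_CD_zero omega (fun s => u s * RtoC (exp (- RInt k 0 s)))%C).
  cbv beta in H; rewrite RInt_point, H0 in H.
  change (@zero _) with 0 in H; rewrite Ropp_0, exp_0 in H.
  assert (E : (u t * RtoC (exp (- RInt k 0 t)))%C = (1 * 1)%C).
  { apply H; [| |exact Ht].
    - apply Ccont_mult; [exact Hu|]; apply (Ccont_RtoC (fun s => exp (- RInt k 0 s))); intros s.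
      apply (ex_derive_continuous (V := R_NormedModule)); eexists; apply He.
    - intros s Hs.
      apply (CD_eq _ _ (RtoC (k s) * u s * RtoC (exp (- RInt k 0 s))
        + u s * RtoC (- k s * exp (- RInt k 0 s)))%C).
      + rewrite RtoC_mult, RtoC_opp; ring.
      + exact (CD_mult u (fun s => RtoC (exp (- RInt k 0 s))) s _ _ (HD s Hs)
                 (CD_RtoC (fun s => exp (- RInt k 0 s)) s _ (He s))). }
  replace (u t) with (u t * RtoC (exp (- RInt k 0 t)) * RtoC (exp (RInt k 0 t)))%C.
  - rewrite E; ring.
  - rewrite <- Cmult_assoc, <- RtoC_mult, <- exp_plus, Rplus_opp_l, exp_0; ring.
Qed.

Lemma RInt_neg omega (g : R -> R) t0 :
  0 < omega -> (forall t, continuous g t) -> (forall t, interval omega t -> g t <= 0) ->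
  interval omega t0 -> g t0 < 0 -> RInt g 0 omega < 0.
Proof.
  intros Hw Hc Hg Ht0 Hn.
  set (H := fun t => RInt g 0 t).
  assert (HD : forall t, is_derive H t (g t)) by (intros t; apply is_derive_RInt_cont, Hc).
  assert (HC : forall t, continuous H t).
  { intros t; apply (ex_derive_continuous (V := R_NormedModule)); eexists; apply HD. }
  assert (Hm : forall s t, 0 <= s -> s <= t -> t <= omega -> H t <= H s).
  { intros s t H1 H2 H3; apply (decreasing_of_derive_nonpos H g); auto.
    intros u Hu; apply Hg; unfold interval; lra. }
  assert (Hd : 0 < - g t0) by lra.
  destruct (proj1 (continuous_eps g t0) (Hc t0) (mkposreal _ Hd)) as [d Hd']; simpl in Hd'.
  assert (Hd0 := cond_pos d); destruct Ht0 as [T0 T1].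
  (* [t0] may be an endpoint, so the window around it is cut to [[0, omega]]; it keeps positive
     length, and [g] is negative on it. *)
  set (p := Rmax 0 (t0 - d / 2)); set (r := Rmin omega (t0 + d / 2)).
  assert (Hp : 0 <= p /\ t0 - d / 2 <= p /\ p <= t0).
  { unfold p; split; [apply Rmax_l|]; split; [apply Rmax_r | apply Rmax_lub; lra]. }
  assert (Hr : r <= omega /\ r <= t0 + d / 2 /\ t0 <= r).
  { unfold r; split; [apply Rmin_l|]; split; [apply Rmin_r | apply Rmin_glb; lra]. }
  assert (Hpr : p < r).
  { unfold p, r; apply Rmax_lub_lt; apply Rmin_glb_lt; lra. }
  destruct (mean_value_interior H g p r Hpr HC (fun t _ => HD t)) as [s [Hs E]].
  assert (Hgs : g s < 0).
  { specialize (Hd' s); assert (Hsd : Rabs (s - t0) < d) by (apply Rabs_def1; lra).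
    apply Hd', Rabs_lt_between in Hsd; lra. }
  assert (A1 := Hm 0 p ltac:(lra) ltac:(lra) ltac:(lra)).
  assert (A2 := Hm r omega ltac:(lra) ltac:(lra) ltac:(lra)).
  assert (A0 : H 0 = 0) by (unfold H; rewrite RInt_point; reflexivity).
  change (H omega < 0); nra.
Qed.

Lemma CInt_RtoC (f : R -> R) a b : CInt (fun t => RtoC (f t)) a b = RtoC (RInt f a b).
Proof.
  unfold CInt, RtoC; f_equal; simpl.
  rewrite RInt_const; unfold scal; simpl; unfold mult; simpl; ring.
Qed.

Lemma CInt_ext omega f g :
  0 <= omega -> (forall t, interval omega t -> f t = g t) -> CInt f 0 omega = CInt g 0 omega.
Proof.
  intros Hw E; unfold CInt; f_equal; apply RInt_ext; rewrite Rmin_left, Rmax_right by lra;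
    intros t Ht; rewrite E; unfold interval; auto; lra.
Qed.

(** Along the zero solution every term carries [h ^ m]; this common factor fixes the order of the
    displacement when the [b] term survives integration. *)
Lemma zero_family_eq m a b t y h :
  dfield m a b (fun _ => 0%C) t y h =
  (h ^ m * (h ^ 2 * y ^ S (S (S m)) + RtoC (a t) * (h * y ^ S (S m)) + RtoC (b t) * y ^ S m))%C.
Proof. unfold dfield; rewrite !dpow_w0, !(Cpow_S h); simpl (h ^ 0)%C; ring. Qed.

Lemma smooth_Ccont r d f h :
  0 <= r -> smooth r d f -> Cmod h <= d -> Ccont (fun t => f t 0%C h).
Proof.
  intros Hr (fy & fh & K & _ & _ & _ & H) Hh.
  apply (H (fun _ => 0%C) h); [apply Ccont_const | intros; rewrite Cmod_0; exact Hr | exact Hh].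
Qed.

(* [P] is a correction with equal end values: subtracting it from [Y] does not affect the
   increment over the period, but may raise the order in [h] of the integrand. *)
Lemma local_factor_of_integrand omega m a b k (g0 : C) (Y : R -> C -> C) d
  (psi : R -> C -> C) (P : C -> R -> C) :
  0 < omega -> 0 < d <= 1 ->
  (forall h, Cmod h <= d ->
       Ccont (fun t => Y t h) /\ Y 0 h = 1%C /\
       (forall t, 0 < t < omega ->
          CD (fun s => Y s h) t (dfield m a b (fun _ => 0%C) t (Y t h) h)) /\
       strong_solution omega (field m a b) (fun t => 0 + h * Y t h)%C) ->
  smooth 0 d (fun t _ h => psi t h) ->
  (forall h, Cmod h <= d -> Ccont (P h) /\ P h omega = P h 0 /\
     forall t, 0 < t < omega ->
       CD (fun s => Y s h - P h s)%C t (h ^ k * psi t h)%C) ->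
  CInt (fun t => psi t 0%C) 0 omega = g0 ->
  local_factor omega (field m a b) (fun _ => 0%C) (S k) g0.
Proof.
  intros Hw Hd HY Hpsi HP Hg0.
  exists d, (fun h => CInt (fun t => psi t h) 0 omega), (fun h t => 0 + h * Y t h)%C.
  split; [lra|]; split; [|split; [exact Hg0|]].
  - apply (quad_diff_CInt omega d (fun t _ h => psi t h)); [lra | exact Hpsi].
  - intros h Hh; destruct (HY h Hh) as (A1 & A2 & A3 & A4); destruct (HP h Hh) as (B1 & B2 & B3).
    split; [exact A4|]; split; [rewrite A2; ring|].
    assert (Hc := smooth_Ccont 0 d (fun t _ h => psi t h) h (Rle_refl 0) Hpsi Hh).
    assert (E := increment_CInt omega (fun t => Y t h - P h t)%C (fun t => psi t h) (h ^ k)%C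
                   (Rlt_le _ _ Hw) (Ccont_minus _ _ A1 B1) Hc B3).
    cbv beta in E; rewrite B2 in E.
    (* Since [Z = h Y], the displacement has one factor [h] more than the increment of [Y], hence
       [S k]. *)
    rewrite Cpow_S, <- Cmult_assoc, <- E; ring.
Qed.

(** The leading coefficient is the integral of [b E ^ (m + 1)], where [E = Y t 0] is a positive
    exponential; it inherits the sign of [b]. *)
Lemma zero_factor omega m a b :
  0 < omega -> coefficient omega a -> coefficient omega b ->
  (forall t, b t <= 0) -> (exists t, b t < 0) ->
  exists g0 : R, g0 < 0 /\
    local_factor omega (field m a b) (fun _ => 0%C) (S m) (RtoC g0).
Proof.
  intros Hw Ha Hb Hneg [t0 Ht0]; assert (Hw0 := Rlt_le _ _ Hw).
  destruct (solution_family omega m a b (fun _ => 0%C) Hw Ha Hb (strong_zero omega m a b))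
    as (d & Y & Hd & H1 & H2).
  assert (C0 : Cmod 0 <= d) by (rewrite Cmod_0; lra).
  (* [pow 0 m] is [1] for [m = 0] and [0] otherwise: the equation has a linear term at the zero
     solution only for [n = 3]. One formula covers both cases. *)
  set (kap := fun t => pow 0 m * b t).
  assert (HY0 : forall t, interval omega t -> Y t 0%C = RtoC (exp (RInt kap 0 t))).
  { destruct (H1 0%C C0) as (A1 & A2 & A3 & _).
    apply (linear_real_explicit omega kap (fun t => Y t 0%C)); try assumption.
    - intros t; apply (continuous_mult (K := R_AbsRing) (fun _ => 0 ^ m));
        [apply continuous_const | apply Hb].
    - intros t Ht; apply (CD_eq _ _ (dfield m a b (fun _ => 0%C) t (Y t 0%C) 0)); [|apply A3, Ht].
      rewrite dfield_h0; unfold linearized, kap; rewrite RtoC_mult, RtoC_pow, !Cpow_S.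
      destruct m as [|m]; [change (INR 1) with 1; simpl; ring | rewrite !Cpow_S; ring]. }
  set (E := fun t => exp (RInt kap 0 t)).
  assert (HEc : forall t, continuous E t).
  { intros t; apply (continuous_comp (fun t => RInt kap 0 t) exp); [|apply continuous_exp].
    apply (ex_derive_continuous (V := R_NormedModule)); eexists.
    apply is_derive_RInt_cont; intros s.
    apply (continuous_mult (K := R_AbsRing) (fun _ => 0 ^ m));
        [apply continuous_const | apply Hb]. }
  exists (RInt (fun t => b t * E t ^ S m) 0 omega); split.
  - apply (RInt_neg omega _ (clamp omega t0)); [exact Hw| | |apply clamp_interval, Hw0|].
    + intros t; apply (continuous_mult (K := R_AbsRing)); [apply Hb|].
      generalize (S m); intros k; induction k as [|k IH]; [apply continuous_const|].
      apply (continuous_mult (K := R_AbsRing) E (fun t => E t ^ k)); [apply HEc | exact IH].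
    + intros t _; assert (P : 0 < E t ^ S m) by (apply pow_lt, exp_pos).
      specialize (Hneg t); nra.
    + rewrite (proj2 Hb); assert (P : 0 < E (clamp omega t0) ^ S m) by (apply pow_lt, exp_pos).
      nra.
  - apply (local_factor_of_integrand omega m a b m _ Y d
      (fun t h => h ^ 2 * Y t h ^ S (S (S m)) + RtoC (a t) * (h * Y t h ^ S (S m))
                  + RtoC (b t) * Y t h ^ S m)%C (fun _ _ => 0%C)); try assumption.
    + assert (P : forall k, smooth 0 d (fun t _ h => Y t h ^ k)%C).
      { intros k; apply (smooth_pow 0 d (fun t _ h => Y t h)); [lra|lra|apply H2]. }
      assert (Hh := smooth_h 0 d (Rlt_le _ _ (proj1 Hd))).
      apply (smooth_poly omega a b 0 d (fun t _ h => h ^ 2 * Y t h ^ S (S (S m)))%C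
        (fun t _ h => h * Y t h ^ S (S m))%C (fun t _ h => Y t h ^ S m)%C); try assumption; try lra.
      * apply (smooth_mult 0 d (fun _ _ h => h ^ 2)%C (fun t _ h => Y t h ^ S (S (S m)))%C);
          try lra; [|apply P].
        apply (smooth_pow 0 d (fun _ _ h => h)); try lra; exact Hh.
      * apply (smooth_mult 0 d (fun _ _ h => h) (fun t _ h => Y t h ^ S (S m))%C);
          try lra; [exact Hh | apply P].
      * apply P.
    + intros h Hh; split; [apply Ccont_const|]; split; [reflexivity|].
      intros t Ht; rewrite <- zero_family_eq.
      match goal with |- CD _ _ ?l => apply (CD_eq _ _ (l - 0)%C); [ring|] end.
      apply CD_minus; [apply H1; assumption | apply CD_const].
    + rewrite <- CInt_RtoC; apply CInt_ext; [exact Hw0|].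
      intros t Ht; rewrite (HY0 t Ht), RtoC_mult, RtoC_pow; fold (E t); simpl (0 ^ 2)%C; ring.
Qed.

(** With [b = 0] the equation is [Y' = h ^ (m + 1) Y ^ (m + 2) (h Y + a)] and [Y = 1] at [h = 0], so
    the leading integral is that of [a]. If it vanishes, the next order is reached by removing the
    [a] term through a correction with equal ends. *)
Lemma zero_factor_b0 omega m a b :
  0 < omega -> coefficient omega a -> coefficient omega b -> (forall t, b t = 0) ->
  local_factor omega (field m a b) (fun _ => 0%C) (S (S m)) (RtoC (RInt a 0 omega)) /\
  (RInt a 0 omega = 0 ->
   local_factor omega (field m a b) (fun _ => 0%C) (S (S (S m))) (RtoC omega)).
Proof.
  intros Hw Ha Hb Hb0; assert (Hw0 := Rlt_le _ _ Hw).
  destruct (solution_family omega m a b (fun _ => 0%C) Hw Ha Hb (strong_zero omega m a b))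
    as (d & Y & Hd & H1 & H2).
  assert (C0 : Cmod 0 <= d) by (rewrite Cmod_0; lra).
  assert (HY0 : forall t, interval omega t -> Y t 0%C = 1%C).
  { destruct (H1 0%C C0) as (A1 & A2 & A3 & _); intros t Ht.
    rewrite <- A2; apply (constant_of_CD_zero omega (fun t => Y t 0%C)); [exact A1 | | exact Ht].
    intros s Hs; specialize (A3 s Hs); rewrite zero_family_eq, Hb0 in A3.
    revert A3; apply CD_eq; rewrite !Cpow_S; ring. }
  assert (HYeq : forall h t, Cmod h <= d -> 0 < t < omega ->
    CD (fun s => Y s h) t (h ^ S m * (Y t h ^ S (S m) * (h * Y t h + RtoC (a t))))%C).
  { intros h t Hh Ht; destruct (H1 h Hh) as (_ & _ & A3 & _); specialize (A3 t Ht).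
    rewrite zero_family_eq, Hb0 in A3; revert A3; apply CD_eq; rewrite !Cpow_S; simpl (h ^ 0)%C;
      ring. }
  assert (P : forall k, smooth 0 d (fun t _ h => Y t h ^ k)%C).
  { intros k; apply (smooth_pow 0 d (fun t _ h => Y t h)); [lra|lra|apply H2]. }
  assert (Hh := smooth_h 0 d (Rlt_le _ _ (proj1 Hd))).
  assert (Hlin : smooth 0 d (fun t _ h => h * Y t h + RtoC (a t))%C).
  { apply (smooth_plus 0 d (fun t _ h => h * Y t h)%C (fun t _ _ => RtoC (a t))).
    - apply (smooth_mult 0 d (fun _ _ h => h) (fun t _ h => Y t h)); try lra; [exact Hh | apply H2].
    - apply (smooth_coefficient omega); assumption. }
  split.
  - apply (local_factor_of_integrand omega m a b (S m) _ Y d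
      (fun t h => Y t h ^ S (S m) * (h * Y t h + RtoC (a t)))%C (fun _ _ => 0%C)); try assumption.
    + apply (smooth_mult 0 d (fun t _ h => Y t h ^ S (S m))%C
        (fun t _ h => h * Y t h + RtoC (a t))%C); try lra; [apply P | exact Hlin].
    + intros h Hh'; split; [apply Ccont_const|]; split; [reflexivity|].
      intros t Ht.
      match goal with |- CD _ _ ?l => apply (CD_eq _ _ (l - 0)%C); [ring|] end.
      apply CD_minus; [apply HYeq; assumption | apply CD_const].
    + rewrite <- CInt_RtoC; apply CInt_ext; [exact Hw0|].
      intros t Ht; rewrite (HY0 t Ht), Cpow_1_l; ring.
  - intros HA.
    set (A := fun t => RInt a 0 t).
    assert (HAd : forall t, is_derive A t (a t)) by (intros t; apply is_derive_RInt_cont, Ha).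
    assert (HAc : forall t, continuous A t).
    { intros t; apply (ex_derive_continuous (V := R_NormedModule)); eexists; apply HAd. }
    assert (HA' : coefficient omega (fun t => A (clamp omega t))).
    { split; [intros t; apply continuous_comp_clamp, HAc|].
      intros t; rewrite clamp_idem by exact Hw0; reflexivity. }
    (* Integrating [a Y ^ (m + 2)] by parts against [A] gains the missing power of [h]. *)
    apply (local_factor_of_integrand omega m a b (S (S m)) _ Y d
      (fun t h => Y t h ^ S (S (S m))
         + RtoC (A (clamp omega t)) * (- RtoC (INR (S (S m))) * h ^ m * Y t h ^ S m * Y t h ^ S
           (S m)
             * (h * Y t h + RtoC (a t))) + RtoC 0 * 0)%C
      (fun h t => h ^ S m * RtoC (A (clamp omega t)) * Y t h ^ S (S m))%C); try assumption.
    (* The summand [RtoC 0 * 0] gives the integrand the three-term shape of [smooth_poly]. *)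
    + apply (smooth_poly omega (fun t => A (clamp omega t)) (fun _ => 0) 0 d
        (fun t _ h => Y t h ^ S (S (S m)))%C
        (fun t _ h => - RtoC (INR (S (S m))) * h ^ m * Y t h ^ S m * Y t h ^ S (S m)
             * (h * Y t h + RtoC (a t)))%C (fun _ _ _ => 0%C)); try assumption; try lra.
      * split; [intros; apply continuous_const | reflexivity].
      * apply P.
      * apply (smooth_mult 0 d (fun t _ h => - RtoC (INR (S
        (S m))) * h ^ m * Y t h ^ S m * Y t h ^ S (S m))%C
          (fun t _ h => h * Y t h + RtoC (a t))%C); try lra; [|exact Hlin].
        apply (smooth_mult 0 d (fun t _ h => - RtoC (INR (S (S m))) * h ^ m * Y t h ^ S m)%C
          (fun t _ h => Y t h ^ S (S m))%C); try lra; [|apply P].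
        apply (smooth_mult 0 d (fun t _ h => - RtoC (INR (S (S m))) * h ^ m)%C
          (fun t _ h => Y t h ^ S m)%C); try lra; [|apply P].
        apply (smooth_mult 0 d (fun _ _ _ => - RtoC (INR (S (S m))))%C (fun _ _ h => h ^ m)%C);
          try lra; [apply smooth_const|].
        apply (smooth_pow 0 d (fun _ _ h => h)); try lra; exact Hh.
      * apply smooth_const.
    + intros h Hh'; destruct (H1 h Hh') as (A1 & _).
      split; [|split].
      * apply Ccont_mult; [|apply Ccont_pow, A1].
        apply Ccont_mult; [apply Ccont_const | apply Ccont_RtoC, HA'].
      (* The correction vanishes at both ends, because [A] does; this is where the zero integral of
         [a] enters. *)
      * rewrite !clamp_id by (unfold interval; lra); unfold A at 1; rewrite HA.
        unfold A; rewrite RInt_point; change (@zero _) with 0; ring.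
      * intros t Ht.
        assert (Hi : interval omega t) by (unfold interval; lra).
        rewrite (clamp_id omega t Hi).
        apply (CD_ext_loc (fun s => Y s h - h ^ S m * RtoC (A s) * Y s h ^ S (S m))%C).
        { generalize (clamp_locally omega t Ht); apply filter_imp; intros s ->; reflexivity. }
        assert (D := HYeq h t Hh' Ht).
        set (Y' := (h ^ S m * (Y t h ^ S (S m) * (h * Y t h + RtoC (a t))))%C) in *.
        apply (CD_eq _ _ (Y' - ((h ^ S m * RtoC (a t)) * Y t h ^ S (S m)
          + h ^ S m * RtoC (A t) * (RtoC (INR (S (S m))) * Y t h ^ (S (S m) - 1) * Y')))%C).
        { replace (S (S m) - 1)%nat with (S m) by lia; unfold Y'; rewrite !Cpow_S; ring. }
        apply CD_minus; [exact D|].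
        apply (CD_mult (fun s => h ^ S m * RtoC (A s))%C (fun s => Y s h ^ S (S m))%C).
        -- apply CD_scal, CD_RtoC, HAd.
        -- apply (CD_pow (fun s => Y s h)), D.
    (* A primitive of the integrand at [h = 0]. The term in [A a], present only for [m = 0], is the
       derivative of [A ^ 2 / 2] and integrates to [0], leaving [omega]. *)
    + set (I := fun t => t - INR (S (S m)) * 0 ^ m * (A t ^ 2 / 2)).
      assert (HI : forall t, is_derive I t (1 - INR (S (S m)) * 0 ^ m * (A t * a t))).
      { intros t; apply (is_derive_minus (V := R_NormedModule) (fun t => t)
          (fun t => INR (S (S m)) * 0 ^ m * (A t ^ 2 / 2))); [exact (is_derive_id
            (K := R_AbsRing) t)|].
        apply is_derive_scal.
        apply (is_derive_ext (fun t => / 2 * A t ^ 2)); [intros; simpl; field|].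
        evar_last; [apply is_derive_scal, is_derive_pow, HAd|].
        simpl; field. }
      transitivity (CInt (fun t => RtoC (1 - INR (S (S m)) * 0 ^ m * (A t * a t))) 0 omega).
      { apply CInt_ext; [exact Hw0|]; intros t Ht.
        rewrite (HY0 t Ht), (clamp_id omega t Ht), !Cpow_1_l.
        rewrite RtoC_minus, !RtoC_mult, RtoC_pow; ring. }
      rewrite (CInt_FTC omega (fun t => RtoC (I t))); [| | |intros t _; apply CD_RtoC,
        HI|unfold interval; lra].
      * unfold I, A; rewrite HA, RInt_point; change (@zero _) with 0.
        rewrite <- RtoC_minus; f_equal; simpl; field.
      * apply Ccont_RtoC; intros t; apply (ex_derive_continuous (V := R_NormedModule)); eexists;
        apply HI.
      * apply Ccont_RtoC; intros t.
        apply (continuous_minus (V := R_NormedModule) (fun _ => 1)); [apply continuous_const|].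
        apply (continuous_mult (K := R_AbsRing) (fun _ => INR (S (S m)) * 0 ^ m));
          [apply continuous_const|].
        apply (continuous_mult (K := R_AbsRing)); [apply HAc | apply Ha].
Qed.

(** * Nonzero periodic solutions *)

Lemma Ccont_inv (f : R -> C) :
  (forall t, f t <> RtoC 0) -> Ccont f -> Ccont (fun t => / f t)%C.
Proof.
  intros H0 H t; destruct (H t) as [H1 H2].
  assert (HN : continuous (fun s => Re (f s) ^ 2 + Im (f s) ^ 2) t).
  { apply (continuous_ext (fun s => Cmod (f s) ^ 2)); [intros s; apply Cmod2|].
    apply continuous_Cmod2, H. }
  assert (Hn : Re (f t) ^ 2 + Im (f t) ^ 2 <> 0).
  { rewrite <- Cmod2; apply pow_nonzero; intros E; apply (H0 t), Cmod_eq_0, E. }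
  assert (HI := continuous_Rinv_comp _ t HN Hn).
  split.
  - exact (continuous_mult (K := R_AbsRing) (fun s => Re (f s)) _ t H1 HI).
  - exact (continuous_mult (K := R_AbsRing) (fun s => - Im (f s)) _ t
      (continuous_opp (V := R_NormedModule) _ t H2) HI).
Qed.

(* [- z ^ (2 - n) / (n - 2)] is a primitive of [z' / z ^ (n - 1) = z + a + b / z]. *)
Definition potential (m : nat) (z : R -> C) (t : R) : C := (/ z t ^ S m)%C.

Lemma CD_potential m a b (z : R -> C) t :
  z t <> RtoC 0 -> CD z t (field m a b t (z t)) ->
  CD (potential m z) t
    (RtoC (- INR (S m)) * (z t + RtoC (a t) + RtoC (b t) * / z t))%C.
Proof.
  intros H0 HD; unfold potential.
  assert (Hp : (z t ^ S m)%C <> RtoC 0) by (apply Cpow_nz, H0).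
  assert (Hm : (z t ^ m)%C <> RtoC 0) by (apply Cpow_nz, H0).
  assert (H := CD_inv (fun s => z s ^ S m)%C t _ Hp (CD_pow z t _ (S m) HD)).
  revert H; apply CD_eq.
  unfold field; replace (S m - 1)%nat with m by lia.
  rewrite RtoC_opp, !Cpow_S; simpl (z t ^ 0)%C.
  field; split; assumption.
Qed.

Lemma Ccont_potential m z :
  (forall t, z t <> RtoC 0) -> Ccont z -> Ccont (potential m z).
Proof.
  intros H0 Hz; apply Ccont_inv; [intros t; apply Cpow_nz, H0 | apply Ccont_pow, Hz].
Qed.

Definition periodic (omega : R) (F : R -> C -> C) (z : R -> C) : Prop :=
  strong_solution omega F z /\ z 0 = z omega.

Lemma periodic_real omega m a b z :
  0 < omega -> coefficient omega a -> coefficient omega b -> (forall t, b t <= 0) ->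
  periodic omega (field m a b) z -> (forall t, z t <> RtoC 0) ->
  forall t, Im (z t) = 0.
Proof.
  intros Hw Ha Hb Hneg [Hz Hp] H0 t; assert (Hz' := Hz); destruct Hz' as (Z1 & Z2 & Z3).
  assert (HC := Ccont_potential m z H0 Z1).
  destruct (mean_value_interior (fun t => Im (potential m z t)) _ 0 omega Hw
    (fun t => proj2 (HC t))
    (fun t Ht => proj2 (CD_potential m a b z t (H0 t) (Z3 t Ht)))) as [s [Hs E]].
  apply (strong_real_propagates omega m a b z s t); try assumption.
  assert (E1 : Im (potential m z omega) = Im (potential m z 0))
    by (unfold potential; rewrite Hp; reflexivity).
  rewrite E1, Rminus_diag in E.
  assert (HN : 0 < Re (z s) ^ 2 + Im (z s) ^ 2).
  { rewrite <- Cmod2; apply pow_lt, Cmod_gt_0, H0. }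
  assert (HM : 0 < INR (S m)) by (apply lt_0_INR; lia).
  specialize (Hneg s).
  (* [Im (z + a + b / z) = Im z (1 - b / |z|^2)], and [b <= 0] makes the second factor at least [1].
     So [z] is real at the Rolle point, hence everywhere. *)
  assert (E2 : Im (RtoC (- INR (S m)) * (z s + RtoC (a s) + RtoC (b s) * / z s))
    = - INR (S m) * (Im (z s) * (1 - b s / (Re (z s) ^ 2 + Im (z s) ^ 2)))).
  { unfold Re, Im in *; simpl; simpl in HN; field; lra. }
  rewrite E2 in E; symmetry in E.
  assert (HB : 0 <= - b s / (Re (z s) ^ 2 + Im (z s) ^ 2))
    by (apply Rmult_le_pos; [lra | left; apply Rinv_0_lt_compat, HN]).
  assert (HB' : 1 - b s / (Re (z s) ^ 2 + Im (z s) ^ 2) > 0) by (unfold Rdiv in *; lra).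
  apply Rmult_integral in E; destruct E as [E|E]; [|lra].
  apply Rmult_integral in E; destruct E as [E|E]; [lra|].
  apply Rmult_integral in E; destruct E as [E|E]; [exact E | lra].
Qed.

Lemma real_eta (z : C) : Im z = 0 -> z = RtoC (Re z).
Proof. intros H; rewrite (surjective_pairing z) at 1; unfold Im in H; rewrite H; reflexivity. Qed.

Lemma constant_sign (f : R -> R) s t :
  (forall t, continuous f t) -> (forall t, f t <> 0) -> 0 < f s -> 0 < f t.
Proof.
  intros Hc H0 Hs; apply Rnot_le_lt; intros Ht.
  destruct (IVT_gen_consistent f s t 0 Hc) as [u [_ Hu]]; [|apply (H0 u), Hu].
  rewrite Rmin_right, Rmax_left by lra; lra.
Qed.

Lemma constant_sign_neg (f : R -> R) s t :
  (forall t, continuous f t) -> (forall t, f t <> 0) -> f s < 0 -> f t < 0.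
Proof.
  intros Hc H0 Hs; assert (0 < - f t); [|lra].
  apply (constant_sign (fun t => - f t) s t); [| |lra].
  - intros u; apply (continuous_opp (V := R_NormedModule)), Hc.
  - intros u E; apply (H0 u); lra.
Qed.

Lemma periodic_same_sign_unique omega m a b z w :
  0 < omega -> coefficient omega a -> coefficient omega b -> (forall t, b t <= 0) ->
  periodic omega (field m a b) z -> periodic omega (field m a b) w ->
  (forall t, Im (z t) = 0) -> (forall t, Im (w t) = 0) ->
  (forall t, 0 < Re (z t) * Re (w t)) ->
  forall t, z t = w t.
Proof.
  intros Hw Ha Hb Hneg [Hz Hzp] [Hv Hvp] Rz Rw Hs t.
  assert (Hz' := Hz); destruct Hz' as (Z1 & Z2 & Z3).
  assert (Hv' := Hv); destruct Hv' as (W1 & W2 & W3).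
  assert (Nz : forall t, z t <> RtoC 0).
  { intros u E; specialize (Hs u); rewrite E in Hs; simpl in Hs; lra. }
  assert (Nw : forall t, w t <> RtoC 0).
  { intros u E; specialize (Hs u); rewrite E in Hs; simpl in Hs; lra. }
  assert (HC := Ccont_minus _ _ (Ccont_potential m z Nz Z1) (Ccont_potential m w Nw W1)).
  destruct (mean_value_interior (fun t => Re (potential m z t - potential m w t)%C) _ 0 omega Hw
    (fun t => proj1 (HC t))
    (fun t Ht => proj1 (CD_minus _ _ _ _ _ (CD_potential m a b z t (Nz t) (Z3 t Ht))
                          (CD_potential m a b w t (Nw t) (W3 t Ht))))) as [s [Hss E]].
  assert (E1 : Re (potential m z omega - potential m w omega)
               = Re (potential m z 0 - potential m w 0))
    by (unfold potential; rewrite Hzp, Hvp; reflexivity).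
  rewrite E1, Rminus_diag in E.
  assert (HM : 0 < INR (S m)) by (apply lt_0_INR; lia).
  specialize (Hs s); specialize (Hneg s).
  assert (Nz1 : Re (z s) <> 0) by nra.
  assert (Nw1 : Re (w s) <> 0) by nra.
  rewrite (real_eta _ (Rz s)), (real_eta _ (Rw s)) in E.
  (* For real values [x] and [y] of one sign, the difference of [x + a + b / x] and [y + a + b / y]
     is [(x - y) (1 - b / (x y))], with second factor positive. The solutions therefore meet at
     [s]. *)
  assert (E2 : Re (RtoC (- INR (S m)) * (RtoC (Re (z s)) + RtoC (a s) + RtoC (b s) * / RtoC (Re
    (z s)))
     - RtoC (- INR (S m)) * (RtoC (Re (w s)) + RtoC (a s) + RtoC (b s) * / RtoC (Re (w s))))
    = - INR (S m) * ((Re (z s) - Re (w s)) * (1 + - b s / (Re (z s) * Re (w s))))).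
  { rewrite <- !RtoC_inv by assumption.
    rewrite <- ?RtoC_mult, <- ?RtoC_plus, <- ?RtoC_mult, <- ?RtoC_minus, <- ?RtoC_plus,
      <- ?RtoC_mult, <- ?RtoC_minus; unfold Re at 1; simpl.
    field; split; assumption. }
  rewrite E2 in E; symmetry in E.
  assert (HB : 0 <= - b s / (Re (z s) * Re (w s)))
    by (apply Rmult_le_pos; [lra | left; apply Rinv_0_lt_compat, Hs]).
  assert (Ezw : Re (z s) = Re (w s)).
  { apply Rmult_integral in E; destruct E as [E|E]; [|lra].
    apply Rmult_integral in E; destruct E as [E|E]; [lra|].
    apply Rmult_integral in E; destruct E as [E|E]; lra. }
  rewrite <- (Z2 t), <- (W2 t).
  apply (strong_unique omega (field m a b) z w Hw) with (s := s); try assumption.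
  - apply (smooth_field_field omega); try assumption; lra.
  - unfold interval; lra.
  - apply clamp_interval; lra.
  - rewrite (real_eta _ (Rz s)), (real_eta _ (Rw s)), Ezw; reflexivity.
Qed.

(** The derivative of the displacement at [z 0] is [u omega - 1], where [u] solves the linearised
    equation and [u 0 = 1]. Up to a constant factor, [u / x ^ (m + 2)] is the derivative of
    [potential] in the initial value; if [u omega = 1], its end values agree and Rolle applies. *)
Lemma periodic_nonzero_simple omega m a b z :
  0 < omega -> coefficient omega a -> coefficient omega b -> (forall t, b t <= 0) ->
  periodic omega (field m a b) z ->
  (forall t, Im (z t) = 0) -> (forall t, z t <> RtoC 0) ->
  multiplicity (field m a b) omega z 1.
Proof.
  intros Hw Ha Hb Hneg [Hz Hzp] Rz Nz; assert (Hw0 := Rlt_le _ _ Hw).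
  assert (Hz' := Hz); destruct Hz' as (Z1 & Z2 & Z3).
  destruct (solution_family omega m a b z Hw Ha Hb Hz) as (d & Y & Hd & H1 & H2).
  assert (C0 : Cmod 0 <= d) by (rewrite Cmod_0; lra).
  apply (multiplicity_of_factor omega _ z (fun h t => z t + h * Y t h)%C d
           (fun h => Y omega h - 1)%C); try assumption; try lra.
  - apply (smooth_field_field omega); assumption.
  - apply quad_diff_minus_const.
    apply (quad_diff_eval d (fun t _ h => Y t h) omega), H2.
  - destruct (H1 0%C C0) as (A1 & A2 & A3 & _).
    intros E.
    set (x := fun t => Re (z t)); set (u := fun t => Re (Y t 0%C)).
    assert (Hx : forall t, z t = RtoC (x t)) by (intros t; apply real_eta, Rz).
    assert (Nx : forall t, x t <> 0).
    { intros t H; apply (Nz t); rewrite Hx, H; reflexivity. }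
    set (rho := fun t => INR (S (S (S m))) * x t ^ S (S m) + a t * (INR (S (S m)) * x t ^ S m)
                         + b t * (INR (S m) * x t ^ m)).
    assert (Hrho : forall t, linearized m a b z t = RtoC (rho t)).
    { intros t; unfold linearized, rho; rewrite Hx.
      rewrite !RtoC_plus, !RtoC_mult, !RtoC_pow; reflexivity. }
    assert (Hu : forall t, 0 < t < omega -> is_derive u t (rho t * u t)).
    { intros t Ht; destruct (A3 t Ht) as [D _].
      rewrite dfield_h0, Hrho in D; unfold u; evar_last; [exact D|].
      unfold Re; simpl; ring. }
    assert (Hxd : forall t, 0 < t < omega ->
      is_derive x t (x t ^ S (S (S m)) + a t * x t ^ S (S m) + b t * x t ^ S m)).
    { intros t Ht; destruct (Z3 t Ht) as [D _]; unfold x at 1; evar_last; [exact D|].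
      rewrite Hx; unfold field.
      rewrite <- !RtoC_pow, <- !RtoC_mult, <- !RtoC_plus; reflexivity. }
    assert (Hxc : forall t, continuous x t) by (intros t; apply Z1).
    assert (Huc : forall t, continuous u t) by (intros t; apply A1).
    assert (Hpd : forall t, 0 < t < omega -> is_derive (fun t => x t ^ S (S m)) t
       (INR (S (S m)) * (x t ^ S (S (S m)) + a t * x t ^ S (S m) + b t * x t ^ S m) * x t ^ S m)).
    { intros t Ht; apply (is_derive_pow x (S (S m)) t), Hxd, Ht. }
    assert (Hpc : forall k t, continuous (fun t => x t ^ k) t).
    { intros k t; induction k as [|k IH]; [apply continuous_const|].
      apply (continuous_mult (K := R_AbsRing) x (fun t => x t ^ k)); [apply Hxc | exact IH]. }
    assert (Npow : forall t k, x t ^ k <> 0) by (intros; apply pow_nonzero, Nx).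
    assert (Hqc : forall t, continuous (fun t => u t / x t ^ S (S m)) t).
    { intros t; apply (continuous_mult (K := R_AbsRing) u); [apply Huc|].
      apply continuous_Rinv_comp; [apply Hpc | apply Npow]. }
    destruct (mean_value_interior (fun t => u t / x t ^ S (S m)) _ 0 omega Hw Hqc
      (fun t Ht => is_derive_div u (fun t => x t ^ S (S m)) t _ _
                   (Hu t Ht) (Hpd t Ht) (Npow t _))) as [s [Hs Es]].
    assert (Eu0 : u 0 = 1) by (unfold u; rewrite A2; reflexivity).
    assert (Euw : u omega = 1).
    { unfold u; replace (Y omega 0%C) with (Y omega 0%C - 1 + 1)%C by ring.
      rewrite E; unfold Re; simpl; ring. }
    assert (Ex : x omega = x 0) by (unfold x; rewrite Hzp; reflexivity).
    rewrite Eu0, Euw, Ex, Rminus_diag in Es; symmetry in Es.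
    (* The derivative of the quotient is [u (x ^ 2 - b) / x ^ 2]: the [a] terms cancel and
       [x ^ 2 - b > 0]. Hence [u s = 0], which propagates to [u 0 = 1], a contradiction. *)
    assert (Eq : (rho s * u s * x s ^ S (S m)
      - u s * (INR (S (S m)) * (x s ^ S (S (S m)) + a s * x s ^ S
        (S m) + b s * x s ^ S m) * x s ^ S m))
      / (x s ^ S (S m)) ^ 2 = u s * (x s ^ 2 - b s) * x s ^ m / x s ^ S (S m)).
    { unfold rho; rewrite !S_INR; simpl; field; split; [exact (Npow s m) | apply Nx]. }
    apply Rmult_integral in Es; destruct Es as [Es|Es]; [|lra].
    assert (Es' : u s * (x s ^ 2 - b s) * x s ^ m / x s ^ S (S m) = 0)
      by (rewrite <- Eq; exact Es).
    assert (Us : u s = 0).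
    { assert (0 < x s ^ 2 - b s).
      { specialize (Hneg s); specialize (Nx s); assert (0 < x s ^ 2) by (apply pow2_gt_0, Nx);
        lra. }
      apply Rmult_integral in Es'; destruct Es' as [Es'|Es'];
        [|exfalso; revert Es'; apply Rinv_neq_0_compat, Npow].
      apply Rmult_integral in Es'; destruct Es' as [Es'|Es']; [|exfalso; exact (Npow s m Es')].
      apply Rmult_integral in Es'; destruct Es' as [Es'|Es']; lra. }
    assert (HL := Ccont_linearized omega m a b z Ha Hb Z1).
    destruct (Ccont_bounded_clamp omega _ Hw0 HL) as [L [HL0 HLb]].
    assert (Z : RtoC (u 0) = 0%C).
    { apply (zero_propagates omega (fun t => RtoC (u t)) (fun t => RtoC (rho t * u t)) L) with
      (s := s).
      - apply Ccont_RtoC, Huc.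
      - intros t Ht; apply CD_RtoC, Hu, Ht.
      - intros t Ht; rewrite !Cmod_R, Rabs_mult.
        apply Rmult_le_compat_r; [apply Rabs_pos|].
        specialize (HLb t); rewrite clamp_id, Hrho, Cmod_R in HLb by (unfold interval; lra).
        exact HLb.
      - unfold interval; lra.
      - unfold interval; lra.
      - rewrite Us; reflexivity. }
    rewrite Eu0 in Z; apply RtoC_inj in Z; lra.
  - intros h Hh; destruct (H1 h Hh) as (A1 & A2 & A3 & A4).
    split; [exact A4|]; split; [rewrite A2; ring|].
    rewrite A2, Hzp, Cpow_1_r; ring.
Qed.

(** For [b = 0] the derivative of [potential] is [- (m + 1) (z + a)]; the mean value theorem over
    the period forces the sign of [z] to be opposite to that of the integral of [a]. *)
Lemma periodic_sign_b0 omega m a b z :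
  0 < omega -> coefficient omega a -> (forall t, b t = 0) ->
  periodic omega (field m a b) z ->
  (forall t, Im (z t) = 0) -> (forall t, z t <> RtoC 0) ->
  exists s, RInt a 0 omega = - omega * Re (z s).
Proof.
  intros Hw Ha Hb0 [Hz Hzp] Rz Nz; destruct Hz as (Z1 & Z2 & Z3).
  assert (HC := Ccont_potential m z Nz Z1).
  assert (HM : 0 < INR (S m)) by (apply lt_0_INR; lia).
  assert (HAd : forall t, is_derive (fun t => INR (S m) * RInt a 0 t) t (INR (S m) * a t)).
  { intros t; apply is_derive_scal, is_derive_RInt_cont, Ha. }
  assert (Hc : forall t, continuous
    (fun t => plus (Re (potential m z t)) (INR (S m) * RInt a 0 t)) t).
  { intros t; apply (continuous_plus (V := R_NormedModule)); [apply HC|].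
    apply (ex_derive_continuous (V := R_NormedModule)); eexists; apply HAd. }
  destruct (mean_value_interior
    (fun t => plus (Re (potential m z t)) (INR (S m) * RInt a 0 t)) _ 0 omega Hw Hc
    (fun t Ht => is_derive_plus (V := R_NormedModule) _ _ _ _ _
      (proj1 (CD_potential m a b z t (Nz t) (Z3 t Ht))) (HAd t))) as [s [Hs E]].
  exists s.
  assert (Nx : Re (z s) <> 0).
  { intros H; apply (Nz s); rewrite (real_eta _ (Rz s)), H; reflexivity. }
  rewrite Hb0, (real_eta _ (Rz s)) in E.
  assert (E1 : potential m z omega = potential m z 0) by (unfold potential; rewrite Hzp;
    reflexivity).
  rewrite E1, RInt_point in E.
  assert (E2 : Re (RtoC (- INR (S m)) * (RtoC (Re (z s)) + RtoC (a s) + RtoC 0 * / RtoC (Re (z s))))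
    = - INR (S m) * (Re (z s) + a s)).
  { replace (RtoC 0 * / RtoC (Re (z s)))%C with (RtoC 0) by ring.
    rewrite <- !RtoC_plus, <- RtoC_mult; unfold Re at 1; simpl; ring. }
  rewrite E2 in E; unfold plus in E; simpl in E; change (@zero _) with 0 in E.
  assert (E3 : INR (S m) * (RInt a 0 omega + omega * Re (z s)) = 0) by (simpl INR;
    simpl INR in E; lra).
  apply Rmult_integral in E3; destruct E3; lra.
Qed.

(** * Existence of nonzero periodic solutions *)

Lemma clamp_rev omega t : clamp omega (omega - t) = omega - clamp omega t \/ omega < 0.
Proof.
  unfold clamp, Rmax, Rmin.
  destruct (Rle_dec (omega - t) omega); destruct (Rle_dec t omega);
    repeat destruct (Rle_dec 0 _); lra.
Qed.

Lemma clamp_rev_pos omega t : 0 < omega -> clamp omega (omega - t) = omega - clamp omega t.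
Proof. intros H; destruct (clamp_rev omega t); lra. Qed.

Lemma is_derive_rev (f : R -> R) omega t l :
  is_derive f (omega - t) l -> is_derive (fun s => f (omega - s)) t (- l).
Proof.
  intros H; evar_last.
  - apply (is_derive_comp f (fun s => omega - s)); [exact H|].
    apply (is_derive_minus (V := R_NormedModule) (fun _ => omega) (fun s => s));
      [apply (is_derive_const (V := R_NormedModule)) | exact (is_derive_id (K := R_AbsRing) t)].
  - unfold scal, minus, plus, opp, zero, one; simpl; unfold mult; simpl; ring.
Qed.

Lemma CD_rev f omega t l : CD f (omega - t) l -> CD (fun s => f (omega - s)) t (- l)%C.
Proof.
  intros [H1 H2]; split.
  - exact (is_derive_rev (fun s => Re (f s)) omega t _ H1).
  - exact (is_derive_rev (fun s => Im (f s)) omega t _ H2).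
Qed.

Lemma continuous_rev (f : R -> R) omega t :
  (forall s, continuous f s) -> continuous (fun s => f (omega - s)) t.
Proof.
  intros H; apply (continuous_comp (fun s => omega - s) f); [|apply H].
  apply (continuous_minus (V := R_NormedModule) (fun _ => omega) (fun s => s));
    [apply continuous_const | apply continuous_id].
Qed.

Lemma Ccont_rev f omega : Ccont f -> Ccont (fun s => f (omega - s)).
Proof.
  intros H t; split.
  - apply (continuous_rev (fun s => Re (f s))); apply H.
  - apply (continuous_rev (fun s => Im (f s))); apply H.
Qed.

Lemma coefficient_rev omega a :
  0 < omega -> coefficient omega a -> coefficient omega (fun t => a (omega - t)).
Proof.
  intros Hw [H1 H2]; split; [intros t; apply continuous_rev, H1|].
  intros t; rewrite <- clamp_rev_pos by exact Hw; apply H2.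
Qed.

(** This function is the square of the positive part, differentiable at [0] where the positive part
    is not. *)
Lemma is_derive_mult_pos_part x :
  is_derive (fun x => x * Rmax x 0) x (2 * Rmax x 0).
Proof.
  apply is_derive_Reals; intros eps He.
  destruct (Rtotal_order x 0) as [Hx|[Hx|Hx]].
  - exists (mkposreal (- x) ltac:(lra)); intros h Hh Hh'; simpl in Hh'.
    apply Rabs_def2 in Hh'; rewrite !Rmax_right by lra.
    replace (((x + h) * 0 - x * 0) / h - 2 * 0) with 0 by (field; exact Hh).
    rewrite Rabs_R0; exact He.
  - subst x; exists (mkposreal eps He); intros h Hh Hh'; simpl in Hh'.
    rewrite (Rmax_left 0 0), Rplus_0_l by lra.
    replace ((h * Rmax h 0 - 0 * 0) / h - 2 * 0) with (Rmax h 0) by (field; exact Hh).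
    eapply Rle_lt_trans; [|exact Hh'].
    unfold Rmax; destruct (Rle_dec h 0); [rewrite Rabs_R0; apply Rabs_pos | lra].
  - exists (mkposreal (Rmin x eps) ltac:(apply Rmin_pos; lra)); intros h Hh Hh'; simpl in Hh'.
    assert (H1 := Rlt_le_trans _ _ _ Hh' (Rmin_l _ _)).
    assert (H2 := Rlt_le_trans _ _ _ Hh' (Rmin_r _ _)).
    assert (H1' := H1); apply Rabs_def2 in H1'; rewrite !Rmax_left by lra.
    replace (((x + h) * (x + h) - x * x) / h - 2 * x) with h by (field; exact Hh).
    exact H2.
Qed.

(** The square of the positive part of [u] starts at [0] and is nonincreasing. *)
Lemma barrier omega (u du : R -> R) :
  (forall t, continuous u t) -> (forall t, 0 < t < omega -> is_derive u t (du t)) ->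
  u 0 <= 0 -> (forall t, 0 < t < omega -> 0 < u t -> du t <= 0) ->
  forall t, interval omega t -> u t <= 0.
Proof.
  intros Hc Hd H0 H t [Ht0 Ht1].
  assert (HD : forall s, ex_derive (fun x => x * Rmax x 0) s)
    by (intros s; eexists; apply is_derive_mult_pos_part).
  assert (E : u t * Rmax (u t) 0 <= u 0 * Rmax (u 0) 0).
  { apply (decreasing_of_derive_nonpos (fun t => u t * Rmax (u t) 0)
      (fun t => du t * (2 * Rmax (u t) 0))); [exact Ht0 | | |].
    - intros s; apply (continuous_comp u (fun x => x * Rmax x 0)); [apply Hc|].
      apply (ex_derive_continuous (V := R_NormedModule)), HD.
    - intros s Hs; apply (is_derive_comp (fun x => x * Rmax x 0) u);
        [apply is_derive_mult_pos_part | apply Hd; lra].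
    - intros s Hs; specialize (H s ltac:(lra)).
      unfold Rmax; destruct (Rle_dec (u s) 0); [lra|].
      specialize (H ltac:(lra)); nra. }
  rewrite (Rmax_right (u 0)) in E by lra.
  apply Rnot_lt_le; intros Hp; rewrite Rmax_left in E by lra; nra.
Qed.

(** * Truncations and the field on the real axis *)

Lemma Rmax_lipschitz l x y : Rabs (Rmax l x - Rmax l y) <= Rabs (x - y).
Proof.
  unfold Rmax; destruct (Rle_dec l x), (Rle_dec l y);
    unfold Rabs; repeat destruct (Rcase_abs _); lra.
Qed.

Lemma Rmin_lipschitz x y M : Rabs (Rmin x M - Rmin y M) <= Rabs (x - y).
Proof.
  unfold Rmin; destruct (Rle_dec x M), (Rle_dec y M);
    unfold Rabs; repeat destruct (Rcase_abs _); lra.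
Qed.

Lemma continuous_Rmax_fun (f g : R -> R) t :
  continuous f t -> continuous g t -> continuous (fun s => Rmax (f s) (g s)) t.
Proof.
  intros Hf Hg.
  apply (continuous_ext (fun s => (f s + g s + Rabs (f s - g s)) * / 2)).
  - intros s; unfold Rmax, Rabs; destruct (Rle_dec _ _), (Rcase_abs _); simpl; lra.
  - apply (continuous_mult (K := R_AbsRing) (fun s => f s + g s + Rabs (f s - g s)) (fun _ => / 2));
      [|apply continuous_const].
    apply (continuous_plus (V := R_NormedModule) (fun s => f s + g s) (fun s => Rabs (f s - g s))).
    + apply (continuous_plus (V := R_NormedModule)); assumption.
    + apply (continuous_comp (fun s => f s - g s) Rabs); [|apply continuous_Rabs].
      apply (continuous_minus (V := R_NormedModule)); assumption.
Qed.

Lemma continuous_Rmin_const (f : R -> R) M t :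
  continuous f t -> continuous (fun s => Rmin (f s) M) t.
Proof.
  intros H; apply (continuous_comp f (fun x => Rmin x M)); [exact H|].
  apply continuous_of_lipschitz1; intros s; apply Rmin_lipschitz.
Qed.

Lemma Im_field_RtoC m a b t x : Im (field m a b t (RtoC x)) = 0.
Proof.
  unfold field; rewrite <- !RtoC_pow, <- !RtoC_mult, <- !RtoC_plus; reflexivity.
Qed.

Lemma Re_field_RtoC m a b t x :
  Re (field m a b t (RtoC x)) = x ^ S m * (x ^ 2 + a t * x + b t).
Proof.
  unfold field; rewrite <- !RtoC_pow, <- !RtoC_mult, <- !RtoC_plus; simpl; ring.
Qed.

(* Between a positive lower solution and a large constant, the backward Poincare map
   of the truncated equation maps an interval into itself; large solutions cannot blow
   up backward in time. *)
Theorem periodic_above_lower_solution omega m a b z0 :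
  0 < omega -> coefficient omega a -> coefficient omega b ->
  strong_solution omega (field m a b) z0 ->
  (forall t, Im (z0 t) = 0) -> (forall t, 0 < Re (z0 t)) -> Re (z0 omega) < Re (z0 0) ->
  exists z, periodic omega (field m a b) z /\
    (forall t, Im (z t) = 0) /\ (forall t, 0 < Re (z t)).
Proof.
  intros Hw Ha Hb Hz0 Rz0 Pz0 Hlt; assert (Hw0 := Rlt_le _ _ Hw).
  (* In reversed time the equation reads [x' = - field m ar br t x]; [l] is [z0] run backward and
     solves it. *)
  set (ar := fun t => a (omega - t)); set (br := fun t => b (omega - t)).
  assert (Har : coefficient omega ar) by (apply coefficient_rev; assumption).
  assert (Hbr : coefficient omega br) by (apply coefficient_rev; assumption).
  set (l := fun t => Re (z0 (omega - t))).
  assert (Hz0' := Hz0); destruct Hz0' as (Z1 & Z2 & Z3).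
  assert (Hlc : forall t, continuous l t).
  { intros t; apply (continuous_rev (fun s => Re (z0 s))); intros s; apply Z1. }
  assert (Hlcl : forall t, l (clamp omega t) = l t).
  { intros t; unfold l; rewrite <- clamp_rev_pos, Z2 by exact Hw; reflexivity. }
  assert (Hld : forall t, 0 < t < omega ->
    is_derive l t (- Re (field m ar br t (RtoC (l t))))).
  { intros t Ht; destruct (CD_rev z0 omega t _ (Z3 (omega - t) ltac:(lra))) as [D _].
    unfold l at 1; evar_last; [exact D|].
    rewrite (real_eta _ (Rz0 (omega - t))); reflexivity. }
  assert (Hlp : forall t, 0 < l t) by (intros t; apply Pz0).
  destruct (bounded_clamp omega a Hw0 (proj1 Ha)) as [A [A0 HA]].
  destruct (bounded_clamp omega b Hw0 (proj1 Hb)) as [B [B0 HB]].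
  destruct (bounded_clamp omega l Hw0 Hlc) as [Bl [Bl0 HBl]].
  (* Then [M >= 1] and [M ^ 2 >= A M + B], so the field is nonnegative at [M]; [Bl] puts [M] above
     [l]. *)
  set (M := 1 + A + B + Bl).
  assert (HlM : forall t, l t <= M).
  { intros t; specialize (HBl t); rewrite Hlcl in HBl; apply Rabs_le_between in HBl.
    unfold M; lra. }
  assert (HgM : forall t, 0 <= Re (field m ar br t (RtoC M))).
  { intros t; rewrite Re_field_RtoC.
    specialize (HA (omega - t)); specialize (HB (omega - t)).
    rewrite (proj2 Ha) in HA; rewrite (proj2 Hb) in HB; fold (ar t) in HA; fold (br t) in HB.
    apply Rabs_le_between in HA; apply Rabs_le_between in HB.
    assert (HM1 : 1 <= M) by (unfold M; lra).
    apply Rmult_le_pos; [apply pow_le; lra|].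
    assert (M * M = (1 + A + B + Bl) * M) by (unfold M; ring).
    simpl; nra. }
  (* Truncation to the strip between [l] and [M] makes the field globally Lipschitz; the two
     barriers below show that the relevant solutions never leave the strip. *)
  set (tr := fun t x => Rmax (l t) (Rmin x M)).
  assert (Htr : forall t x, 0 <= tr t x <= M).
  { intros t x; unfold tr; specialize (Hlp t); specialize (HlM t); split.
    - eapply Rle_trans; [|apply Rmax_l]; lra.
    - apply Rmax_lub; [exact HlM | apply Rmin_r]. }
  assert (HM0 : 0 <= M) by (unfold M; lra).
  set (F := fun t (y : C) => (- field m ar br t (RtoC (tr t (Re y))))%C).
  assert (HSF := smooth_field_field omega m ar br Hw0 Har Hbr).
  assert (HFc : forall x, Ccont x -> Ccont (fun t => F t (x t))).
  { intros x Hx; apply Ccont_opp.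
    apply (smooth_field_cont _ (fun t => RtoC (tr t (Re (x t)))) M HSF).
    - apply Ccont_RtoC; intros t.
      apply (continuous_Rmax_fun l (fun t => Rmin (Re (x t)) M)); [apply Hlc|].
      exact (continuous_Rmin_const (fun t => Re (x t)) M t (proj1 (Hx t))).
    - intros t; specialize (Htr t (Re (x t))); rewrite Cmod_R, Rabs_pos_eq; lra. }
  destruct (HSF M HM0) as (fy & fh & K & HK).
  assert (HL := smooth_with_lipschitz _ _ _ _ _ K HM0 Rle_0_1 HK).
  set (L := K * (1 + 2 * (M + 1))) in HL.
  assert (HL0 : 0 <= L) by (apply Rmult_le_pos; [apply HK | lra]).
  assert (HFl : forall t x y, Cmod (F t x - F t y) <= L * Cmod (x - y)).
  { intros t x y; unfold F.
    match goal with |- Cmod (- ?p - - ?r) <= _ =>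
      replace (- p - - r)%C with (- (p - r))%C by ring end.
    rewrite Cmod_opp.
    assert (T1 := Htr t (Re x)); assert (T2 := Htr t (Re y)).
    assert (H := HL t (RtoC (tr t (Re y))) 0%C (RtoC (tr t (Re x))) 0%C).
    rewrite !Cmod_R, !Rabs_pos_eq in H by lra.
    replace (0 - 0)%C with (RtoC 0) in H by ring; rewrite Cmod_0, Rplus_0_r in H.
    eapply Rle_trans; [apply H; lra|].
    apply Rmult_le_compat_l; [exact HL0|].
    rewrite <- RtoC_minus, Cmod_R.
    eapply Rle_trans; [apply Rmax_lipschitz|].
    eapply Rle_trans; [apply Rmin_lipschitz|].
    exact (re_le_Cmod (x - y)). }
  assert (HX : forall d : R, exists x, Ccont x /\ (forall t, x (clamp omega t) = x t) /\
    x 0 = RtoC d /\ forall t, 0 < t < omega -> CD x t (F t (x t))).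
  { intros d; exact (picard_lipschitz omega F L (RtoC d) Hw HL0 HFc HFl). }
  set (X := fun d => proj1_sig (constructive_indefinite_description _ (HX d))).
  assert (HX' : forall d, Ccont (X d) /\ (forall t, X d (clamp omega t) = X d t) /\
    X d 0 = RtoC d /\ forall t, 0 < t < omega -> CD (X d) t (F t (X d t))).
  { intros d; exact (proj2_sig (constructive_indefinite_description _ (HX d))). }
  clearbody X; clear HX.
  assert (Hxd : forall d t, 0 < t < omega ->
    is_derive (fun t => Re (X d t)) t (- Re (field m ar br t (RtoC (tr t (Re (X d t))))))).
  { intros d t Ht; destruct (HX' d) as (_ & _ & _ & D); destruct (D t Ht) as [D1 _].
    exact D1. }
  assert (Hup : forall d, d <= M -> forall t, interval omega t -> Re (X d t) <= M).
  { intros d Hd t Ht; destruct (HX' d) as (X1 & _ & X3 & _).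
    assert (H : Re (X d t) - M <= 0); [|lra].
    apply (barrier omega (fun t => Re (X d t) - M)
      (fun t => - Re (field m ar br t (RtoC (tr t (Re (X d t)))))) ); [| | | |exact Ht].
    - intros s; apply (continuous_minus (V := R_NormedModule) (fun s => Re (X d s)) (fun _ => M));
        [apply X1 | apply continuous_const].
    - intros s Hs; evar_last;
        [apply (is_derive_minus (V := R_NormedModule) (fun s => Re (X d s)) (fun _ => M));
          [apply Hxd, Hs | apply (is_derive_const (V := R_NormedModule))]|].
      unfold minus, plus, opp, zero; simpl; ring.
    - rewrite X3; simpl; lra.
    (* Above [M] the truncated field is the field at [M], so in reversed time the solution cannot
       grow. *)
    - intros s _ Hs; unfold tr; rewrite (Rmin_right (Re (X d s))) by lra.
      rewrite Rmax_right by apply HlM; specialize (HgM s); lra. }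
  assert (Hlow : forall d, l 0 <= d -> forall t, interval omega t -> l t <= Re (X d t)).
  { intros d Hd t Ht; destruct (HX' d) as (X1 & _ & X3 & _).
    assert (H : l t - Re (X d t) <= 0); [|lra].
    apply (barrier omega (fun t => l t - Re (X d t))
      (fun t => - Re (field m ar br t (RtoC (l t)))
                - - Re (field m ar br t (RtoC (tr t (Re (X d t)))))) ); [| | | |exact Ht].
    - intros s; apply (continuous_minus (V := R_NormedModule) l (fun s => Re (X d s)));
        [apply Hlc | apply X1].
    - intros s Hs; apply (is_derive_minus (V := R_NormedModule) l (fun s => Re (X d s)));
        [apply Hld, Hs | apply Hxd, Hs].
    - rewrite X3; simpl; lra.
    (* Below [l] the truncation replaces the solution by [l], so the two derivatives agree and the
       gap cannot open. *)
    - intros s _ Hs; unfold tr; rewrite Rmax_left; [lra|].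
      eapply Rle_trans; [apply Rmin_l | lra]. }
  assert (I0 : interval omega 0) by (unfold interval; lra).
  assert (I1 : interval omega omega) by (unfold interval; lra).
  (* Gronwall gives [E] for the squared distance; as [E >= 1], [E] itself serves as a Lipschitz
     constant. *)
  set (E := exp ((2 * L + 1) * omega)).
  assert (HE : 1 <= E).
  { unfold E; assert (h := exp_ineq1_le ((2 * L + 1) * omega)); nra. }
  assert (HP : forall d d', Rabs (Re (X d omega) - Re (X d' omega)) <= E * Rabs (d - d')).
  { intros d d'; destruct (HX' d) as (X1 & _ & X3 & X4); destruct (HX' d') as (Y1 & _ & Y3 & Y4).
    eapply Rle_trans; [exact (re_le_Cmod (X d omega - X d' omega))|].
    assert (H := gronwall omega (fun t => X d t - X d' t)%C
      (fun t => F t (X d t) - F t (X d' t))%C L 0 HL0 (Ccont_minus _ _ X1 Y1)).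
    specialize (H (fun t Ht => CD_minus _ _ _ _ _ (X4 t Ht) (Y4 t Ht))).
    assert (H' := H ltac:(intros; rewrite Rplus_0_r; apply HFl) omega I1); clear H.
    cbv beta in H'; rewrite X3, Y3, <- RtoC_minus, Cmod_R in H'; fold E in H'.
    apply Rsqr_incr_0_var; [|apply Rmult_le_pos; [lra | apply Rabs_pos]].
    rewrite !Rsqr_pow2, Rpow_mult_distr.
    eapply Rle_trans; [exact H'|].
    replace (E * (Rabs (d - d') ^ 2 + 0 ^ 2 * omega)) with (E * Rabs (d - d') ^ 2) by ring.
    apply Rmult_le_compat_r; [apply pow2_ge_0 | nra]. }
  assert (HPc : forall d, continuous (fun d => Re (X d omega) - d) d).
  { intros d; apply (continuous_minus (V := R_NormedModule) (fun d => Re (X d omega)) (fun d => d));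
      [|apply continuous_id].
    apply continuous_eps; intros eps.
    assert (Hp : 0 < eps / E) by (apply Rdiv_lt_0_compat; [apply eps | lra]).
    exists (mkposreal _ Hp); intros s Hs; simpl in Hs.
    eapply Rle_lt_trans; [apply HP|].
    apply (Rmult_lt_compat_l E) in Hs; [|lra].
    replace (E * (eps / E)) with (pos eps) in Hs by (field; lra); exact Hs. }
  assert (Hl0 : l 0 = Re (z0 omega)) by (unfold l; rewrite Rminus_0_r; reflexivity).
  assert (Hlw : l omega = Re (z0 0)) by (unfold l; rewrite Rminus_diag; reflexivity).
  assert (P1 := Hlow (l 0) (Rle_refl _) omega I1).
  assert (P2 := Hup M (Rle_refl _) omega I1).
  assert (HlM0 := HlM 0).
  (* At [d = l 0] the solution ends at or above [l omega = Re (z0 0) > Re (z0 omega) = l 0]; at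
     [d = M] it ends at or below [M]. *)
  destruct (IVT_gen_consistent (fun d => Re (X d omega) - d) (l 0) M 0 HPc) as [d [Hd Ed]].
  { rewrite Rmin_right, Rmax_left by lra; lra. }
  rewrite Rmin_left, Rmax_right in Hd by lra.
  destruct (HX' d) as (X1 & X2 & X3 & X4).
  set (x := fun t => Re (X d t)).
  assert (Hx : forall t, l t <= x t <= M).
  { intros t; unfold x; rewrite <- (X2 t), <- (Hlcl t).
    assert (Hi := clamp_interval omega t Hw0).
    split; [apply Hlow | apply Hup]; try exact Hi; lra. }
  exists (fun t => RtoC (x (omega - t))).
  split; [|split; [reflexivity|]].
  - split; [split; [|split]|].
    + apply Ccont_RtoC; intros t; apply (continuous_rev x); intros s; apply X1.
    + intros t; unfold x; rewrite <- clamp_rev_pos, X2 by exact Hw; reflexivity.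
    + intros t Ht; apply (CD_eq _ _ (RtoC (- - Re (field m ar br (omega - t) (RtoC (x
      (omega - t))))))).
      * rewrite Ropp_involutive, <- (real_eta _ (Im_field_RtoC m ar br _ _)).
        unfold field, ar, br; replace (omega - (omega - t)) with t by ring; reflexivity.
      * apply CD_RtoC, (is_derive_rev x).
        assert (D := Hxd d (omega - t) ltac:(lra)); fold x in D.
        assert (T := Hx (omega - t)).
        fold (x (omega - t)) in D.
        unfold tr in D; rewrite (Rmin_left (x (omega - t))), Rmax_right in D by lra.
        exact D.
    + rewrite Rminus_0_r, Rminus_diag; f_equal; unfold x; rewrite X3; simpl; lra.
  - intros t; simpl; specialize (Hx (omega - t)); specialize (Hlp (omega - t)); lra.
Qed.

Lemma positive_periodic omega m a b k (g0 : R) :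
  0 < omega -> coefficient omega a -> coefficient omega b -> g0 < 0 ->
  local_factor omega (field m a b) (fun _ => 0%C) k (RtoC g0) ->
  exists z, periodic omega (field m a b) z /\
    (forall t, Im (z t) = 0) /\ (forall t, 0 < Re (z t)).
Proof.
  intros Hw Ha Hb Hg (d & G & Z & Hd & (G' & K & HK & HG) & HG0 & HZ).
  (* For [0 < h <= 1] within the disc, [|G h - g0| <= c h]; the bound [h <= - g0 / (2 c)] then keeps
     [Re (G h)] at most [g0 / 2 < 0]. *)
  set (c := Cmod (G' 0%C) + K + 1).
  assert (Hc : 1 <= c) by (unfold c; assert (P := Cmod_ge_0 (G' 0%C)); lra).
  set (h := Rmin (Rmin d 1) (- g0 / (2 * c))).
  assert (Hp : 0 < - g0 / (2 * c)) by (apply Rdiv_lt_0_compat; lra).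
  assert (Hh : 0 < h) by (apply Rmin_pos; [apply Rmin_pos; lra | exact Hp]).
  assert (Hh1 : h <= d) by (unfold h; eapply Rle_trans; [apply Rmin_l | apply Rmin_l]).
  assert (Hh2 : h <= 1) by (unfold h; eapply Rle_trans; [apply Rmin_l | apply Rmin_r]).
  assert (Hh3 : h <= - g0 / (2 * c)) by apply Rmin_r.
  assert (Ch : Cmod (RtoC h) = h) by (rewrite Cmod_R; apply Rabs_pos_eq; lra).
  assert (Hneg : Re (G (RtoC h)) < 0).
  { assert (H := HG 0%C (RtoC h)); rewrite Cmod_0, HG0 in H.
    replace (RtoC h - 0)%C with (RtoC h) in H by ring; rewrite Ch in H.
    specialize (H ltac:(lra) Hh1).
    set (e := (G h - g0 - G' 0%C * h)%C) in H.
    assert (E : G (RtoC h) = (e + G' 0%C * RtoC h + RtoC g0)%C) by (unfold e; ring).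
    assert (B1 : Cmod (e + G' 0%C * RtoC h) <= K * h ^ 2 + Cmod (G' 0%C) * h).
    { eapply Rle_trans; [apply Cmod_triangle|]; rewrite Cmod_mult, Ch; lra. }
    assert (B2 := Rle_trans _ _ _ (Rle_abs _) (re_le_Cmod (e + G' 0%C * RtoC h))).
    assert (h ^ 2 <= h) by nra.
    assert (K * h ^ 2 <= K * h) by (apply Rmult_le_compat_l; assumption).
    assert (B3 : K * h ^ 2 + Cmod (G' 0%C) * h <= c * h) by (unfold c; lra).
    apply (Rmult_le_compat_l c) in Hh3; [|lra].
    replace (c * (- g0 / (2 * c))) with (- g0 / 2) in Hh3 by (field; lra).
    rewrite E; change (Re (e + G' 0%C * RtoC h) + g0 < 0); lra. }
  destruct (HZ (RtoC h)) as (A1 & A2 & A3); [rewrite Ch; exact Hh1|].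
  rewrite Cplus_0_l in A2.
  assert (Rz : forall t, Im (Z h t) = 0).
  { intros t; apply (strong_real_propagates omega m a b (Z h) 0 t); try assumption.
    rewrite A2; reflexivity. }
  assert (Nz : forall t, Re (Z h t) <> 0).
  { intros t E; assert (E' : Z h 0 = 0%C).
    { apply (strong_zero_propagates omega m a b (Z h) t 0); try assumption.
      rewrite (real_eta _ (Rz t)), E; reflexivity. }
    rewrite A2 in E'; apply RtoC_inj in E'; lra. }
  apply (periodic_above_lower_solution omega m a b (Z h)); try assumption.
  - intros t; apply (constant_sign (fun t => Re (Z h t)) 0 t); try assumption.
    + intros s; apply A1.
    + rewrite A2; exact Hh.
  - assert (E : Re (Z h omega) - Re (Z h 0) = h ^ k * Re (G h)).
    { transitivity (Re (Z h omega - Z h 0)); [reflexivity|].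
      rewrite A3, <- RtoC_pow; unfold Re; simpl; ring. }
    assert (0 < h ^ k) by (apply pow_lt, Hh); nra.
Qed.

Lemma Cpow_opp_even (z : C) p : ((- z) ^ (2 * p) = z ^ (2 * p))%C.
Proof.
  rewrite !Cpow_mult_r; f_equal; simpl; ring.
Qed.

(* [z -> - z], combined with time reversal when [n] is even, preserves the form of the
   equation and changes the sign of [a]. *)
Lemma reflection omega m a b :
  0 < omega -> coefficient omega a -> coefficient omega b -> (forall t, b t <= 0) ->
  exists a' b', coefficient omega a' /\ coefficient omega b' /\ (forall t, b' t <= 0) /\
    ((exists t, b t < 0) -> exists t, b' t < 0) /\
    ((forall t, b t = 0) -> forall t, b' t = 0) /\
    RInt a' 0 omega = - RInt a 0 omega /\
    forall w, periodic omega (field m a' b') w ->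
      (forall t, Im (w t) = 0) -> (forall t, 0 < Re (w t)) ->
      exists z, periodic omega (field m a b) z /\
        (forall t, Im (z t) = 0) /\ (forall t, Re (z t) < 0).
Proof.
  intros Hw Ha Hb Hneg.
  assert (Hopp : forall a, coefficient omega a -> coefficient omega (fun t => - a t)).
  { intros c [C1 C2]; split; [intros t; apply (continuous_opp (V := R_NormedModule)), C1|].
    intros t; rewrite C2; reflexivity. }
  assert (Hint : forall c, coefficient omega c -> ex_RInt c 0 omega).
  { intros c [C1 _]; apply (ex_RInt_continuous (V := R_CompleteNormedModule)); intros; apply C1. }
  (* [m] and [n = m + 3] have opposite parities. As [n] and [n - 2] have the same parity, the sign
     of [b] is kept in both cases. *)
  destruct (Nat.Even_or_Odd m) as [[p Hp]|[p Hp]].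
  - exists (fun t => - a t), b.
    split; [apply Hopp, Ha|]; split; [exact Hb|]; split; [exact Hneg|].
    split; [auto|]; split; [auto|]; split.
    { apply (RInt_opp (V := R_CompleteNormedModule)), Hint, Ha. }
    intros w [(W1 & W2 & W3) Wp] Rw Pw; exists (fun t => - w t)%C.
    split; [split; [split; [|split]|]|split].
    + apply Ccont_opp, W1.
    + intros t; rewrite W2; reflexivity.
    + intros t Ht; assert (D := CD_opp _ _ _ (W3 t Ht)); revert D; apply CD_eq.
      unfold field; rewrite RtoC_opp, !Cpow_S, Hp, !Cpow_opp_even; ring.
    + rewrite Wp; reflexivity.
    + intros t; specialize (Rw t); unfold Im in *; simpl; lra.
    + intros t; specialize (Pw t); unfold Re in *; simpl; lra.
  - exists (fun t => - a (omega - t)), (fun t => b (omega - t)).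
    split; [apply (Hopp (fun t => a (omega - t))), coefficient_rev; assumption|].
    split; [apply coefficient_rev; assumption|]; split; [intros t; apply Hneg|].
    split; [intros [t Ht]; exists (omega - t); replace (omega - (omega - t)) with t by ring;
      exact Ht|].
    split; [auto|]; split.
    { assert (E := RInt_comp_lin (V := R_CompleteNormedModule) a (-1) omega 0 omega).
      replace (-1 * 0 + omega) with omega in E by ring.
      replace (-1 * omega + omega) with 0 in E by ring.
      transitivity (RInt a omega 0).
      - rewrite <- E.
        + apply RInt_ext; intros t _; unfold scal; simpl; unfold mult; simpl.
          replace (-1 * t + omega) with (omega - t) by ring; ring.
        + apply (ex_RInt_swap (V := R_NormedModule)), Hint, Ha.
      - symmetry; apply (opp_RInt_swap (V := R_CompleteNormedModule)), Hint, Ha. }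
    intros w [(W1 & W2 & W3) Wp] Rw Pw; exists (fun t => - w (omega - t)%R)%C.
    split; [split; [split; [|split]|]|split].
    + apply Ccont_opp, Ccont_rev, W1.
    + intros t; rewrite <- clamp_rev_pos, W2 by exact Hw; reflexivity.
    + intros t Ht; assert (D := CD_opp _ _ _ (CD_rev w omega t _ (W3 (omega - t) ltac:(lra)))).
      revert D; apply CD_eq.
      unfold field; replace (omega - (omega - t)) with t by ring.
      rewrite RtoC_opp, Hp, PeanoNat.Nat.add_1_r, !Cpow_S, !Cpow_opp_even; ring.
    + rewrite Rminus_0_r, Rminus_diag, Wp; reflexivity.
    + intros t; specialize (Rw (omega - t)); unfold Im in *; simpl; lra.
    + intros t; specialize (Pw (omega - t)); unfold Re in *; simpl; lra.
Qed.

(** * Counting *)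

(** A solution that vanishes once is zero; otherwise it is real by [periodic_real], and continuity
    fixes its sign. *)
Lemma periodic_trichotomy omega m a b z :
  0 < omega -> coefficient omega a -> coefficient omega b -> (forall t, b t <= 0) ->
  periodic omega (field m a b) z ->
  (forall t, z t = 0%C) \/
  (forall t, z t <> RtoC 0) /\ (forall t, Im (z t) = 0) /\
    ((forall t, 0 < Re (z t)) \/ (forall t, Re (z t) < 0)).
Proof.
  intros Hw Ha Hb Hneg Hz.
  destruct (excluded_middle_informative (z 0 = RtoC 0)) as [E|E].
  - left; intros t.
    apply (strong_zero_propagates omega m a b z 0 t); try assumption; apply Hz.
  - right.
    assert (Nz : forall t, z t <> RtoC 0).
    { intros t E'; apply E.
      apply (strong_zero_propagates omega m a b z t 0); try assumption; apply Hz. }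
    assert (Rz := periodic_real omega m a b z Hw Ha Hb Hneg Hz Nz).
    split; [exact Nz|]; split; [exact Rz|].
    assert (Nx : forall t, Re (z t) <> 0).
    { intros t H; apply (Nz t); rewrite (real_eta _ (Rz t)), H; reflexivity. }
    assert (Hc : forall t, continuous (fun t => Re (z t)) t) by (intros t; apply Hz).
    destruct (Rtotal_order 0 (Re (z 0))) as [H|[H|H]].
    + left; intros t; exact (constant_sign _ 0 t Hc Nx H).
    + exfalso; apply (Nx 0); symmetry; exact H.
    + right; intros t; exact (constant_sign_neg _ 0 t Hc Nx H).
Qed.

Lemma periodic_solution_of_periodic omega F z :
  0 < omega -> smooth_field F -> periodic omega F z -> periodic_solution F omega z.
Proof. intros Hw HF [Hz Hp]; split; [apply strong_is_solution; assumption | exact Hp]. Qed.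

Lemma periodic_of_periodic_solution omega F psi :
  0 < omega -> periodic_solution F omega psi ->
  exists z, periodic omega F z /\ same_on omega psi z.
Proof.
  intros Hw [Hs Hp]; exists (fun t => psi (clamp omega t)); split.
  - split; [apply strong_of_is_solution; assumption|].
    rewrite !clamp_id by (unfold interval; lra); exact Hp.
  - intros t Ht; rewrite clamp_id by exact Ht; reflexivity.
Qed.

Theorem exactly_periodic_field omega m a b :
  0 < omega -> coefficient omega a -> coefficient omega b -> (forall t, b t <= 0) ->
  exactly_periodic_solutions (field m a b) omega (S (S (S m))).
Proof.
  intros Hw Ha Hb Hneg; assert (Hw0 := Rlt_le _ _ Hw).
  assert (HF := smooth_field_field omega m a b Hw0 Ha Hb).
  assert (Hzero : periodic omega (field m a b) (fun _ => 0%C))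
    by (split; [apply strong_zero | reflexivity]).
  assert (I0 : interval omega 0) by (unfold interval; lra).
  assert (Hmult0 : forall k (g0 : R), g0 <> 0 ->
    local_factor omega (field m a b) (fun _ => 0%C) k (RtoC g0) ->
    multiplicity (field m a b) omega (fun _ => 0%C) k).
  { intros k g0 Hg; apply multiplicity_of_local_factor; try assumption.
    intros E; apply Hg, RtoC_inj, E. }
  assert (Hmult1 : forall z, periodic omega (field m a b) z -> (forall t, Im (z t) = 0) ->
    (forall t, Re (z t) <> 0) -> multiplicity (field m a b) omega z 1).
  { intros z Hz Rz Nx; apply periodic_nonzero_simple; try assumption.
    intros t E; apply (Nx t); rewrite E; reflexivity. }
  assert (Huniq : forall psi z w, same_on omega psi w ->
    periodic omega (field m a b) z -> periodic omega (field m a b) w ->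
    (forall t, Im (z t) = 0) -> (forall t, Im (w t) = 0) ->
    (forall t, 0 < Re (w t) * Re (z t)) -> same_on omega psi z).
  { intros psi z w Hs Hz Hv Rz Rw Hp t Ht; rewrite (Hs t Ht).
    apply (periodic_same_sign_unique omega m a b w z); assumption. }
  assert (Hsame : forall z w, Re (z 0) <> Re (w 0) -> ~ same_on omega z w).
  { intros z w Hne H; apply Hne; rewrite (H 0 I0); reflexivity. }
  assert (Hps := periodic_solution_of_periodic omega (field m a b)).
  destruct (reflection omega m a b Hw Ha Hb Hneg)
    as (a' & b' & Ha' & Hb' & Hneg' & Hlt' & Hz' & Hi' & Hrefl).
  destruct (excluded_middle_informative (exists t, b t < 0)) as [Hlt|Hnlt].
  - destruct (zero_factor omega m a b Hw Ha Hb Hneg Hlt) as (g0 & Hg0 & Hf).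
    destruct (positive_periodic omega m a b (S m) g0 Hw Ha Hb Hg0 Hf) as (zp & Pp & Rp & Sp).
    (* The negative solution is the reflection of a positive one for the coefficients [a'] and
       [b']. *)
    destruct (zero_factor omega m a' b' Hw Ha' Hb' Hneg' (Hlt' Hlt)) as (g1 & Hg1 & Hf1).
    destruct (positive_periodic omega m a' b' (S m) g1 Hw Ha' Hb' Hg1 Hf1) as (w & Pw & Rw & Sw).
    destruct (Hrefl w Pw Rw Sw) as (zn & Pn & Rn & Sn).
    exists (((fun _ => RtoC 0), S m) :: (zp, 1%nat) :: (zn, 1%nat) :: nil).
    split; [|split; [|split]].
    + repeat apply Forall_cons; simpl; try apply Forall_nil; (split; [apply Hps; assumption|]).
      * apply (Hmult0 _ g0); [lra | exact Hf].
      * apply Hmult1; try assumption; intros t; specialize (Sp t); lra.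
      * apply Hmult1; try assumption; intros t; specialize (Sn t); lra.
    + specialize (Sp 0); specialize (Sn 0).
      repeat (apply FOP_cons; [repeat apply Forall_cons; try apply Forall_nil; apply Hsame;
        simpl; lra|]).
      apply FOP_nil.
    + intros psi Hpsi; destruct (periodic_of_periodic_solution _ _ _ Hw Hpsi) as (z & Pz & Ez).
      destruct (periodic_trichotomy omega m a b z Hw Ha Hb Hneg Pz) as [Z|(_ & Rz & [Sz|Sz])].
      * apply Exists_cons_hd; intros t Ht; rewrite (Ez t Ht); apply Z.
      * apply Exists_cons_tl, Exists_cons_hd; apply (Huniq psi zp z); try assumption.
        intros t; apply Rmult_lt_0_compat; [apply Sz | apply Sp].
      * apply Exists_cons_tl, Exists_cons_tl, Exists_cons_hd; apply (Huniq psi zn z);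
        try assumption.
        intros t; specialize (Sz t); specialize (Sn t); simpl; nra.
    + simpl; lia.
  - assert (Hb0 : forall t, b t = 0).
    { intros t; destruct (Hneg t) as [H|H]; [|exact H]; exfalso; apply Hnlt; exists t; exact H. }
    destruct (zero_factor_b0 omega m a b Hw Ha Hb Hb0) as [Hf Hf0].
    assert (Hsign := fun z => periodic_sign_b0 omega m a b z Hw Ha Hb0).
    destruct (Rtotal_order (RInt a 0 omega) 0) as [HA|[HA|HA]].
    (* The integral of [a] is itself the leading coefficient at zero, and it is negative here. *)
    + destruct (positive_periodic omega m a b _ _ Hw Ha Hb HA Hf) as (zp & Pp & Rp & Sp).
      exists (((fun _ => RtoC 0), S (S m)) :: (zp, 1%nat) :: nil).
      split; [|split; [|split]].
      * repeat apply Forall_cons; simpl; try apply Forall_nil; (split; [apply Hps; assumption|]).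
        -- apply (Hmult0 _ (RInt a 0 omega)); [lra | exact Hf].
        -- apply Hmult1; try assumption; intros t; specialize (Sp t); lra.
      * specialize (Sp 0).
        repeat (apply FOP_cons; [repeat apply Forall_cons; try apply Forall_nil; apply Hsame;
          simpl; lra|]).
        apply FOP_nil.
      * intros psi Hpsi; destruct (periodic_of_periodic_solution _ _ _ Hw Hpsi) as (z & Pz & Ez).
        destruct (periodic_trichotomy omega m a b z Hw Ha Hb Hneg Pz) as [Z|(Nz & Rz & [Sz|Sz])].
        -- apply Exists_cons_hd; intros t Ht; rewrite (Ez t Ht); apply Z.
        -- apply Exists_cons_tl, Exists_cons_hd; apply (Huniq psi zp z); try assumption.
           intros t; apply Rmult_lt_0_compat; [apply Sz | apply Sp].
        (* A negative solution would make the integral of [a] positive. *)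
        -- exfalso; destruct (Hsign z Pz Rz Nz) as [s Hs]; specialize (Sz s); nra.
      * simpl; lia.
    + exists (((fun _ => RtoC 0), S (S (S m))) :: nil).
      split; [|split; [|split]].
      * repeat apply Forall_cons; simpl; try apply Forall_nil; (split; [apply Hps; assumption|]).
        apply (Hmult0 _ omega); [lra | apply Hf0, HA].
      * apply FOP_cons; [apply Forall_nil | apply FOP_nil].
      * intros psi Hpsi; destruct (periodic_of_periodic_solution _ _ _ Hw Hpsi) as (z & Pz & Ez).
        destruct (periodic_trichotomy omega m a b z Hw Ha Hb Hneg Pz) as [Z|(Nz & Rz & Sz)].
        -- apply Exists_cons_hd; intros t Ht; rewrite (Ez t Ht); apply Z.
        -- exfalso; destruct (Hsign z Pz Rz Nz) as [s Hs].
           destruct Sz as [Sz|Sz]; specialize (Sz s); nra.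
      * simpl; lia.
    (* The reflected coefficient has integral opposite to that of [a], hence negative, which yields
       a positive solution to reflect back. *)
    + destruct (zero_factor_b0 omega m a' b' Hw Ha' Hb' (Hz' Hb0)) as [Hf1 _].
      assert (HA1 : RInt a' 0 omega < 0) by lra.
      destruct (positive_periodic omega m a' b' _ _ Hw Ha' Hb' HA1 Hf1) as (w & Pw & Rw & Sw).
      destruct (Hrefl w Pw Rw Sw) as (zn & Pn & Rn & Sn).
      exists (((fun _ => RtoC 0), S (S m)) :: (zn, 1%nat) :: nil).
      split; [|split; [|split]].
      * repeat apply Forall_cons; simpl; try apply Forall_nil; (split; [apply Hps; assumption|]).
        -- apply (Hmult0 _ (RInt a 0 omega)); [lra | exact Hf].
        -- apply Hmult1; try assumption; intros t; specialize (Sn t); lra.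
      * specialize (Sn 0).
        repeat (apply FOP_cons; [repeat apply Forall_cons; try apply Forall_nil; apply Hsame;
          simpl; lra|]).
        apply FOP_nil.
      * intros psi Hpsi; destruct (periodic_of_periodic_solution _ _ _ Hw Hpsi) as (z & Pz & Ez).
        destruct (periodic_trichotomy omega m a b z Hw Ha Hb Hneg Pz) as [Z|(Nz & Rz & [Sz|Sz])].
        -- apply Exists_cons_hd; intros t Ht; rewrite (Ez t Ht); apply Z.
        -- exfalso; destruct (Hsign z Pz Rz Nz) as [s Hs]; specialize (Sz s); nra.
        -- apply Exists_cons_tl, Exists_cons_hd; apply (Huniq psi zn z); try assumption.
           intros t; specialize (Sz t); specialize (Sn t); simpl; nra.
      * simpl; lia.
Qed.

(** Equality of predicates, not mere equivalence: [sol] is defined by [epsilon], whose value depends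
    on the predicate, and so [q] transfers only along an equality. *)
Lemma is_solution_ext F G omega :
  (forall t z, interval omega t -> F t z = G t z) -> is_solution F omega = is_solution G omega.
Proof.
  intros E; apply functional_extensionality; intros z; apply propositional_extensionality.
  split; intros H t Ht; specialize (H t Ht); [rewrite <- E | rewrite E]; assumption.
Qed.

Lemma exactly_periodic_solutions_ext F G omega n :
  (forall t z, interval omega t -> F t z = G t z) ->
  exactly_periodic_solutions F omega n -> exactly_periodic_solutions G omega n.
Proof.
  intros E; unfold exactly_periodic_solutions, periodic_solution, multiplicity, q, sol, Q.
  rewrite (is_solution_ext F G omega E); exact (fun H => H).
Qed.

Theorem theorem3p2 :
  forall (n : nat) (omega : R) (alpha beta : R -> R),
    (3 <= n)%nat ->
    0 < omega ->
    continuous_on (interval omega) alpha ->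
    continuous_on (interval omega) beta ->
    (forall t, interval omega t -> beta t <= 0) ->
    exactly_periodic_solutions
      (fun (t : R) (z : C) =>
         (z ^ n + RtoC (alpha t) * z ^ (n - 1)
          + RtoC (beta t) * z ^ (n - 2))%C)
      omega n.
Proof.
  intros n omega alpha beta Hn Hw Ha Hb Hneg; assert (Hw0 := Rlt_le _ _ Hw).
  destruct n as [|[|[|m]]]; try lia.
  (* Clamping leaves the coefficients unchanged on [[0, omega]] and makes continuity and the sign
     condition global. *)
  apply (exactly_periodic_solutions_ext
    (field m (fun t => alpha (clamp omega t)) (fun t => beta (clamp omega t)))).
  - intros t z Ht; unfold field; rewrite (clamp_id omega t Ht); reflexivity.
  - apply exactly_periodic_field; [exact Hw| | |].
    + split; intros t; [apply continuous_on_clamp; assumption | rewrite clamp_idem by exact Hw0;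
      reflexivity].
    + split; intros t; [apply continuous_on_clamp; assumption | rewrite clamp_idem by exact Hw0;
      reflexivity].
    + intros t; apply Hneg, clamp_interval, Hw0.
Qed.
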